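(* Let $3<m<\infty$, let $0\le u_0\in L^1(\mathbb{R})\cap H^1(\mathbb{R})$ with $\int_{\mathbb{R}}x^2u_0\,dx<\infty$ and $M=\int_{\mathbb{R}}u_0\,dx>0$, and let $U_*$ be the optimizer (unique up to translation) of the Sz.-Nagy inequality in $\mathcal{Y}_{M,P_*}$. Assume $$F(u_0)<F(U_* )=\frac{m-3}{3(m+1)}P_*^{m+1},\qquad F(u)=\frac12\int_{\mathbb{R}}(u_x)^2\,dx-\frac1{m+1}\int_{\mathbb{R}}u^{m+1}\,dx .$$ Let $u$ be the maximal weak entropy solution, on $[0,T_w)$, of $u_t=-(uu_{xxx})_x-(u(u^m)_x)_x$ on $\mathbb{R}$ with $u(\cdot,0)=u_0$. (i) If $\|u_0\|_{m+1}>\|U_*\|_{m+1}$, then the solution blows up in finite time, i.e. $T_w<\infty$ and $\limsup_{t\to T_w}\|u_x(\cdot,t)\|_2=\infty$. (ii) If $\|u_0\|_{m+1}<\|U_*\|_{m+1}$, then the solution exists globally in time, i.e. $T_w=\infty$, and $$\lim_{t\to\infty}\int_{\mathbb{R}}x^2u(x,t)\,dx=+\infty.$$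
   Context: $\|\cdot\|_p$ is the norm of $L^p(\mathbb{R})$. The Sz.-Nagy inequality is $\|f\|_{m+1}^{3(m+1)/m}\le C_*\|f\|_1^{(m+3)/m}\|f_x\|_2^2$ for $0\le f\in L^1(\mathbb{R})$ with $f_x\in L^2(\mathbb{R})$, with sharp constant $C_*=C_*(m)$; an optimizer is a nonzero function attaining equality. $\mathcal{Y}_{M,P_*}=\{u\in L^1(\mathbb{R})\cap H^1(\mathbb{R}):u\ge0,\ \|u\|_1=M,\ \|u\|_{m+1}=P_*\}$ with $$P_*=\left(\frac{3(m+1)}{2mC_*M^{\frac{m+3}{m}}}\right)^{\frac{m}{(m+1)(m-3)}}.$$ Weak entropy solution on $[0,T)$: a nonnegative $u\in L^\infty(0,T;L^1(\mathbb{R})\cap H^1(\mathbb{R}))\cap L^2(0,T;H^2(\mathbb{R}))$ with $u^{1/2}u_{xxx}\in L^2(0,T;L^2(\mathbb{R}))$ such that for every $0<t<T$ and $\psi\in C_0^\infty(\mathbb{R})$ $$\int\psi u(\cdot,t)\,dx-\int\psi u_0\,dx=\int_0^t\!\!\int\psi_x\,u\,u_{xxx}\,dx\,ds-\frac{m}{m+1}\int_0^t\!\!\int\psi_{xx}u^{m+1}\,dx\,ds,$$ and $F(u(\cdot,t))+\int_0^t\int u|(u_{xx}+u^m)_x|^2\,dx\,ds\le F(u_0)$. Mass is conserved: $\int u(\cdot,t)\,dx=M$. Maximal solution: the weak entropy solution $u$ on $[0,T_w)$, $T_w\in(0,\infty]$ (i.e. a weak entropy solution on $[0,T)$ for every finite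 $T<T_w$), constructed as the limit along a subsequence $\varepsilon\to0$ of solutions of the regularized problem $\partial_tu_\varepsilon+\partial_x\big(\sqrt{u_\varepsilon^2+\varepsilon^2}\,((u_\varepsilon)_{xxx}+(u_\varepsilon^m)_x)\big)=0$ with mollified initial data $u_\varepsilon(\cdot,0)=J_\varepsilon*u_0$ ($J_\varepsilon$ a standard mollifier), and such that if $T_w<\infty$ then $\|u_x(\cdot,t)\|_2\to\infty$ as $t\to T_w$. *)

(* Defs.v *)
From HB Require Import structures.
From mathcomp Require Export all_boot all_order all_algebra.
From mathcomp Require Export all_classical all_reals all_analysis.
Export Order.TTheory GRing.Theory Num.Theory.
Export numFieldNormedType.Exports.

Set Implicit Arguments.
Unset Strict Implicit.
Unset Printing Implicit Defensive.

Global Open Scope classical_set_scope.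
Global Open Scope ring_scope.

Section WeakDerivatives.
Context {R : realType}.
Local Notation mu := (@lebesgue_measure R).
Implicit Types (Om : set R) (f g phi : R -> R).

Definition Lpnorm (p : \bar R) f : \bar R := 'N[mu]_p[EFin \o f]%E.

Definition test_function Om phi : Prop :=
  (forall n x, derivable (phi^`(n)%classic) x 1) /\
  exists K, [/\ compact K, K `<=` Om & forall x, ~ K x -> phi x = 0].

(* the open-ness of Om is part of [locally_integrable] *)
Definition is_weak_derivative Om f g : Prop :=
  [/\ locally_integrable Om f, locally_integrable Om g &
    forall phi, test_function Om phi ->
      \int[mu]_(x in Om) (f x * phi^`()%classic x) =
      - \int[mu]_(x in Om) (g x * phi x)].

Definition weakly_differentiable Om f : Prop :=
  exists g, is_weak_derivative Om f g.

(* A chosen representative of the weak derivative, which is unique up to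
   a null subset of Om; 0 if f is not weakly differentiable on Om. *)
Definition wderiv Om f : R -> R := xget (cst 0) (is_weak_derivative Om f).

Definition wderivn (n : nat) f : R -> R := iter n (wderiv setT) f.

Definition sobolevH (k : nat) f : Prop :=
  (forall j, (j < k)%N -> weakly_differentiable setT (wderivn j f)) /\
  (forall j, (j <= k)%N -> wderivn j f \in Lfun mu 2%:E).

Definition sobolevH_norm (k : nat) f : R :=
  Num.sqrt (\sum_(j < k.+1) fine (Lpnorm 2%:E (wderivn j f)) ^+ 2).

(* u \in L^p(0, T; X), where u t stands for the function u(., t), N is the
   norm of X, and the a.e. defined function t |-> N (u t) has a
   representative g \in L^p *)
Definition bochner (T : R) (p : \bar R) (X : set (R -> R)) (N : (R -> R) -> R)
    (u : R -> R -> R) : Prop :=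
  measurable_fun (`]0, T[ `*` [set: R]) (fun z : R * R => u z.1 z.2) /\
  exists2 g : R -> R, g \in Lfun mu p &
    {ae mu, forall t, t \in `]0, T[ -> X (u t) /\ g t = N (u t)}.

End WeakDerivatives.

Section SzNagy.
Context {R : realType}.
Local Notation mu := (@lebesgue_measure R).
Implicit Types (m C M P : R) (f : R -> R).

Definition sz_nagy_class f : Prop :=
  [/\ forall x, 0 <= f x, f \in Lfun mu 1%:E, weakly_differentiable setT f
    & wderiv setT f \in Lfun mu 2%:E].

Definition sz_nagy_lhs m f : \bar R :=
  (Lpnorm (m + 1)%:E f `^ (3 * (m + 1) / m))%E.

Definition sz_nagy_rhs m f : \bar R :=
  (Lpnorm 1%:E f `^ ((m + 3) / m) * Lpnorm 2%:E (wderiv setT f) ^+ 2)%E.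

Definition sz_nagy_const m : R :=
  inf [set C | forall f, sz_nagy_class f ->
                 (sz_nagy_lhs m f <= C%:E * sz_nagy_rhs m f)%E].

Definition sz_nagy_optimizer m f : Prop :=
  [/\ sz_nagy_class f, ~ {ae mu, forall x, f x = 0}
    & sz_nagy_lhs m f = ((sz_nagy_const m)%:E * sz_nagy_rhs m f)%E].

Definition Pstar m M : R :=
  (3 * (m + 1) / (2 * m * sz_nagy_const m * M `^ ((m + 3) / m)))
    `^ (m / ((m + 1) * (m - 3))).

Definition Yset m M P : set (R -> R) :=
  [set f | [/\ forall x, 0 <= f x, f \in Lfun mu 1%:E, sobolevH 1 f,
               Lpnorm 1%:E f = M%:E & Lpnorm (m + 1)%:E f = P%:E]].

End SzNagy.

Section ThinFilm.
Context {R : realType}.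
Local Notation mu := (@lebesgue_measure R).
Implicit Types (m T e : R) (f : R -> R) (u v : R -> R -> R).

Definition energy m f : R :=
  2^-1 * \int[mu]_x (wderiv setT f x ^+ 2)
  - (m + 1)^-1 * \int[mu]_x (f x `^ (m + 1)).

Definition second_moment f : \bar R := (\int[mu]_x (x ^+ 2 * f x)%:E)%E.

Definition positivity_set f : set R := [set x | 0 < f x].

(* u_xxx is taken on the positivity set only: on a contact line u_xx may
   jump. Its values elsewhere are irrelevant, since u_xxx only occurs
   multiplied by a positive power of u. *)
Definition D3pos f : R -> R := wderiv (positivity_set f) (wderivn 2 f).

Definition pressure_grad m f : R -> R :=
  wderiv (positivity_set f) (fun x => wderivn 2 f x + f x `^ m).

Definition sqrt_D3 f : R -> R := fun x => Num.sqrt (f x) * D3pos f x.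

Definition L1H1 : set (R -> R) :=
  [set f | f \in Lfun mu 1%:E /\ sobolevH 1 f].

Definition L1H1_norm f : R := fine (Lpnorm 1%:E f) + sobolevH_norm 1 f.

(* u t x stands for u(x, t). The representative of u is chosen such that
   each u(., t) is the continuous representative of an element of H^1(R);
   this makes the positivity set of u(., t) open. *)
Record weak_entropy_solution m (u0 : R -> R) T u : Prop := {
  wes_slice : forall t, 0 < t < T ->
    [/\ forall x, 0 <= u t x, continuous (u t) & L1H1 (u t)] ;
  wes_LooL1H1 : bochner T +oo%E L1H1 L1H1_norm u ;
  wes_L2H2 : bochner T 2%:E (sobolevH 2) (sobolevH_norm 2) u ;
  wes_L2D3 : bochner T 2%:E
    [set f | weakly_differentiable (positivity_set f) (wderivn 2 f) /\
             sqrt_D3 f \in Lfun mu 2%:E]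
    (fun f => fine (Lpnorm 2%:E (sqrt_D3 f))) u ;
  wes_weak : forall t psi, 0 < t < T -> test_function setT psi ->
    \int[mu]_x (psi x * u t x) - \int[mu]_x (psi x * u0 x) =
    \int[mu]_(s in `[0, t])
      (\int[mu]_x (psi^`()%classic x * u s x * D3pos (u s) x))
    - m / (m + 1) * \int[mu]_(s in `[0, t])
      (\int[mu]_x (psi^`(2)%classic x * u s x `^ (m + 1))) ;
  wes_energy : forall t, 0 < t < T ->
    ((energy m (u t))%:E
     + \int[mu]_(s in `[0%R, t])
         \int[mu]_x (u s x * `|pressure_grad m (u s) x| ^+ 2)%:E
     <= (energy m u0)%:E)%E ;
  wes_mass : forall t, 0 < t < T ->
    \int[mu]_x (u t x) = \int[mu]_x (u0 x) }.

Definition standard_mollifier (J : R -> R) : Prop :=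
  [/\ test_function setT J, forall x, 0 <= J x,
      forall x, 1 <= `|x| -> J x = 0 & \int[mu]_x (J x) = 1].

(* the convolution J_e * f, with J_e(x) = J(x / e) / e *)
Definition mollify (J : R -> R) e f : R -> R :=
  fun x => \int[mu]_y (e^-1 * J ((x - y) / e) * f y).

(* s^m, extended to an odd function of s: the solutions of the regularized
   problem need not be nonnegative. *)
Definition odd_pow (s m : R) : R := Num.sg s * `|s| `^ m.

(* Solutions are understood in the energy class, the equation being tested
   against psi and integrated in time as in [weak_entropy_solution]. *)
Record regularized_solution m e (v0 : R -> R) T v : Prop := {
  reg_slice : forall t, 0 < t < T -> sobolevH 1 (v t) ;
  reg_LooH1 : bochner T +oo%E (sobolevH 1) (sobolevH_norm 1) v ;
  reg_L2H3 : bochner T 2%:E (sobolevH 3) (sobolevH_norm 3) v ;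
  reg_weak : forall t psi, 0 < t < T -> test_function setT psi ->
    \int[mu]_x (psi x * v t x) - \int[mu]_x (psi x * v0 x) =
    \int[mu]_(s in `[0, t])
      (\int[mu]_x (psi^`()%classic x * Num.sqrt (v s x ^+ 2 + e ^+ 2) *
         (wderivn 3 (v s) x + wderiv setT (fun y => odd_pow (v s y) m) x))) }.

(* The convergence of v k to u is in L^1_loc(R x [0, Tw)); v k only has to
   be a solution on [0, T), T < Tw, for k large enough depending on T. *)
Definition regularization_limit m (u0 : R -> R) (Tw : \bar R) u : Prop :=
  exists (J : R -> R) (eps : nat -> R) (v : nat -> R -> R -> R),
  [/\ standard_mollifier J, (forall k, 0 < eps k), eps @ \oo --> (0 : R) &
    forall T, 0 < T -> (T%:E < Tw)%E ->
      (\forall k \near \oo,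
         regularized_solution m (eps k) (mollify J (eps k) u0) T (v k)) /\
      (forall A : R,
        (\int[mu]_(t in `]0%R, T[) \int[mu]_(x in `[(- A)%R, A])
           `|v k t x - u t x|%:E)%E @[k --> \oo] --> (0 : \bar R))].

Record maximal_weak_entropy_solution m (u0 : R -> R) (Tw : \bar R) u : Prop := {
  max_Tw : (0 < Tw)%E ;
  max_init : {ae mu, forall x, u 0 x = u0 x} ;
  max_sol : forall T, 0 < T -> (T%:E < Tw)%E -> weak_entropy_solution m u0 T u ;
  max_lim : regularization_limit m u0 Tw u ;
  max_blowup : forall T, Tw = T%:E ->
    Lpnorm 2%:E (wderiv setT (u t)) @[t --> T^'-] --> +oo%E }.

End ThinFilm.

(* Main.v *)
Require Import Defs.
From mathcomp Require Import all_boot all_order all_algebra.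
From mathcomp Require Import all_classical all_reals all_analysis.
From mathcomp Require Import measurable_realfun ess_sup_inf ring lra.

Set Implicit Arguments.
Unset Strict Implicit.
Unset Printing Implicit Defensive.

(** With Y(f) = int f^(m+1), mass M and K = 1 / (Cstar M^((m+3)/m)), the Sz.-Nagy
    inequality reads K Y^(3/m) <= int f_x^2, hence G(Y(f)) <= F(f) for
    G(Y) = K Y^(3/m) / 2 - Y / (m+1). The function G is maximal at
    Ystar = Pstar^(m+1), and G(Ystar) = F(Ustar). As the energy does not increase,
    F(u_0) < F(Ustar) keeps Y(u(t)) at a distance d from Ystar; since Y(u(t)) is
    continuous in time (off a null set of times), it stays on the side of Ystar
    where it starts.

    Testing the equation with truncations of x^2, and integrating by parts
    twice on the positivity set (u_x vanishes wherever u does, as u is C^1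
    and nonnegative), gives the virial identity
      d/dt int x^2 u = 3 int u_x^2 - 2m/(m+1) Y(u) = 6 F(u) - 2(m-3)/(m+1) Y(u).
    If Y(u_0) > Ystar, the right-hand side is at most 6 (F(u_0) - F(Ustar)) < 0, so
    the second moment would become negative in a finite time. If Y(u_0) < Ystar,
    the energy bounds u_x, so that the solution is global, and the right-hand
    side is at least 3 K Y^(3/m) - 2m/(m+1) Y >= 0. If the second moment stayed
    bounded, then Y would be bounded below, since mass cannot escape, and the
    second moment would grow linearly. *)

(** * Smooth functions *)

(** The notion of solution leaves three gaps that shape the proof. First, u_xxx exists only as a
    weak derivative on the positivity set, defined through smooth test functions. The integration by
    parts tests it with psi' times a cutoff of u, which is only C^1; the bound on sqrt(u) u_xxx then
    allows the cutoff to be removed at the contact line. Second, regularity and bounds hold only off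
    a null set of times, and the integrands in time are not known to be measurable; they are
    replaced by functionals of u and u_x, set to 0 at the exceptional times. Third, no continuity in
    time is given. Averages of u against the translates of one mollifier are Lipschitz in time with
    a common constant, and the H^1 bound turns closeness of these averages into closeness in the sup
    norm, hence of Y. The distance d comes from the continuity of G at Ystar and the strict energy
    inequality; steps that change Y by at most d / 2 cannot cross Ystar. The mollifier is the one
    that comes with the regularized problem, and its primitive, a smooth step, provides all
    cutoffs. *)

Section Smooth.
Context {R : realType}.
Implicit Types f g : R -> R.

Definition smooth f := forall n x, derivable (f^`(n)%classic) x 1.

(** The recursion takes the innermost derivative first, with f varying; this is the form in which
    the Leibniz rule can be proved by induction on n, since the derivative of a product is a sum of
    products. *)
Fixpoint difn (n : nat) f : Prop :=
  (forall x, derivable f x 1) /\ (if n is n'.+1 then difn n' (f^`()%classic) else True).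

Lemma difn_derivable n f : difn n f -> forall x, derivable f x 1.
Proof. by case: n => [|n] []. Qed.

Lemma smooth_difn f : smooth f <-> forall n, difn n f.
Proof.
split=> [sf n|df n].
  elim: n f sf => [|n IH] f sf; first by split => //; exact: (sf 0%N).
  split; first exact: (sf 0%N).
  by apply: IH => k x; rewrite -derive1Sn; exact: sf.
elim: n f df => [|n IH] f df x; first exact: (difn_derivable (df 0%N)).
by rewrite derive1Sn; apply: IH => k; case: (df k.+1).
Qed.

Lemma difnS n f : difn n.+1 f -> difn n f.
Proof.
elim: n f => [|n IH] f [df dn]; first by split.
by split => //; exact: IH.
Qed.

Lemma derive1_add f g : (forall x, derivable f x 1) -> (forall x, derivable g x 1) ->
  (fun x => f x + g x)^`()%classic = (fun x => f^`()%classic x + g^`()%classic x).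
Proof. by move=> df dg; apply/funext => x; rewrite !derive1E deriveD. Qed.

Lemma derive1_mul f g : (forall x, derivable f x 1) -> (forall x, derivable g x 1) ->
  (fun x => f x * g x)^`()%classic =
  (fun x => f^`()%classic x * g x + f x * g^`()%classic x).
Proof.
move=> df dg; apply/funext => x; rewrite !derive1E deriveM//= addrC.
by rewrite [in RHS]mulrC.
Qed.

Lemma is_derive_affine f (a b c x : R) : derivable f (a * x + b) 1 ->
  is_derive x 1 (fun y => c * f (a * y + b)) (c * a * f^`()%classic (a * x + b)).
Proof.
move=> df.
have hd : is_derive x 1 (fun y : R => a * y + b) a.
  have -> : (fun y : R => a * y + b) = (a *: id + cst b)%R by apply/funext.
  have := is_deriveD (is_deriveZ a (is_derive_id x 1)) (is_derive_cst b x 1).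
  by rewrite addr0 /GRing.scale/= mulr1.
have hf : is_derive (a * x + b) 1 f (f^`()%classic (a * x + b)).
  by rewrite derive1E; exact: derivableP.
have -> : (fun y => c * f (a * y + b)) = c *: (f \o (fun y => a * y + b)).
  by apply/funext.
have hc := @is_derive1_comp _ f (fun y => a * y + b) x _ _ hf hd.
apply: is_derive_eq.
rewrite /GRing.scale/= /GRing.scale/=; ring.
Qed.

Lemma derive1_affine f (a b c : R) : (forall x, derivable f x 1) ->
  (fun y => c * f (a * y + b))^`()%classic =
  (fun y => c * a * f^`()%classic (a * y + b)).
Proof.
move=> df; apply/funext => x; rewrite derive1E.
by have h := is_derive_affine c (df (a * x + b)); rewrite derive_val.
Qed.

Lemma difn_add n f g : difn n f -> difn n g -> difn n (fun x => f x + g x).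
Proof.
elim: n f g => [|n IH] f g [df fn] [dg gn]; (split; first by move=> x; apply: derivableD).
  by [].
by rewrite derive1_add//; exact: IH.
Qed.

Lemma difn_mul n f g : difn n f -> difn n g -> difn n (fun x => f x * g x).
Proof.
elim: n f g => [|n IH] f g df dg.
  by case: df dg => df _ [dg _]; split => // x; apply: derivableM.
have [df1 df2] := df; have [dg1 dg2] := dg.
split; first by move=> x; apply: derivableM.
by rewrite derive1_mul//; apply: difn_add; apply: IH => //; exact: difnS.
Qed.

Lemma difn_affine n f (a b c : R) : difn n f -> difn n (fun y => c * f (a * y + b)).
Proof.
elim: n f c => [|n IH] f c [df fn];
  (split; first by move=> x; have := is_derive_affine c (df (a * x + b)); case).
  by [].
by rewrite derive1_affine//; exact: IH.
Qed.

Lemma smoothD f g : smooth f -> smooth g -> smooth (fun x => f x + g x).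
Proof.
move=> /smooth_difn sf /smooth_difn sg; apply/smooth_difn => n; exact: difn_add.
Qed.

Lemma smoothM f g : smooth f -> smooth g -> smooth (fun x => f x * g x).
Proof.
move=> /smooth_difn sf /smooth_difn sg; apply/smooth_difn => n; exact: difn_mul.
Qed.

Lemma smooth_affine f (a b c : R) : smooth f -> smooth (fun y => c * f (a * y + b)).
Proof. move=> /smooth_difn sf; apply/smooth_difn => n; exact: difn_affine. Qed.

Lemma derive1n_affine n f (a b c : R) : smooth f ->
  (fun y => c * f (a * y + b))^`(n)%classic =
  (fun y => c * a ^+ n * f^`(n)%classic (a * y + b)).
Proof.
move=> sf; elim: n => [|n IH]; first by apply/funext => y /=; rewrite expr0 mulr1.
rewrite derive1nS IH derive1_affine; last by move=> x; exact: (sf n).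
by apply/funext => y; rewrite exprSr derive1nS mulrA.
Qed.

Lemma smooth_derive1 f : smooth f -> smooth (f^`()%classic).
Proof. by move=> sf n x; rewrite -derive1Sn; exact: sf. Qed.

Lemma smooth_cst (c : R) : smooth (cst c).
Proof.
have H0 n : (cst c : R -> R)^`(n.+1)%classic = cst 0.
  elim: n => [|n IH]; first by rewrite derive1n1; apply/funext=> x; rewrite derive1_cst.
  by rewrite derive1nS IH; apply/funext=> x; rewrite derive1_cst.
by case=> [|n] x; rewrite ?H0; exact: derivable_cst.
Qed.

Lemma smooth_id : smooth (fun x : R => x).
Proof.
apply/smooth_difn => -[|n]; (split; first by move=> x; exact: derivable_id).
  by [].
have -> : (fun x : R => x)^`()%classic = cst 1.
  by apply/funext => x; rewrite derive1E derive_val.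
exact: ((smooth_difn _).1 (@smooth_cst 1) n).
Qed.

Lemma smooth_continuous f : smooth f -> continuous f.
Proof.
by move=> sf x; apply: differentiable_continuous; apply/derivable1_diffP; exact: (sf 0%N).
Qed.

Lemma smooth_derive1n n f : smooth f -> smooth (f^`(n)%classic).
Proof.
by move=> sf; elim: n => [//|n IH]; rewrite derive1nS; exact: smooth_derive1.
Qed.

Lemma derive1n_out n f (K : set R) : closed K ->
  (forall x, ~ K x -> f x = 0) -> forall x, ~ K x -> f^`(n)%classic x = 0.
Proof.
move=> cK; elim: n f => [//|n IH] f f0 x nKx; rewrite derive1Sn.
apply: IH => // {nKx}{}x nKx.
rewrite -(derive1_cst (0:R) x); rewrite !derive1E.
apply: near_eq_derive.
have : nbhs x (~` K) by apply: open_nbhs_nbhs; split => //; exact: closed_openC.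
apply: filterS => y /= nKy; exact: f0.
Qed.

Lemma continuous_compact_supp_bounded f (K : set R) : compact K -> continuous f ->
  (forall x, ~ K x -> f x = 0) -> exists2 C : R, 0 <= C & forall x, `|f x| <= C.
Proof.
move=> cK cf f0.
have : bounded_set (f @` K).
  by apply: compact_bounded; apply: continuous_compact => //; exact: continuous_subspaceT.
move=> [C [Cr hC]]; exists (`|C| + 1) => [|x]; first by rewrite addr_ge0.
have [Kx|nKx] := pselect (K x).
  by apply: (hC (`|C| + 1)); [rewrite ltr_pwDr// ler_norm|exists x].
by rewrite f0// normr0 addr_ge0.
Qed.

Lemma test_function_bounded n f Om : test_function Om f ->
  exists2 C : R, 0 <= C & forall x, `|f^`(n)%classic x| <= C.
Proof.
move=> [sf [K [cK _ f0]]].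
apply: (@continuous_compact_supp_bounded _ K) => //.
  by apply: smooth_continuous; exact: smooth_derive1n.
by apply: derive1n_out => //; apply: compact_closed => //; exact: Rhausdorff.
Qed.

End Smooth.

(** * Absolutely continuous functions *)

Section AbsCont.
Local Open Scope classical_set_scope.
Local Open Scope ring_scope.
Context {R : realType}.
Local Notation mu := (@lebesgue_measure R).
Implicit Types (f g F G : R -> R) (a b c : R).

(* L need only be dense: steps of length less than d between points of L. *)
Lemma chaining (L : set R) (P : R -> R -> Prop) (d : R) : 0 < d ->
  (forall x y c e, L x -> L y -> x <= c -> c < e -> e <= y ->
     exists z, [/\ L z, c < z & z < e]) ->
  (forall x y, L x -> L y -> x < y -> y - x < d -> P x y) ->
  (forall x y z, L x -> L y -> L z -> x < y -> y < z -> P x y -> P y z -> P x z) ->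
  forall x y, L x -> L y -> x < y -> P x y.
Proof.
move=> d0 Ld Pd Pt.
have H n : forall x y, L x -> L y -> x < y -> y - x < n%:R * (d / 2) -> P x y.
  elim: n => [|n IH] x y Lx Ly xy; first by rewrite mul0r => h; lra.
  rewrite -natr1 mulrDl mul1r => yxn.
  have [yxd|dyx] := Order.TotalTheory.ltP (y - x) d; first exact: Pd.
  (* The next point is between d / 2 and d away: close enough for [Pd], far enough to use up one of
     the n + 1 half-steps. *)
  have [| | |z [Lz z1 z2]] := Ld x y (x + d / 2) (x + d) Lx Ly; [lra|lra|lra|].
  apply: (Pt x z y) => //; [lra|lra|apply: Pd => //; lra|apply: IH => //; lra].
move=> x y Lx Ly xy.
apply: (H (Num.truncn ((y - x) / (d / 2))).+1) => //.
by rewrite -ltr_pdivrMr ?truncnS_gt// divr_gt0.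
Qed.

Definition lint f := forall a b, mu.-integrable `[a, b] (EFin \o f).

(** Local absolute continuity, with the fundamental theorem of calculus as definition; f is the
    derivative of F up to a null set. *)
Definition abscont F f := lint f /\
  forall a b, a <= b -> F b - F a = \int[mu]_(x in `[a, b]) f x.

Lemma integrable_lint f : mu.-integrable setT (EFin \o f) -> lint f.
Proof. by move=> h a b; apply: integrableS h. Qed.

Lemma lint_measurable f : lint f -> measurable_fun setT f.
Proof.
move=> lf; have -> : [set: R] = \bigcup_(n in setT) [set` `[- (n%:R : R), n%:R]].
  apply/seteqP; split => // x _; exists (Num.truncn `|x|).+1 => //=.
  have := truncnS_gt `|x|; rewrite in_itv/= -ler_norml => /ltW//.
apply/measurable_fun_bigcup => // n; apply/measurable_EFinP.
exact: measurable_int (lf _ _).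
Qed.

Lemma locally_integrable_lint f : locally_integrable setT f <-> lint f.
Proof.
split=> [[mf _ fK] a b|lf].
  apply/integrableP; split; first by apply/measurable_EFinP; exact: measurable_funTS.
  by apply: fK => //; exact: segment_compact.
split; [exact: lint_measurable|exact: openT|move=> K _ cK].
have [r Kr] : exists r : R, K `<=` `[-r, r].
  have [M [Mr HM]] := compact_bounded cK; exists (`|M| + 1) => x Kx /=.
  by rewrite in_itv/= -ler_norml; apply: HM => //; rewrite ltr_pwDr// ler_norm.
have /integrableP[_] := lf (-r) r; apply: le_lt_trans.
apply: ge0_subset_integral => //.
  exact: compact_measurable.
apply/measurable_EFinP/measurableT_comp => //; apply: measurable_funTS.
exact: lint_measurable lf.
Qed.

Lemma continuous_lint f : continuous f -> lint f.
Proof.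
move=> cf a b; apply: continuous_compact_integrable; first exact: segment_compact.
exact: continuous_subspaceT.
Qed.

Lemma lintMl F g : continuous F -> lint g -> lint (fun x => F x * g x).
Proof.
move=> cF lg a b.
have -> : EFin \o (fun x => F x * g x) = ((EFin \o F) \* (EFin \o g))%E.
  by apply/funext => x /=; rewrite EFinM.
apply: integrableMr => //; first by apply: measurable_funTS; exact: continuous_measurable_fun.
have : bounded_set (F @` `[a, b]).
  apply: compact_bounded; apply: continuous_compact; last exact: segment_compact.
  exact: continuous_subspaceT.
move=> [M [Mr HM]]; exists M; split => // N MN x xab; apply: HM => //.
Qed.

Lemma lintMr f G : lint f -> continuous G -> lint (fun x => f x * G x).
Proof.
move=> lf cG; have := lintMl cG lf.
by congr lint; apply/funext => x; rewrite mulrC.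
Qed.

Lemma lintD f g : lint f -> lint g -> lint (fun x => f x + g x).
Proof. by move=> lf lg a b; exact: integrableD (lf a b) (lg a b). Qed.

Lemma lintN f : lint f -> lint (fun x => - f x).
Proof. by move=> lf a b; exact: integrableN (lf a b). Qed.

Lemma lintB f g : lint f -> lint g -> lint (fun x => f x - g x).
Proof. by move=> lf lg; apply: lintD => //; exact: lintN. Qed.

Lemma lintZ k f : lint f -> lint (fun x => k * f x).
Proof. by move=> lf a b; exact: integrableZl (lf a b). Qed.

Lemma lint_norm f : lint f -> lint (fun x => `|f x|).
Proof. by move=> lf a b; exact: integrable_norm (lf a b). Qed.

Lemma Rint_split f a b c : lint f -> a <= b -> b <= c ->
  \int[mu]_(x in `[a, c]) f x =
  \int[mu]_(x in `[a, b]) f x + \int[mu]_(x in `[b, c]) f x.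
Proof.
move=> lf ab bc; rewrite -(@Rintegral_itv_obnd_cbnd _ b).
  by rewrite -(@Rintegral_itvB _ f (BLeft a) (BRight c) b)// addrC subrK.
by apply: integrableS (lf b c) => //; apply: subset_itvr; rewrite bnd_simp.
Qed.

Lemma lint_unif f a b (e : R) : lint f -> 0 < e -> exists2 d : R, 0 < d &
  forall x y, a <= x -> x <= y -> y <= b -> y - x < d ->
    \int[mu]_(s in `[x, y]) `|f s| < e.
Proof.
move=> lf e0.
have iT : mu.-integrable setT (EFin \o (f \_ `[a, b])).
  by rewrite -restrict_EFin; exact/(integrable_mkcond _ _).1/lf.
have [d [d0 hd]] := integral_normr_continuous iT e0.
exists d => // x y ax xy yb yx.
have -> : \int[mu]_(s in `[x, y]) `|f s| = \int[mu]_(s in `[x, y]) `|(f \_ `[a, b]) s|.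
  apply: eq_Rintegral => s; rewrite inE/= in_itv/= => /andP[xs sy].
  rewrite patchE mem_set//= in_itv/=; lra.
have mxy : (mu `[x, y] < d%:E)%E.
  by rewrite lebesgue_measure_itv/= lte_fin; case: ifPn => //; rewrite -EFinD lte_fin.
exact: hd.
Qed.

Lemma abscont_norm_le F f a b : abscont F f -> a <= b ->
  `|F b - F a| <= \int[mu]_(x in `[a, b]) `|f x|.
Proof. by move=> [lf Ff] ab; rewrite Ff//; apply: le_normr_Rintegral. Qed.

Lemma abscont_unif F f a b (e : R) : abscont F f -> 0 < e -> exists2 d : R, 0 < d &
  forall x y, a <= x -> x <= b -> a <= y -> y <= b -> `|y - x| < d -> `|F y - F x| < e.
Proof.
move=> Ff e0; have [lf _] := Ff; have [d d0 hd] := lint_unif a b lf e0.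
exists d => // x y ax xb ay yb yx.
have [xy|yx'] := Order.TotalTheory.leP x y.
  apply: le_lt_trans (abscont_norm_le Ff xy) _; apply: hd => //.
  by move: yx; rewrite ger0_norm ?subr_ge0.
rewrite distrC; apply: le_lt_trans (abscont_norm_le Ff (ltW yx')) _; apply: hd => //; first exact: ltW.
by move: yx; rewrite distrC ger0_norm ?subr_ge0 ?ltW.
Qed.

Lemma abscont_continuous F f : abscont F f -> continuous F.
Proof.
move=> Ff x; apply/cvgrPdist_lt => e e0.
have [d d0 hd] := abscont_unif (x - 1) (x + 1) Ff e0.
near=> y; rewrite distrC; apply: hd; [lra|lra| | |].
- near: y; exists 1 => //= y /=; rewrite distrC => /ltr_distlCDr; lra.
- near: y; exists 1 => //= y /=; rewrite distrC => /ltr_distlDr; lra.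
- near: y; exists d => //= y /=; by rewrite distrC.
Unshelve. all: end_near. Qed.

(** On a short interval, uniform continuity of F and G makes the increment of F G differ from the
    integral of f G + F g by at most e times the integral of |f| + |g|. Both sides add up along a
    chain of short intervals, and e is arbitrary. *)
Lemma abscontM F f G g : abscont F f -> abscont G g ->
  abscont (fun x => F x * G x) (fun x => f x * G x + F x * g x).
Proof.
move=> Ff Gg; have [lf eF] := Ff; have [lg eG] := Gg.
have cF := abscont_continuous Ff; have cG := abscont_continuous Gg.
have lh : lint (fun x => f x * G x + F x * g x).
  by apply: lintD; [exact: lintMr|exact: lintMl].
split => // a b; rewrite le_eqVlt => /predU1P[<-|ab].
  by rewrite subrr set_itv1 Rintegral_set1.
pose S x y := \int[mu]_(s in `[x, y]) (`|f s| + `|g s|).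
have lS : lint (fun s => `|f s| + `|g s|) by apply: lintD; exact: lint_norm.
suff H (e : R) : 0 < e ->
    `|F b * G b - F a * G a - \int[mu]_(x in `[a, b]) (f x * G x + F x * g x)| <= e * S a b.
  apply/eqP; rewrite -subr_eq0 -normr_le0; apply/ler_addgt0Pl => e e0; rewrite addr0.
  have S0 : 0 <= S a b by apply: Rintegral_ge0 => x _; rewrite addr_ge0.
  apply: le_trans (H (e / (S a b + 1)) _) _; first by rewrite divr_gt0// ltr_wpDl.
  rewrite mulrAC ler_pdivrMr ?ltr_wpDl//; nra.
move=> e0; have [d1 d10 u1] := abscont_unif a b Ff e0.
have [d2 d20 u2] := abscont_unif a b Gg e0.
apply: (@chaining `[a, b] (fun x y =>
  `|F y * G y - F x * G x - \int[mu]_(s in `[x, y]) (f s * G s + F s * g s)| <= e * S x y)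
  (Num.min d1 d2)) => //; last 2 first.
- by rewrite /= in_itv/= lexx ltW.
- by rewrite /= in_itv/= lexx ltW.
- by rewrite lt_min d10.
- move=> x y c z; rewrite /= !in_itv/= => /andP[? ?] /andP[? ?] ? ? ?.
  by exists ((c + z) / 2); rewrite in_itv/=; split; lra.
- move=> x y; rewrite /= !in_itv/= => /andP[ax xb] /andP[ay yb] xy.
  rewrite lt_min => /andP[yx1 yx2].
  have -> : F y * G y - F x * G x = F y * (G y - G x) + (F y - F x) * G x by ring.
  rewrite eF ?eG ?(ltW xy)//.
  rewrite -!RintegralZl// -RintegralZr// -RintegralD//; last 2 first.
  - exact: (lintZ (F y) lg x y).
  - apply: (lintMr lf (G := cst (G x))) => //; exact: cst_continuous.
  have lk1 : lint (fun s => F y * g s + f s * G x).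
    apply: lintD; first exact: lintZ.
    apply: (lintMr lf (G := cst (G x))) => //; exact: cst_continuous.
  rewrite -RintegralB; [|by []|exact: lk1|exact: lh].
  have lk : lint (fun s => F y * g s + f s * G x - (f s * G s + F s * g s)).
    exact: lintB.
  apply: le_trans (le_normr_Rintegral _ (lk x y)) _ => //.
  apply: le_Rintegral => //.
  - exact: (lint_norm lk x y).
  - exact: (lintZ e lS x y).
  move=> s; rewrite /= in_itv/= => /andP[xs sy].
  have -> : F y * g s + f s * G x - (f s * G s + F s * g s) =
            (F y - F s) * g s + (G x - G s) * f s by ring.
  apply: le_trans (ler_normD _ _) _; rewrite !normrM mulrDr addrC.
  apply: lerD; apply: ler_wpM2r => //; apply: ltW.
    apply: u2 => //; [exact: le_trans xs|exact: le_trans yb|].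
    by rewrite distrC ger0_norm ?subr_ge0//; apply: le_lt_trans yx2; rewrite lerD2r.
  apply: u1 => //; [exact: le_trans xs|exact: le_trans yb|].
  by rewrite ger0_norm ?subr_ge0//; apply: le_lt_trans yx1; rewrite lerD2l lerN2.
- move=> x y z; rewrite /= !in_itv/= => /andP[ax xb] /andP[ay yb] /andP[az zb] xy yz Pxy Pyz.
  rewrite /S (Rint_split lh (ltW xy) (ltW yz)) (Rint_split lS (ltW xy) (ltW yz)).
  rewrite mulrDr; apply: (le_trans _ (lerD Pxy Pyz)); apply: (le_trans _ (ler_normD _ _)).
  by rewrite le_eqVlt; apply/predU1P; left; congr (`|_|); ring.
Qed.

Lemma abscontD F f G g : abscont F f -> abscont G g -> abscont (fun x => F x + G x) (fun x => f x + g x).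
Proof.
move=> [lf Ff] [lg Gg]; split; first exact: lintD.
move=> a b ab; rewrite RintegralD//.
by rewrite -Ff// -Gg//; ring.
Qed.

Lemma abscontZ k F f : abscont F f -> abscont (fun x => k * F x) (fun x => k * f x).
Proof.
move=> [lf Ff]; split; first exact: lintZ.
by move=> a b ab; rewrite RintegralZl// -Ff//; ring.
Qed.

Lemma C1_abscont F f : (forall x, derivable F x 1) -> F^`()%classic = f -> continuous f -> abscont F f.
Proof.
move=> dF Ff cf; split; first exact: continuous_lint.
move=> a b; rewrite le_eqVlt => /predU1P[<-|ab].
  by rewrite subrr set_itv1 Rintegral_set1.
rewrite /Rintegral (@continuous_FTC2 _ f F)//.
- exact: continuous_subspaceT.
- split; first by move=> x _; exact: dF.
    apply: cvg_at_right_filter; apply: differentiable_continuous; exact/derivable1_diffP.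
  apply: cvg_at_left_filter; apply: differentiable_continuous; exact/derivable1_diffP.
- by move=> x _; rewrite Ff.
Qed.

Lemma abscont_derive F f : abscont F f -> continuous f ->
  (forall x, derivable F x 1) /\ F^`()%classic = f.
Proof.
move=> [lf Ff] cf.
suff H x : derivable F x 1 /\ F^`()%classic x = f x.
  by split => [x|]; [have [] := H x|apply/funext => x; have [] := H x].
pose a := x - 1.
have [||dG eG] := @continuous_FTC1_closed R f a x (x + 1) _ (lf _ _) _ (cf x); [lra|rewrite/a; lra|].
have eqn : \forall y \near x, F y = F a + \int[mu]_(t in `[a, y]) f t.
  near=> y; rewrite -Ff; first by ring.
  near: y; exists 1 => //= y /=; rewrite distrC => /ltr_distlCDr; rewrite /a; lra.
have : is_derive x 1 (fun y => F a + \int[mu]_(t in `[a, y]) f t) (f x).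
  have h : is_derive x 1 (fun y => \int[mu]_(t in `[a, y]) f t) (f x).
    by rewrite -eG derive1E; exact: derivableP.
  by have := is_deriveD (is_derive_cst (F a) x 1) h; rewrite add0r.
have eqn' : \forall y \near x, F a + \int[mu]_(t in `[a, y]) f t = F y.
  by apply: filterS eqn => y ->.
move=> /(near_eq_is_derive eqn') h.
by split; [exact: ex_derive|rewrite derive1E derive_val].
Unshelve. all: end_near. Qed.

Lemma abscont_compact_supp F f (A : R) : abscont F f -> 0 <= A ->
  (forall x, A <= `|x| -> F x = 0) -> (forall x, A < `|x| -> f x = 0) ->
  \int[mu]_x f x = 0.
Proof.
move=> [lf Ff] A0 F0 f0.
transitivity (\int[mu]_(x in `[- A, A]) f x).
  rewrite [RHS]Rintegral_mkcond; apply: eq_Rintegral => x _.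
  rewrite patchE; case: ifPn => //; rewrite notin_setE/= in_itv/= -ler_norml => /negP.
  by rewrite -ltNge => /f0.
rewrite -Ff; last lra.
by rewrite !F0 ?subr0// ?normrN ger0_norm.
Qed.

End AbsCont.

(** * Mollifiers and increments of weakly differentiable functions *)

Section WeakDer.
Local Open Scope classical_set_scope.
Local Open Scope ring_scope.
Context {R : realType}.
Local Notation mu := (@lebesgue_measure R).
Implicit Types (f g F G : R -> R) (a b c d e x y z A C : R).

Lemma Rdominated dp (T : measurableType dp) (nu : {measure set T -> \bar R}) (D : set T)
    (f_ : nat -> T -> R) (f g : T -> R) :
  measurable D -> (forall n, measurable_fun D (f_ n)) -> measurable_fun D f ->
  {ae nu, forall x : T, D x -> f_ n x @[n --> \oo] --> f x} ->
  nu.-integrable D (EFin \o g) ->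
  (forall n (x : T), D x -> `|f_ n x| <= g x) ->
  nu.-integrable D (EFin \o f) /\
  \int[nu]_(x in D) f_ n x @[n --> \oo] --> \int[nu]_(x in D) f x.
Proof.
move=> mD mf_ mf cf ig fg.
have [||||| if_ _ cif] := @dominated_convergence _ _ R nu D mD
  (fun n => EFin \o f_ n) (EFin \o f) (EFin \o g).
- by move=> n; exact/measurable_EFinP.
- exact/measurable_EFinP.
- by apply: filterS cf => x + Dx => /(_ Dx) h; apply: cvg_EFin => //; exact: nearW.
- exact: ig.
- by apply: aeW => x n Dx; rewrite lee_fin; exact: fg.
split => //; apply: fine_cvg; rewrite fineK; first exact: cif.
exact: integrable_fin_num.
Qed.

Lemma integrable_csupp (k g : R -> R) (A : R) : continuous k -> lint g ->
  (forall x, A < `|x| -> k x = 0) -> mu.-integrable setT (EFin \o (fun x => k x * g x)).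
Proof.
move=> ck lg k0.
have := lintMl ck lg (- A) A; move/(integrable_mkcond _ _) => h.
have /h : measurable (`[- A, A] : set R) by [].
apply: eq_integrable => // x _; rewrite patchE /=; case: ifPn => //.
by rewrite notin_setE/= in_itv/= -ler_norml => /negP; rewrite -ltNge => /k0 ->; rewrite mul0r.
Qed.

Lemma ae_dense (P : R -> Prop) : {ae mu, forall x, P x} ->
  forall a b, a < b -> exists2 x, P x & a < x < b.
Proof.
move=> [N [mN N0 PN]] a b ab; apply: contrapT => nex.
have sub : `]a, b[ `<=` N.
  move=> x /= xab; apply: PN => /= Px; by apply: nex; exists x.
have : (mu `]a, b[ <= mu N)%E by apply: le_measure => //; rewrite inE.
by rewrite N0 lebesgue_measure_itv/= lte_fin ab -EFinD lee_fin leNgt subr_gt0 ab.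
Qed.

(** * Smooth steps and approximate identities from a mollifier *)

Section Step.
Variables (J : R -> R).
Hypothesis hJ : standard_mollifier J.

(** A smooth Heaviside function, 0 up to -1 and 1 from 1 on. Its affine rescalings give the smoothed
    indicators, the cutoff near the contact line and the truncation of x^2. *)
Definition step x : R := \int[mu]_(t in `]-oo, x]) J t.

Let sJ : smooth J. Proof. by case: hJ => -[]. Qed.
Let J0 : forall x, 0 <= J x. Proof. by case: hJ. Qed.
Let J1 : forall x, 1 <= `|x| -> J x = 0. Proof. by case: hJ. Qed.
Let iJ : \int[mu]_x J x = 1. Proof. by case: hJ. Qed.

Lemma mollifier_integrable : mu.-integrable setT (EFin \o J).
Proof.
have := @integrable_csupp J (cst 1) 1 (smooth_continuous sJ).
have l1 : lint (cst 1 : R -> R) by apply: continuous_lint; exact: cst_continuous.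
move=> /(_ l1); rewrite (_ : (fun x => _) = J); last by apply/funext => x; rewrite mulr1.
by apply=> x /ltW /J1.
Qed.

Lemma step_abscont : abscont step J.
Proof.
split; first by apply: continuous_lint; exact: smooth_continuous.
move=> a b ab; rewrite /step (@Rintegral_itvB _ J -oo%O (BRight b))//.
  rewrite Rintegral_itv_obnd_cbnd//.
  by apply: integrableS mollifier_integrable.
by apply: integrableS mollifier_integrable.
Qed.

Lemma step_derive : (forall x, derivable step x 1) /\ step^`()%classic = J.
Proof. by apply: abscont_derive step_abscont _; exact: smooth_continuous. Qed.

Lemma step_smooth : smooth step.
Proof.
have [ds es] := step_derive.
by case=> [|n] x; rewrite ?derive1Sn ?es; [exact: ds|exact: sJ].
Qed.

Lemma step0 x : x <= -1 -> step x = 0.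
Proof.
move=> x1; rewrite -(mul0r (fine (mu `]-oo, x]))) -Rintegral_cst//.
apply: eq_Rintegral => y; rewrite inE/= in_itv/= => yx; rewrite J1// ler0_norm; lra.
Qed.

Lemma step1 x : 1 <= x -> step x = 1.
Proof.
move=> x1; rewrite -iJ /step Rintegral_mkcond; apply: eq_Rintegral => y _.
rewrite patchE; case: ifPn => //; rewrite notin_setE/= in_itv/= => /negP.
by rewrite -ltNge => xy; rewrite J1// ger0_norm; lra.
Qed.

Lemma step_ge0 x : 0 <= step x.
Proof. by apply: Rintegral_ge0. Qed.

Lemma step_le1 x : step x <= 1.
Proof.
have [x1|x1] := Order.TotalTheory.leP 1 x; first by rewrite step1.
rewrite -(@step1 1)// -subr_ge0 (step_abscont.2 _ _ (ltW x1)).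
by apply: Rintegral_ge0.
Qed.

(** The kernel J((z - x) / d) / d as a function of z, in the affine form to which [derive1n_affine]
    applies. *)
Definition Jd (d x z : R) : R := d^-1 * J (d^-1 * z + - x / d).

Lemma Jd_smooth d x : smooth (Jd d x).
Proof. exact: smooth_affine. Qed.

Lemma Jd_step d x : (fun z => 1 * step (d^-1 * z + - x / d))^`()%classic = Jd d x.
Proof.
rewrite derive1_affine; last exact: step_derive.1.
by apply/funext => z; rewrite step_derive.2 mul1r.
Qed.

Lemma Jd0 d x z : 0 < d -> d <= `|z - x| -> Jd d x z = 0.
Proof.
move=> d0 dz; rewrite /Jd J1 ?mulr0// -mulrC -mulrDl normrM.
by rewrite (@ger0_norm _ d^-1) ?invr_ge0 ?(ltW d0)// ler_pdivlMr// mul1r.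
Qed.

Lemma Jd_out d x z : 0 < d -> `|x| + d < `|z| -> Jd d x z = 0.
Proof.
move=> d0 h; apply: Jd0 => //; have := ler_normD (z - x) x; rewrite subrK; lra.
Qed.

Lemma Jd_ge0 d x z : 0 < d -> 0 <= Jd d x z.
Proof. by move=> d0; apply: mulr_ge0 => //; rewrite invr_ge0 ltW. Qed.

Lemma Jd_integrable d x f : 0 < d -> lint f ->
  mu.-integrable setT (EFin \o (fun z => Jd d x z * f z)).
Proof.
move=> d0 lf; apply: (@integrable_csupp _ _ (`|x| + d)) => //.
  exact/smooth_continuous/Jd_smooth.
by move=> z; exact: Jd_out.
Qed.

Lemma Jd_int1 d x : 0 < d -> \int[mu]_z Jd d x z = 1.
Proof.
move=> d0; transitivity (\int[mu]_(z in `[x - d, x + d]) Jd d x z).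
  rewrite [RHS]Rintegral_mkcond; apply: eq_Rintegral => z _.
  rewrite patchE; case: ifPn => //; rewrite notin_setE/= in_itv/= -ler_distlC => /negP.
  by rewrite -ltNge => /ltW; rewrite distrC; exact: Jd0.
have H : abscont (fun z => 1 * step (d^-1 * z + - x / d)) (Jd d x).
  apply: C1_abscont; last exact/smooth_continuous/Jd_smooth.
    exact: (@smooth_affine _ step d^-1 (- x / d) 1 step_smooth 0%N).
  exact: Jd_step.
rewrite -H.2; last lra.
have -> : d^-1 * (x + d) + - x / d = 1 by field; rewrite gt_eqF.
have -> : d^-1 * (x - d) + - x / d = -1 by field; rewrite gt_eqF.
by rewrite step1// step0// !mul1r subr0.
Qed.

Lemma Jd_lebesgue_pt f x : lint f -> lebesgue_pt f x ->
  forall e, 0 < e -> exists2 d0 : R, 0 < d0 & forall d, 0 < d -> d < d0 ->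
    `|\int[mu]_z (Jd d x z * f z) - f x| < e.
Proof.
move=> lf fx e e0.
have [C C0 HC] : exists2 C : R, 0 <= C & forall z, `|J z| <= C.
  by case: hJ => /(@test_function_bounded R 0).
(* The kernel is at most C / d on a ball of measure 2 d, so the error is at most 2 C times the mean
   oscillation of f; the + 1 covers C = 0. *)
have C1 : 0 < e / (2 * C + 1) by rewrite divr_gt0// ltr_wpDl// mulr_ge0.
have [d0 /= d00 hd] : \forall r \near 0^'+, (davg f x r < (e / (2 * C + 1))%:E)%E.
  have /fine_cvgP[h1 /cvgrPdist_lt/(_ _ C1) h2] := fx.
  near=> r; have /fineK <- : davg f x r \is a fin_num by near: r.
  rewrite lte_fin; apply: le_lt_trans (ler_norm _) _; rewrite -normrN -sub0r.
  by near: r.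
exists d0 => // d d_gt0 dd0.
have {}hd : (davg f x d < (e / (2 * C + 1))%:E)%E.
  by apply: hd => //=; rewrite sub0r normrN gtr0_norm.
have -> : f x = \int[mu]_z (Jd d x z * f x).
  rewrite RintegralZr ?Jd_int1 ?mul1r//.
  have := @Jd_integrable d x (cst 1) d_gt0; under eq_fun do rewrite mulr1; apply.
  by apply: continuous_lint; exact: cst_continuous.
have lfx : lint (cst (f x) : R -> R) by apply: continuous_lint; exact: cst_continuous.
have i1 := Jd_integrable x d_gt0 lf; have i2 := Jd_integrable x d_gt0 lfx.
have ldf : lint (fun z => `|f z - f x|) by apply: lint_norm; exact: (lintB lf lfx).
rewrite -RintegralB//.
have i3 : mu.-integrable setT (EFin \o (fun z => Jd d x z * f z - Jd d x z * f x)).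
  exact: (integrableB _ i1 i2).
apply: le_lt_trans (le_normr_Rintegral _ i3) _ => //.
have bb : ball x d = `]x - d, x + d[%classic by rewrite ball_itv.
have mb : (mu (ball x d) = (d *+ 2)%:E)%E by rewrite lebesgue_measure_ball// ltW.
have i4 : mu.-integrable (ball x d) (EFin \o (fun z => `|f z - f x|)).
  by apply: integrableS (ldf (x - d) (x + d)) => //; rewrite bb//; exact: subset_itv_oo_cc.
have i5 : mu.-integrable setT (EFin \o ((fun z => (d^-1 * C) * `|f z - f x|) \_ (ball x d))).
  rewrite -restrict_EFin; apply/(integrable_mkcond _ _).1; first by rewrite bb.
  by apply: (integrableZl _ _ i4) => //; rewrite bb.
have H : \int[mu]_z `|Jd d x z * f z - Jd d x z * f x| <=
    d^-1 * C * \int[mu]_(z in ball x d) `|f z - f x|.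
  rewrite -RintegralZl//; last by rewrite bb.
  rewrite [leRHS]Rintegral_mkcond; apply: le_Rintegral => //.
    exact: integrable_norm.
  move=> z _; rewrite patchE; case: ifPn => [_|].
    rewrite -mulrBr normrM ler_wpM2r// /Jd normrM (@ger0_norm _ d^-1) ?invr_ge0 ?(ltW d_gt0)//.
    by rewrite ler_wpM2l// invr_ge0 ltW.
  rewrite notin_setE /ball/= => /negP; rewrite -leNgt distrC => /Jd0 -> //.
  by rewrite !mul0r subrr normr0.
apply: le_lt_trans H _.
move: hd; rewrite /davg /iavg mb inver mulrn_eq0/= gt_eqF//=.
have -> : (\int[mu]_(y in ball x d) `|(f y - f x)%:E|)%E =
    (\int[mu]_(z in ball x d) `|f z - f x|)%:E.
  rewrite /Rintegral fineK//.
  by apply: integrable_fin_num => //; rewrite bb.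
rewrite -EFinM lte_fin; set I := (\int[mu]_(z in _) _) => hI.
have I0 : 0 <= I by apply: Rintegral_ge0.
have {}hI : d^-1 * I < 2 * (e / (2 * C + 1)).
  have -> : d^-1 * I = 2 * ((d *+ 2)^-1 * I) by rewrite -mulr_natr; field; rewrite gt_eqF.
  by rewrite ltr_pM2l.
apply: (@le_lt_trans _ _ (C * (2 * (e / (2 * C + 1))))).
  by rewrite mulrAC mulrC ler_wpM2l// ltW.
rewrite mulrCA mulrA -mulrA mulrCA mulrA mulrA ltr_pdivrMr; nra.
Unshelve. all: end_near. Qed.

(** The difference of two steps, rising at x and at y, is a test function with derivative [Jd] at x
    minus [Jd] at y. As the scale tends to 0, its pairing with f tends to f x - f y at Lebesgue
    points, while the function itself tends to the indicator of [x, y]. *)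
Lemma weak_increment Om f g x y : is_weak_derivative Om f g -> lint f -> x < y ->
  `[x, y] `<=` Om -> lebesgue_pt f x -> lebesgue_pt f y ->
  f y - f x = \int[mu]_(z in `[x, y]) g z.
Proof.
move=> [lfO lgO fg] lf xy xyO px py.
have [mgO oO giO] := lgO.
(* A margin around [x, y] inside [Om], which holds the supports of the smoothed indicators
   [ph n]. *)
have [h h0 hO] : exists2 h : R, 0 < h & `[x - h, y + h] `<=` Om.
  have /(oO x) [h1 /= h10 H1] : Om x by apply: xyO; rewrite /= in_itv/= lexx ltW.
  have /(oO y) [h2 /= h20 H2] : Om y by apply: xyO; rewrite /= in_itv/= lexx ltW.
  exists (Num.min h1 h2 / 2); first by rewrite divr_gt0// lt_min h10.
  have m1 : Num.min h1 h2 <= h1 by rewrite ge_min lexx.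
  have m2 : Num.min h1 h2 <= h2 by rewrite ge_min lexx orbT.
  have m0 : 0 < Num.min h1 h2 by rewrite lt_min h10.
  move=> z /=; rewrite in_itv/= => /andP[z1 z2].
  have [zx|zx] := Order.TotalTheory.ltP z x.
    by apply: H1 => /=; rewrite gtr0_norm; lra.
  have [zy|zy] := Order.TotalTheory.ltP y z.
    by apply: H2 => /=; rewrite ltr0_norm; lra.
  by apply: xyO; rewrite /= in_itv/= zx.
pose dl (n : nat) : R := h / n.+1%:R.
have dl0 n : 0 < dl n by rewrite divr_gt0.
have dlh n : dl n <= h by rewrite ler_pdivrMr// ler_peMr ?(ltW h0)// (ler1n R n.+1).
have dlc : dl n @[n --> \oo] --> 0.
  rewrite -[X in _ --> X](mulr0 h); apply: cvgMr; exact: cvg_harmonic.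
pose ph n z := 1 * step ((dl n)^-1 * z + - x / dl n) + (-1) * step ((dl n)^-1 * z + - y / dl n).
have arg n z c : (dl n)^-1 * z + - c / dl n = (z - c) / dl n.
  by rewrite mulrDl mulrC.
have phs n : smooth (ph n) by apply: smoothD; apply: smooth_affine; exact: step_smooth.
have phd n : (ph n)^`()%classic = (fun z => Jd (dl n) x z - Jd (dl n) y z).
  rewrite derive1_add; last 2 first.
    exact: (@smooth_affine _ step _ _ 1 step_smooth 0%N).
    exact: (@smooth_affine _ step _ _ (-1) step_smooth 0%N).
  rewrite Jd_step derive1_affine; last exact: step_derive.1.
  by apply/funext => z; rewrite step_derive.2 /Jd; ring.
have ph0 n z : ~ `[x - dl n, y + dl n]%classic z -> ph n z = 0.
  move=> /=; rewrite in_itv/= => /negP; rewrite negb_and -!ltNge => /orP[zx|zy].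
    rewrite /ph !arg !step0 ?mulr0 ?addr0//.
      by rewrite ler_pdivrMr//; lra.
    by rewrite ler_pdivrMr//; lra.
  rewrite /ph !arg !step1 ?mulr1 ?subrr//.
    by rewrite ler_pdivlMr//; lra.
  by rewrite ler_pdivlMr//; lra.
have phO n : `[x - dl n, y + dl n] `<=` `[x - h, y + h]%classic.
  by have := dlh n => ? z /=; rewrite !in_itv/= => /andP[? ?]; apply/andP; split; lra.
have tph n : test_function Om (ph n).
  split; first exact: phs.
  exists `[x - dl n, y + dl n]%classic; split; [exact: segment_compact| |exact: ph0].
  exact: subset_trans hO.
have key n := fg _ (tph n).
have lhs n : \int[mu]_(z in Om) (f z * (ph n)^`()%classic z) =
    \int[mu]_z (Jd (dl n) x z * f z) - \int[mu]_z (Jd (dl n) y z * f z).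
  rewrite -RintegralB//; [|exact: Jd_integrable|exact: Jd_integrable].
  rewrite Rintegral_mkcond; apply: eq_Rintegral => z _; rewrite patchE phd.
  case: ifPn => [_|]; first by ring.
  rewrite notin_setE => nO.
  have nz : ~ `[x - dl n, y + dl n]%classic z by move=> /phO /hO.
  have /derive1n_out : closed (`[x - dl n, y + dl n] : set R) by exact: itv_closed.
  move=> /(_ 1%N (ph n) (ph0 n) z nz); rewrite derive1n1 phd => /eqP.
  by rewrite subr_eq0 => /eqP ->; rewrite subrr.
pose D : set R := `[x - h, y + h]%classic.
have igD : mu.-integrable D (EFin \o g).
  apply/integrableP; split; last by apply: giO => //; exact: segment_compact.
  by apply/measurable_EFinP; apply: measurable_funS mgO => //; exact: open_measurable.
have rhs n : \int[mu]_(z in Om) (g z * ph n z) = \int[mu]_(z in D) (g z * ph n z).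
  rewrite Rintegral_mkcond [RHS]Rintegral_mkcond; apply: eq_Rintegral => z _.
  rewrite !patchE; case: ifPn => [|nO]; case: ifPn => //.
    by rewrite notin_setE => nD _; rewrite ph0 ?mulr0// => /phO.
  by rewrite inE => /hO; rewrite -in_setE (negbTE nO).
have c1 : \int[mu]_(z in Om) (f z * (ph n)^`()%classic z) @[n --> \oo] --> f x - f y.
  under eq_fun do rewrite lhs.
  apply: cvgB; apply/cvgrPdist_lt => e e0.
    have [d0 d00 hd] := Jd_lebesgue_pt lf px e0.
    have /cvgrPdist_lt/(_ _ d00) := dlc; apply: filterS => n.
    by rewrite sub0r normrN gtr0_norm// distrC => /hd; exact.
  have [d0 d00 hd] := Jd_lebesgue_pt lf py e0.
  have /cvgrPdist_lt/(_ _ d00) := dlc; apply: filterS => n.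
  by rewrite sub0r normrN gtr0_norm// distrC => /hd; exact.
have c2 : \int[mu]_(z in D) (g z * ph n z) @[n --> \oo] --> \int[mu]_(z in D) (g \_ `[x, y]) z.
  have mg : measurable_fun D g by apply/measurable_EFinP; exact: measurable_int igD.
  have [] // := @Rdominated _ _ mu D (fun n z => g z * ph n z) (g \_ `[x, y]) (fun z => `|g z|).
  - exact: measurable_itv.
  - move=> n; apply: measurable_funM => //; apply: measurable_funTS.
    by apply: continuous_measurable_fun; exact: smooth_continuous.
  - apply/measurable_restrict => //; first exact: measurable_itv.
    by apply: (measurable_funS _ _ mg); [exact: measurable_itv|exact: subIsetl].
  (* The end points are the only places where [ph n] may fail to converge to the indicator of
     [x, y]. *)
  - exists ([set x] `|` [set y]); split.
    + exact: measurableU.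
    + by apply/null_set_setU => //; exact: lebesgue_measure_set1.
    + move=> z /= H; apply: contrapT => /not_orP[zx zy]; apply: H => Dz.
      have zx0 : 0 < `|z - x| by rewrite normr_gt0 subr_eq0; apply/eqP.
      have zy0 : 0 < `|z - y| by rewrite normr_gt0 subr_eq0; apply/eqP.
      have /cvgrPdist_lt dlc' := dlc.
      apply: cvg_near_cst; near=> n.
      have dx : dl n < `|z - x|.
        by rewrite -(gtr0_norm (dl0 n)) -normrN -sub0r; near: n; exact: dlc'.
      have dy : dl n < `|z - y|.
        by rewrite -(gtr0_norm (dl0 n)) -normrN -sub0r; near: n; exact: dlc'.
      rewrite patchE; have [lzx|lxz] := Order.TotalTheory.ltP z x.
        rewrite ler0_norm in dx; last lra.
        rewrite memNset; last by rewrite /= in_itv/=; lra.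
        by rewrite ph0 ?mulr0// /= in_itv/=; lra.
      rewrite ger0_norm in dx; last lra.
      have [lyz|lzy] := Order.TotalTheory.ltP y z.
        rewrite ger0_norm in dy; last lra.
        rewrite memNset; last by rewrite /= in_itv/=; lra.
        by rewrite ph0 ?mulr0// /= in_itv/=; lra.
      rewrite ler0_norm in dy; last lra.
      rewrite mem_set; last by rewrite /= in_itv/= lxz lzy.
      rewrite /ph !arg step1; last by rewrite ler_pdivlMr//; lra.
      rewrite step0; last by rewrite ler_pdivrMr//; lra.
      by ring.
  - exact: integrable_norm.
  - move=> n z Dz; rewrite normrM ler_piMr// /ph mul1r mulN1r.
    have := step_ge0 ((dl n)^-1 * z + - x / dl n).
    have := step_ge0 ((dl n)^-1 * z + - y / dl n).
    have := step_le1 ((dl n)^-1 * z + - x / dl n).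
    have := step_le1 ((dl n)^-1 * z + - y / dl n).
    by rewrite ler_norml => *; apply/andP; split; lra.
have c3 : \int[mu]_(z in Om) (f z * (ph n)^`()%classic z) @[n --> \oo] -->
    - \int[mu]_(z in D) (g \_ `[x, y]) z.
  by under eq_fun do rewrite key rhs; exact: cvgN.
have e12 : f x - f y = - \int[mu]_(z in D) (g \_ `[x, y]) z.
  by apply: cvg_unique c1 c3; exact: Rhausdorff.
rewrite -Rintegral_mkcondr setIidr in e12.
  by rewrite -[LHS]opprK opprB e12 opprK.
by move=> z; rewrite /D/= !in_itv/= => /andP[? ?]; apply/andP; split; lra.
Unshelve. all: end_near. Qed.

End Step.
End WeakDer.

(** * Representatives of weakly differentiable functions *)

Section WeakCalc.
Local Open Scope classical_set_scope.
Local Open Scope ring_scope.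
Context {R : realType}.
Local Notation mu := (@lebesgue_measure R).
Implicit Types (f g F G : R -> R) (a b c d e x y z A C : R).

Lemma aeS (P Q : R -> Prop) : (forall x, P x -> Q x) ->
  {ae mu, forall x, P x} -> {ae mu, forall x, Q x}.
Proof. by move=> PQ; apply: filterS => //; exact: (ae_filter_ringOfSetsType mu). Qed.

Lemma aeI (P Q : R -> Prop) : {ae mu, forall x, P x} -> {ae mu, forall x, Q x} ->
  {ae mu, forall x, P x /\ Q x}.
Proof. by apply: filterI; exact: (ae_filter_ringOfSetsType mu). Qed.

Definition primitive g c x : R :=
  if c <= x then \int[mu]_(t in `[c, x]) g t else - \int[mu]_(t in `[x, c]) g t.

Lemma primitive_abscont g c k : lint g -> abscont (fun x => k + primitive g c x) g.
Proof.
move=> lg; split => // a b ab; rewrite /primitive.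
have [ca|ac] := Order.TotalTheory.leP c a.
  by rewrite (le_trans ca ab) (Rint_split lg ca ab); ring.
have [cb|bc] := Order.TotalTheory.leP c b.
  by rewrite (Rint_split lg (ltW ac) cb); ring.
by rewrite (Rint_split lg ab (ltW bc)); ring.
Qed.

Lemma primitive_self g c : primitive g c c = 0.
Proof. by rewrite /primitive lexx set_itv1 Rintegral_set1. Qed.

Lemma continuous_ae_eq f g : continuous f -> continuous g ->
  {ae mu, forall x, f x = g x} -> f = g.
Proof.
move=> cf cg fg; apply/funext => x; apply/eqP; rewrite -subr_eq0; apply/negPn/negP => ne.
have : {for x, continuous (fun y => f y - g y)} by apply: cvgB; [exact: cf|exact: cg].
move=> /cvgrPdist_lt/(_ `|f x - g x|); rewrite normr_gt0 => /(_ ne) [r /= r0 hr].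
have [|y fgy /andP[xy yx]] := @ae_dense R _ fg x (x + r); first lra.
have := hr y; rewrite /= fgy subrr subr0 ltxx => H; apply: notF; apply: H.
by rewrite ltr0_norm; lra.
Qed.

Lemma compact_open_dist (K Om : set R) : compact K -> open Om -> K `<=` Om ->
  exists2 d : R, 0 < d & forall x y, K x -> `|y - x| < d -> Om y.
Proof.
move=> cK oO KO.
have /compact_near_coveringP nK := cK.
have := nK R 0^'+ (fun d x => forall y, `|y - x| < d -> Om y) _ _.
case.
  move=> x Kx.
  have /oO [r /= r0 hr] := KO _ Kx.
  exists (ball x (r / 2), [set d | d < r / 2]) => /=.
    split => /=; first by apply: nbhsx_ballx; rewrite divr_gt0.
    by apply: nbhs_right_lt; rewrite divr_gt0.
  move=> [x' d] /= [xx' dr] y yx'; apply: hr => /=.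
  have : `|x - x'| < r / 2 by [].
  by have := ler_distD x' x y; rewrite (distrC x' y); lra.
move=> r /= r0 hr; exists (r / 2); first by rewrite divr_gt0.
move=> x y Kx yx; apply: (hr (r / 2) _ _ x) => //=; last by rewrite divr_gt0.
by rewrite sub0r normrN gtr0_norm; lra.
Qed.

Lemma Rintegral_ae_eq D f g : measurable D ->
  measurable_fun D f -> measurable_fun D g -> {ae mu, forall x, D x -> f x = g x} ->
  \int[mu]_(x in D) f x = \int[mu]_(x in D) g x.
Proof.
move=> mD mf mg fg; congr fine; apply: ae_eq_integral => //.
- exact/measurable_EFinP.
- exact/measurable_EFinP.
- by apply: aeS fg => x h /h ->.
Qed.

Section WithMollifier.
Variables (J : R -> R).
Hypothesis hJ : standard_mollifier J.

(** The primitive of g anchored at one Lebesgue point of f agrees with f at every Lebesgue point, by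
    [weak_increment]. *)
Lemma weak_abscont f g : is_weak_derivative setT f g ->
  exists2 F, abscont F g & {ae mu, forall x, f x = F x}.
Proof.
move=> fg; have [lf lg _] := fg.
have aef := lebesgue_differentiation lf.
move/locally_integrable_lint : lf => lf; move/locally_integrable_lint : lg => lg.
have [x0 px0 _] := ae_dense aef ltr01.
exists (fun x => f x0 + primitive g x0 x); first exact: primitive_abscont.
apply: aeS aef => x px; rewrite /primitive.
have [xx|xx|<-] := Order.TotalTheory.ltgtP x0 x; last first.
- by rewrite set_itv1 Rintegral_set1 addr0.
- by rewrite -(weak_increment hJ fg lf xx)//; ring.
- by rewrite -(weak_increment hJ fg lf xx)//; ring.
Qed.

Lemma weak_abscont_continuous f g : is_weak_derivative setT f g -> continuous f ->
  abscont f g.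
Proof.
move=> fg cf; have [F aF eF] := weak_abscont fg.
by rewrite (continuous_ae_eq cf (abscont_continuous aF) eF).
Qed.

(** At the Lebesgue points of [x, y], f coincides with a primitive of g, and [abscontM] applies to
    that primitive. *)
Lemma weak_product_local Om f g (eta eta' : R -> R) x y :
  is_weak_derivative Om f g -> lint f -> abscont eta eta' -> x < y ->
  `[x, y] `<=` Om -> lebesgue_pt f x -> lebesgue_pt f y ->
  f y * eta y - f x * eta x = \int[mu]_(z in `[x, y]) (f z * eta' z + g z * eta z).
Proof.
move=> fg lf aeta xy xyO px py.
have [_ [mgO oO giO] _] := fg.
have aef := lebesgue_differentiation ((locally_integrable_lint _).2 lf).
have ig : mu.-integrable `[x, y] (EFin \o g).
  apply/integrableP; split; last by apply: giO => //; exact: segment_compact.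
  by apply/measurable_EFinP; apply: measurable_funS mgO => //; exact: open_measurable.
(* Integrability of g is known only on compact subsets of [Om]; the restriction to [x, y] is
   integrable on the whole line. *)
have lg' : lint (g \_ `[x, y]).
  by apply: integrable_lint; rewrite -restrict_EFin; apply/(integrable_mkcond _ _).1.
have aF := @primitive_abscont _ x (f x) lg'.
have inner z : z <= y ->
    \int[mu]_(t in `[x, z]) (g \_ `[x, y]) t = \int[mu]_(t in `[x, z]) g t.
  move=> zy; rewrite -Rintegral_mkcondr setIidl// => t /=.
  by rewrite !in_itv/= => /andP[-> /le_trans ->].
have Fy z : lebesgue_pt f z -> x <= z -> z <= y -> f x + primitive (g \_ `[x, y]) x z = f z.
  move=> pz; rewrite le_eqVlt => /predU1P[<-|xz] zy; first by rewrite primitive_self addr0.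
  rewrite /primitive (ltW xz) inner// -(weak_increment hJ fg lf xz)//.
    by ring.
  by apply: subset_trans xyO => t /=; rewrite !in_itv/= => /andP[-> /le_trans ->].
have [l2 E2] := abscontM aF aeta.
have := E2 x y (ltW xy); rewrite (Fy y py (ltW xy) (lexx y)) (Fy x px (lexx x) (ltW xy)) => ->.
have mf : measurable_fun `[x, y] f by apply: measurable_funTS; exact: lint_measurable.
have mg : measurable_fun `[x, y] g by apply/measurable_EFinP; exact: measurable_int ig.
have [leta' _] := aeta.
apply: Rintegral_ae_eq => //.
- by apply: measurable_funTS; exact: lint_measurable.
- apply: measurable_funD; apply: measurable_funM => //.
    by apply: measurable_funTS; exact: lint_measurable.
  apply: measurable_funTS; apply: continuous_measurable_fun.
  exact: abscont_continuous aeta.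
- apply: aeS aef => z pz /=; rewrite in_itv/= => /andP[xz zy].
  by rewrite (Fy z pz xz zy) addrC patchE mem_set//= in_itv/= xz.
Qed.

(** Extends the weak derivative to C^1 test functions, such as a smooth function times a cutoff of
    u. The increments of f eta between Lebesgue points are chained: a segment shorter than the
    distance from K to the complement of [Om] either misses K, where all terms vanish, or lies in
    [Om], where [weak_product_local] applies. *)
Lemma weak_derivative_C1_test Om f g (eta : R -> R) (K : set R) :
  is_weak_derivative Om f g -> lint f ->
  (forall x, derivable eta x 1) -> continuous (eta^`()%classic) ->
  compact K -> K `<=` Om -> (forall x, ~ K x -> eta x = 0) ->
  \int[mu]_(x in Om) (f x * eta^`()%classic x) = - \int[mu]_(x in Om) (g x * eta x).
Proof.
move=> fg lf deta ceta' cK KO eta0.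
have [_ [mgO oO giO] _] := fg.
have clK : closed K by apply: compact_closed => //; exact: Rhausdorff.
have eta0' : forall x, ~ K x -> eta^`()%classic x = 0.
  by have H := derive1n_out 1 clK eta0; move=> x /H; rewrite derive1n1.
have aeta : abscont eta eta^`()%classic by exact: (C1_abscont deta erefl ceta').
have ceta := abscont_continuous aeta.
have aef := lebesgue_differentiation ((locally_integrable_lint _).2 lf).
have mK : measurable K by exact: closed_measurable.
have lgK : lint (g \_ K).
  apply: integrable_lint; rewrite -restrict_EFin; apply/(integrable_mkcond _ _).1 => //.
  apply/integrableP; split; last exact: giO.
  by apply/measurable_EFinP; apply: measurable_funS mgO => //; exact: open_measurable.
pose h z := f z * eta^`()%classic z + (g \_ K) z * eta z.
have lh : lint h by apply: lintD; exact: lintMr.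
have [d d0 Kd] := compact_open_dist cK oO KO.
have key : forall x y, lebesgue_pt f x -> lebesgue_pt f y -> x < y ->
    f y * eta y - f x * eta x = \int[mu]_(z in `[x, y]) h z.
  apply: (@chaining R [set x | lebesgue_pt f x]
    (fun x y => f y * eta y - f x * eta x = \int[mu]_(z in `[x, y]) h z) d) => //.
  - move=> x y c e _ _ _ ce _; have [z pz /andP[? ?]] := ae_dense aef ce.
    by exists z.
  - move=> x y px py xy xyd.
    have [[k [Kk /= kxy]]|nk] := pselect (exists k, K k /\ `[x, y]%classic k); last first.
      have nK z : `[x, y]%classic z -> ~ K z by move=> zxy Kz; apply: nk; exists z.
      rewrite !eta0 ?mulr0 ?subr0; last 2 first.
      + by apply: nK; rewrite /= in_itv/= lexx ltW.
      + by apply: nK; rewrite /= in_itv/= lexx ltW.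
      rewrite -(mul0r (fine (mu `[x, y]))) -Rintegral_cst//.
      apply: eq_Rintegral => z; rewrite inE => /nK nKz.
      by rewrite /h eta0// eta0'// !mulr0 addr0.
    have xyO : `[x, y] `<=` Om.
      move=> z /=; rewrite in_itv/= => /andP[xz zy]; apply: (Kd k) => //.
      by move: kxy; rewrite in_itv/= ltr_norml => /andP[? ?]; apply/andP; split; lra.
    rewrite (weak_product_local fg lf aeta xy xyO px py).
    apply: eq_Rintegral => z; rewrite inE => /xyO Oz; rewrite /h; congr (_ + _).
    have [Kz|nKz] := pselect (K z); last by rewrite eta0// !mulr0.
    by rewrite patchE mem_set.
  - move=> x y z px py pz xy yz Pxy Pyz.
    by rewrite (Rint_split lh (ltW xy) (ltW yz)) -Pxy -Pyz; ring.
have [M [Mr HM]] := compact_bounded cK.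
have KM z : K z -> `|z| <= `|M| + 1 by apply: HM; rewrite ltr_pwDr// ler_norm.
pose B := `|M| + 1.
(* Between Lebesgue points on either side of K, where eta vanishes, the increment of f eta is 0 and
   the integral is the full one. *)
have [|x px /andP[x1 x2]] := ae_dense aef (a := - B - 1) (b := - B); first lra.
have [|y py /andP[y1 y2]] := ae_dense aef (a := B) (b := B + 1); first lra.
have B0 : 0 < B by rewrite /B ltr_wpDl.
have Kxy z : K z -> `[x, y]%classic z.
  by move=> /KM; rewrite -/B ler_norml /= in_itv/= => /andP[? ?]; apply/andP; split; lra.
have := key x y px py; rewrite !eta0 ?mulr0 ?subr0; last 2 first.
- by move=> /KM; rewrite -/B ler_norml => /andP[? ?]; lra.
- by move=> /KM; rewrite -/B ler_norml => /andP[? ?]; lra.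
move=> /(_ _)/esym; rewrite RintegralD//; last 2 first.
- exact: (lintMr lf ceta').
- exact: (lintMr lgK ceta).
have -> : \int[mu]_(z in `[x, y]) (f z * eta^`()%classic z) =
          \int[mu]_(z in Om) (f z * eta^`()%classic z).
  rewrite Rintegral_mkcond [RHS]Rintegral_mkcond; apply: eq_Rintegral => z _; rewrite !patchE.
  have [Kz|nKz] := pselect (K z); last by rewrite eta0'// mulr0 !if_same.
  by rewrite !mem_set//; [exact: KO|exact: Kxy].
have -> : \int[mu]_(z in `[x, y]) ((g \_ K) z * eta z) = \int[mu]_(z in Om) (g z * eta z).
  rewrite Rintegral_mkcond [RHS]Rintegral_mkcond; apply: eq_Rintegral => z _; rewrite !patchE.
  have [Kz|nKz] := pselect (K z); last by rewrite eta0// !mulr0 !if_same.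
  by rewrite !mem_set//; [exact: KO|exact: Kxy].
move=> h0; apply/eqP; rewrite -addr_eq0; apply/eqP; apply: h0; lra.
Qed.

End WithMollifier.
End WeakCalc.

(** * Integration by parts on the positivity set *)

Section Identity.
Local Open Scope classical_set_scope.
Local Open Scope ring_scope.
Context {R : realType}.
Local Notation mu := (@lebesgue_measure R).
Implicit Types (f g F G u psi : R -> R) (a b c d e x y z A C : R).

Lemma wderivP Om f : weakly_differentiable Om f -> is_weak_derivative Om f (wderiv Om f).
Proof. by move=> [g hg]; exact: (xgetPex (cst 0) (ex_intro _ g hg)). Qed.

Lemma Lfun2_lint f : f \in Lfun mu 2%:E -> lint f.
Proof.
move=> f2; have i2 := Lfun2_integrable_sqr f2.
have mf : measurable_fun setT f by move: f2; rewrite inE => /andP[]; rewrite inE.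
have l1 : lint (fun x => 1 + f x ^+ 2).
  apply: (@lintD _ (cst 1)); first by apply: continuous_lint; exact: cst_continuous.
  exact: integrable_lint.
move=> a b; have i1 := l1 a b.
apply: le_integrable i1 => //.
  by apply/measurable_EFinP; exact: measurable_funTS.
move=> x _; rewrite !abse_EFin lee_fin (@ger0_norm _ (1 + _)) ?addr_ge0 ?sqr_ge0//.
rewrite -[f x ^+ 2]real_normK ?num_real//; have := sqr_ge0 (`|f x| - 1).
by rewrite sqrrB1; have := normr_ge0 (f x); lra.
Qed.

Lemma test_function_supp Om psi : test_function Om psi ->
  exists2 A : R, 0 <= A & forall n x, A <= `|x| -> psi^`(n)%classic x = 0.
Proof.
move=> [_ [K [cK _ p0]]].
have [M [Mr HM]] := compact_bounded cK; exists (`|M| + 2); first by rewrite addr_ge0.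
have clK : closed K by apply: compact_closed => //; exact: Rhausdorff.
move=> n x Mx; apply: (derive1n_out n clK p0) => Kx.
have : `|x| <= `|M| + 1 by apply: HM => //; rewrite ltr_pwDr// ler_norm.
by move=> ?; lra.
Qed.

Lemma smooth_abscont n psi : smooth psi ->
  abscont (psi^`(n)%classic : R -> R) (psi^`(n.+1)%classic : R -> R).
Proof.
move=> sp; apply: C1_abscont; first exact: sp.
  by rewrite derive1nS.
by apply: smooth_continuous; exact: smooth_derive1n.
Qed.

Section WithMollifier.
Variables (J : R -> R).
Hypothesis hJ : standard_mollifier J.

(** The weak derivative of u agrees almost everywhere with an absolutely continuous q, so u is a
    primitive of the continuous function q and hence C^1. *)
Lemma H2_regularity u : continuous u -> sobolevH 2 u ->
  [/\ forall x, derivable u x 1, abscont u (u^`()%classic),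
      abscont (u^`()%classic) (wderivn 2 u)
    & {ae mu, forall x, wderiv setT u x = u^`()%classic x}].
Proof.
move=> cu [wd _].
have w0 := wderivP (wd 0%N isT); have w1 := wderivP (wd 1%N isT).
have au := weak_abscont_continuous hJ w0 cu.
have [q aq pq] := weak_abscont hJ w1.
have cq := abscont_continuous aq.
have auq : abscont u q.
  split; first exact: continuous_lint.
  move=> a b ab; rewrite (proj2 au a b ab); apply: Rintegral_ae_eq => //.
  - by apply: measurable_funTS; exact: lint_measurable au.1.
  - by apply: measurable_funTS; exact: continuous_measurable_fun.
  - by apply: aeS pq => x + _.
have [du dq] := abscont_derive auq cq.
by rewrite dq; split; [exact: du|exact: auq|exact: aq|exact: pq].
Qed.

Lemma ge0_derive_at_zero u x : (forall y, 0 <= u y) -> (forall y, derivable u y (1:R)) ->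
  u x = 0 -> u^`()%classic x = 0.
Proof.
move=> u0 du ux.
have := @derive1_at_min R u (x - 1) (x + 1) x.
case => //; [lra|by rewrite in_itv/=; apply/andP; split; lra|by move=> t _; rewrite ux|].
by move=> _ h; rewrite derive1E.
Qed.

Section Cutoff.

(* [cutoff e u] vanishes where u <= e and equals u where u >= 2 e, so that a
   test function times [cutoff e u] is supported in the positivity set. *)
Definition cutoff e s := s * (1 * step J (2 / e * s + - 3)).
(** The derivative of [cutoff e]. The map 2 s / e - 3 sends e to -1 and 2 e to 1, the ends of the
    transition of [step]. *)
Definition cutoff' e s := step J (2 / e * s + - 3) + s * (2 / e * J (2 / e * s + - 3)).

Lemma cutoff_is_derive e s : is_derive s (1:R) (cutoff e) (cutoff' e s).
Proof.
have h := is_derive_affine 1 (f := step J) (a := 2 / e) (b := - 3) (x := s)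
  ((step_derive hJ).1 _).
rewrite (step_derive hJ).2 in h.
have := is_deriveM (is_derive_id s 1) h.
rewrite /cutoff/cutoff' /GRing.scale/= => h'; apply: is_derive_eq.
rewrite /GRing.scale/=; ring.
Qed.

Lemma cutoff0 e s : 0 < e -> s <= e -> cutoff e s = 0.
Proof.
move=> e0 se; rewrite /cutoff (step0 hJ) ?mulr0//.
have : 2 / e * s <= 2 by rewrite mulrAC ler_pdivrMr//; lra.
lra.
Qed.

Lemma cutoff'0 e s : 0 < e -> s <= e -> cutoff' e s = 0.
Proof.
move=> e0 se; have h : 2 / e * s <= 2 by rewrite mulrAC ler_pdivrMr//; lra.
rewrite /cutoff' (step0 hJ); last lra.
have [_ _ J1 _] := hJ; rewrite J1 ?mulr0 ?addr0// ler0_norm; lra.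
Qed.

Lemma cutoff_id e s : 0 < e -> 2 * e <= s -> cutoff e s = s.
Proof.
move=> e0 se; have h : 4 <= 2 / e * s by rewrite mulrAC ler_pdivlMr//; lra.
by rewrite /cutoff (step1 hJ) ?mulr1//; lra.
Qed.

Lemma cutoff'_id e s : 0 < e -> 2 * e <= s -> cutoff' e s = 1.
Proof.
move=> e0 se; have h : 4 <= 2 / e * s by rewrite mulrAC ler_pdivlMr//; lra.
rewrite /cutoff' (step1 hJ); last lra.
have [_ _ J1 _] := hJ; rewrite J1 ?mulr0 ?addr0// ger0_norm; lra.
Qed.

(** The factor 2 / e from differentiating the step is harmless: it comes multiplied by s, and acts
    only where s <= 2 e. The bound is therefore uniform in e, as dominated convergence requires. *)
Lemma cutoff'_bound : exists2 B : R, 0 <= B & forall e s, 0 < e -> 0 <= s -> `|cutoff' e s| <= B.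
Proof.
have [tJ J0 J1 _] := hJ.
have [B B0 HB] := test_function_bounded 0 tJ.
exists (1 + 4 * B); first lra.
move=> e s e0 s0; have [se|es] := Order.TotalTheory.leP (2 * e) s.
  by rewrite cutoff'_id// normr1; lra.
apply: le_trans (ler_normD _ _) _; apply: lerD.
  by rewrite ger0_norm ?step_ge0// step_le1.
have h : 2 / e * s <= 4 by rewrite mulrAC ler_pdivrMr//; lra.
have h0 : 0 <= 2 / e * s by rewrite mulr_ge0// divr_ge0// ltW.
rewrite (_ : s * _ = (2 / e * s) * J (2 / e * s + - 3)); last ring.
rewrite normrM (ger0_norm h0); apply: ler_pM => //; exact: HB.
Qed.

Lemma cutoff_bound e s : 0 <= s -> 0 <= cutoff e s <= s.
Proof.
move=> s0; rewrite /cutoff mul1r mulr_ge0 ?step_ge0//=.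
by rewrite ler_piMr// step_le1.
Qed.

End Cutoff.

Lemma cutoff_cvg (e_ : nat -> R) s : (forall n, 0 < e_ n) -> e_ n @[n --> \oo] --> (0:R) ->
  0 < s -> \forall n \near \oo, cutoff (e_ n) s = s /\ cutoff' (e_ n) s = 1.
Proof.
move=> e0 /cvgrPdist_lt ec s0; have s2 : 0 < s / 2 by rewrite divr_gt0.
have := ec _ s2; apply: filterS => n.
rewrite sub0r normrN (gtr0_norm (e0 n)) => h.
by rewrite cutoff_id ?cutoff'_id//; lra.
Qed.

Lemma integration_identity (u q r p1 p2 p3 p4 : R -> R) A :
  abscont u q -> abscont q r -> abscont p1 p2 -> abscont p2 p3 -> abscont p3 p4 ->
  continuous p4 -> 0 <= A ->
  (forall x, A <= `|x| -> [/\ p1 x = 0, p2 x = 0, p3 x = 0 & p4 x = 0]) ->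
  - (\int[mu]_x (p2 x * u x * r x + p1 x * q x * r x)) =
  3 / 2 * \int[mu]_x (p2 x * q x ^+ 2) - 2^-1 * \int[mu]_x (p4 x * u x ^+ 2).
Proof.
move=> au aq ap1 ap2 ap3 cp4 A0 pA.
have cu := abscont_continuous au; have cq := abscont_continuous aq.
have cp1 := abscont_continuous ap1; have cp2 := abscont_continuous ap2.
(* The compactly supported function - p2 u q - p1 q^2 / 2 + p3 u^2 / 2 has as derivative the
   difference of the two integrands, so that difference integrates to 0. *)
have aF := abscontD (abscontD
   (abscontZ (-1) (abscontM ap2 (abscontM au aq)))
   (abscontZ (- 2^-1) (abscontM ap1 (abscontM aq aq))))
   (abscontZ 2^-1 (abscontM ap3 (abscontM au au))).
have F0 := abscont_compact_supp aF A0
  (fun x Ax => ltac:(cbv beta; have [-> -> -> _] := pA x Ax; ring))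
  (fun x Ax => ltac:(cbv beta; have [-> -> -> ->] := pA x (ltW Ax); ring)).
have lr := aq.1.
have i11 : mu.-integrable setT (EFin \o (fun x => p2 x * u x * r x)).
  apply: (@integrable_csupp R (fun x => p2 x * u x) r A) => //.
    by move=> x; apply: cvgM; [exact: cp2|exact: cu].
  by move=> x /ltW Ax; have [_ -> _ _] := pA x Ax; rewrite mul0r.
have i12 : mu.-integrable setT (EFin \o (fun x => p1 x * q x * r x)).
  apply: (@integrable_csupp R (fun x => p1 x * q x) r A) => //.
    by move=> x; apply: cvgM; [exact: cp1|exact: cq].
  by move=> x /ltW Ax; have [-> _ _ _] := pA x Ax; rewrite mul0r.
have i1 := integrableD measurableT i11 i12.
have i2 : mu.-integrable setT (EFin \o (fun x => p2 x * q x ^+ 2)).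
  apply: (@integrable_csupp R p2 (fun x => q x ^+ 2) A) => //.
    by apply: continuous_lint => x; apply: cvgM; exact: cq.
  by move=> x /ltW Ax; have [_ -> _ _] := pA x Ax.
have i3 : mu.-integrable setT (EFin \o (fun x => p4 x * u x ^+ 2)).
  apply: (@integrable_csupp R p4 (fun x => u x ^+ 2) A) => //.
    by apply: continuous_lint => x; apply: cvgM; exact: cu.
  by move=> x /ltW Ax; have [_ _ _ ->] := pA x Ax.
have F0' : \int[mu]_x ((-1) * (p2 x * u x * r x + p1 x * q x * r x)
   - (3 / 2 * (p2 x * q x ^+ 2) - 2^-1 * (p4 x * u x ^+ 2))) = 0.
  by rewrite -[RHS]F0; apply: eq_Rintegral => x _; field.
move: F0'; rewrite RintegralB//; last 2 first.
- exact: (integrableZl _ (-1) i1).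
- exact: (integrableB _ (integrableZl _ (3/2) i2) (integrableZl _ 2^-1 i3)).
rewrite RintegralZl// RintegralB//; last 2 first.
- exact: (integrableZl _ (3/2) i2).
- exact: (integrableZl _ 2^-1 i3).
rewrite RintegralZl// RintegralZl// => /eqP; rewrite subr_eq0 => /eqP <-.
by rewrite mulN1r.
Qed.

(** The weak derivative of u_xx on the positivity set is tested with p1 times [cutoff e] of u,
    supported where u >= e, and e tends to 0. The term with u_xx is dominated thanks to
    [cutoff'_bound], the one with u_xxx thanks to [sqrt_D3]; the limit is free of u_xxx and
    [integration_identity] finishes. *)
Lemma thin_film_identity_aux (u p1 p2 p3 p4 : R -> R) A :
  abscont p1 p2 -> abscont p2 p3 -> abscont p3 p4 ->
  continuous p4 -> 0 <= A ->
  (forall x, A <= `|x| -> [/\ p1 x = 0, p2 x = 0, p3 x = 0 & p4 x = 0]) ->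
  (forall x, 0 <= u x) -> continuous u -> sobolevH 2 u ->
  weakly_differentiable (positivity_set u) (wderivn 2 u) ->
  sqrt_D3 u \in Lfun mu 2%:E ->
  \int[mu]_x (p1 x * u x * D3pos u x) =
  3 / 2 * \int[mu]_x (p2 x * u^`()%classic x ^+ 2)
  - 2^-1 * \int[mu]_x (p4 x * u x ^+ 2).
Proof.
move=> ap1 ap2 ap3 cp4 A0 pA u0 cu H2 wd S2.
have [du au aq _] := H2_regularity cu H2.
set r := wderivn 2 u in wd aq *.
have WD := wderivP wd; rewrite -/r in WD.
have D3E : wderiv (positivity_set u) r = D3pos u by [].
rewrite D3E in WD.
set d := D3pos u in WD *; set Om := positivity_set u in WD *.
set q : R -> R := u^`()%classic in au aq *.
have cq := abscont_continuous aq.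
have lr := aq.1.
have cp1 := abscont_continuous ap1; have cp2 := abscont_continuous ap2.
have [dp1 p1'] := abscont_derive ap1 cp2.
have q0 x : u x = 0 -> q x = 0 by exact: (ge0_derive_at_zero u0 du).
have lS : lint (sqrt_D3 u) by exact: Lfun2_lint.
(* Near the contact line only [sqrt_D3] is controlled; u u_xxx is its product with the continuous
   function sqrt(u). *)
have SE x : u x * d x = Num.sqrt (u x) * sqrt_D3 u x.
  by rewrite /sqrt_D3 -/d mulrA -expr2 sqr_sqrtr.
have csu : continuous (fun x => Num.sqrt (u x)).
  by move=> x; apply: (@continuous_comp _ _ _ u (@Num.sqrt R)); [exact: cu|exact: sqrt_continuous].
rewrite -(integration_identity au aq ap1 ap2 ap3 cp4 A0 pA).
pose e_ (n : nat) : R := n.+1%:R^-1.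
have e0 n : 0 < e_ n by rewrite invr_gt0.
have ec : e_ n @[n --> \oo] --> (0:R) by exact: cvg_harmonic.
pose eta n x := p1 x * cutoff (e_ n) (u x).
pose eta' n x := p2 x * cutoff (e_ n) (u x) +
                 p1 x * (cutoff' (e_ n) (u x) * q x).
have deta n x : is_derive x (1:R) (eta n) (eta' n x).
  have h1 : is_derive x (1:R) p1 (p2 x).
    by rewrite -p1' derive1E; exact: derivableP.
  have h2 : is_derive x (1:R) u (q x) by rewrite /q derive1E; exact: derivableP.
  have h3 := @is_derive1_comp _ (cutoff (e_ n)) u x _ _ (cutoff_is_derive (e_ n) (u x)) h2.
  have := is_deriveM h1 h3 => h4; apply: is_derive_eq.
  by rewrite /GRing.scale/= /eta'; ring.
have etaE n : (eta n)^`()%classic = eta' n.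
  by apply/funext => x; rewrite derive1E; have h := deta n x; rewrite derive_val.
have ccut n : continuous (fun x => cutoff (e_ n) (u x)).
  move=> x; apply: (@continuous_comp _ _ _ u (cutoff (e_ n))); first exact: cu.
  apply: differentiable_continuous; apply/derivable1_diffP.
  by have [] := cutoff_is_derive (e_ n) (u x).
have ccut' n : continuous (fun x => cutoff' (e_ n) (u x)).
  have [[sJ _] _ _ _] := hJ.
  have ca : continuous (fun x => 2 / e_ n * u x + - 3).
    by move=> x; apply: cvgD; [apply: cvgMr; exact: cu|exact: cvg_cst].
  move=> x; apply: cvgD.
    by apply: (@continuous_comp _ _ _ _ (step J) x (ca x)); exact: smooth_continuous (step_smooth hJ) _.
  apply: cvgM; first exact: cu.
  apply: cvgMr; apply: (@continuous_comp _ _ _ _ J x (ca x)).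
  exact: smooth_continuous.
pose K n : set R := [set x | `|x| <= A] `&` [set x | e_ n <= u x].
have KE : [set x : R | `|x| <= A] = `[- A, A]%classic.
  by apply/seteqP; split => x /=; rewrite in_itv/= ler_norml.
have cK n : compact (K n).
  apply: (@subclosed_compact _ _ `[- A, A]%classic).
  - apply: closedI; first by rewrite KE; exact: itv_closed.
    by have := @closed_ge R (e_ n); apply: preimage_closed => x _; exact: cu.
  - exact: segment_compact.
  - by move=> x [/= + _]; rewrite in_itv/= ler_norml.
have KO n : K n `<=` Om by move=> x [_ /= h]; exact: lt_le_trans h.
have eta0 n x : ~ K n x -> eta n x = 0.
  move=> nK; rewrite /eta; have [Ax|xA] := Order.TotalTheory.leP A `|x|; first by have [-> _ _ _] := pA x Ax; rewrite mul0r.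
  rewrite cutoff0 ?mulr0//; apply/ltW; rewrite ltNge; apply/negP => h.
  by apply: nK; split => //=; exact: ltW.
have ceta' n : continuous (eta n)^`()%classic.
  rewrite etaE => x; apply: cvgD; apply: cvgM; [exact: cp2|exact: ccut|exact: cp1|].
  by apply: cvgM; [exact: ccut'|exact: cq].
have key n := weak_derivative_C1_test hJ WD lr (fun x => @ex_derive _ _ _ _ _ _ _ (deta n x)) (ceta' n)
   (cK n) (KO n) (@eta0 n).
have lhsE n : \int[mu]_(x in Om) (r x * (eta n)^`()%classic x) = \int[mu]_x (r x * eta' n x).
  rewrite etaE Rintegral_mkcond; apply: eq_Rintegral => x _; rewrite patchE.
  case: ifPn => //; rewrite notin_setE /Om /positivity_set /= => /negP; rewrite -leNgt => ux.
  have {}ux : u x = 0 by apply/eqP; rewrite eq_le ux u0.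
  transitivity (0:R) => //; rewrite /eta' q0// ux cutoff0 ?(ltW (e0 n))//; ring.
pose k n x := p1 x * Num.sqrt (u x) * step J (2 / e_ n * u x + - 3).
have rhsE n : \int[mu]_(x in Om) (d x * eta n x) = \int[mu]_x (k n x * sqrt_D3 u x).
  rewrite Rintegral_mkcond; apply: eq_Rintegral => x _; rewrite patchE.
  case: ifPn => [_|].
    rewrite /eta /cutoff /k mul1r.
    transitivity (p1 x * step J (2 / e_ n * u x + - 3) * (u x * d x)); first by ring.
    by rewrite SE; ring.
  rewrite notin_setE /Om /positivity_set /= => /negP; rewrite -leNgt => ux.
  have {}ux : u x = 0 by apply/eqP; rewrite eq_le ux u0.
  by rewrite /k ux sqrtr0 mulr0 !mul0r.
have [B B0 HB] := cutoff'_bound.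
have i1 : mu.-integrable setT (EFin \o (fun x => (`|p2 x * u x| + B * `|p1 x * q x|) * `|r x|)).
  apply: (@integrable_csupp R (fun x => `|p2 x * u x| + B * `|p1 x * q x|) (fun x => `|r x|) A).
  - move=> x; apply: cvgD; last apply: cvgMr.
      by apply: cvg_norm; apply: cvgM; [exact: cp2|exact: cu].
    by apply: cvg_norm; apply: cvgM; [exact: cp1|exact: cq].
  - exact: lint_norm.
  - move=> x /ltW Ax; have [-> -> _ _] := pA x Ax.
    by rewrite !mul0r normr0 mulr0 addr0.
have mr : measurable_fun setT r by exact: lint_measurable lr.
have c1 : \int[mu]_x (r x * eta' n x) @[n --> \oo] -->
    \int[mu]_x (p2 x * u x * r x + p1 x * q x * r x).
  have [] // := @Rdominated R _ _ mu setT (fun n x => r x * eta' n x)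
    (fun x => p2 x * u x * r x + p1 x * q x * r x)
    (fun x => (`|p2 x * u x| + B * `|p1 x * q x|) * `|r x|).
  - move=> n; apply: measurable_funM => //; apply: continuous_measurable_fun => x.
    apply: cvgD; apply: cvgM; [exact: cp2|exact: ccut|exact: cp1|].
    by apply: cvgM; [exact: ccut'|exact: cq].
  - apply: measurable_funD; apply: measurable_funM => //; apply: continuous_measurable_fun => x.
      by apply: cvgM; [exact: cp2|exact: cu].
    by apply: cvgM; [exact: cp1|exact: cq].
  (* Where u vanishes so does u_x, and both the approximations and their limit are 0. *)
  - apply: aeW => x _; have := u0 x; rewrite le_eqVlt => /predU1P[/esym ux|ux].
      apply: cvg_near_cst; apply: nearW => n.
      by rewrite /eta' q0// ux cutoff0 ?(ltW (e0 n))//; ring.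
    apply: cvg_near_cst; apply: filterS (cutoff_cvg e0 ec ux) => n [h1 h2].
    by rewrite /eta' h1 h2; ring.
  - move=> n x _; rewrite normrM mulrC ler_wpM2r//.
    apply: le_trans (ler_normD _ _) _; apply: lerD.
      have /andP[h1 h2] := cutoff_bound (e_ n) (u0 x).
      by rewrite [leLHS]normrM [leRHS]normrM ler_wpM2l// (ger0_norm h1) (ger0_norm (u0 x)).
    by rewrite mulrCA normrM ler_wpM2r//; exact: HB.
have c2 : \int[mu]_x (k n x * sqrt_D3 u x) @[n --> \oo] --> \int[mu]_x (p1 x * u x * d x).
  have mS : measurable_fun setT (sqrt_D3 u) by exact: lint_measurable lS.
  have [] // := @Rdominated R _ _ mu setT (fun n x => k n x * sqrt_D3 u x)
    (fun x => p1 x * u x * d x)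
    (fun x => `|p1 x * Num.sqrt (u x)| * `|sqrt_D3 u x|).
  - move=> n; apply: measurable_funM => //; apply: continuous_measurable_fun => x.
    apply: cvgM; first by apply: cvgM; [exact: cp1|exact: csu].
    apply: (@continuous_comp _ _ _ _ (step J) x).
      by apply: cvgD; [apply: cvgMr; exact: cu|exact: cvg_cst].
    exact: smooth_continuous (step_smooth hJ) _.
  - have -> : (fun x => p1 x * u x * d x) = (fun x => p1 x * Num.sqrt (u x) * sqrt_D3 u x).
      by apply/funext => x; rewrite -mulrA SE mulrA.
    apply: measurable_funM => //; apply: continuous_measurable_fun => x.
    by apply: cvgM; [exact: cp1|exact: csu].
  - apply: aeW => x _; rewrite -mulrA SE mulrA.
    have := u0 x; rewrite le_eqVlt => /predU1P[/esym ux|ux].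
      by apply: cvg_near_cst; apply: nearW => n; rewrite /k ux sqrtr0 mulr0 !mul0r.
    apply: cvg_near_cst; apply: filterS (cutoff_cvg e0 ec ux) => n [h1 _].
    have s1 : step J (2 / e_ n * u x + - 3) = 1.
      by move: h1; rewrite /cutoff mul1r => /(canRL (mulKf (lt0r_neq0 ux))); rewrite mulVf ?gt_eqF.
    by rewrite /k s1 mulr1.
  - apply: (@integrable_csupp R (fun x => `|p1 x * Num.sqrt (u x)|) (fun x => `|sqrt_D3 u x|) A).
    + by move=> x; apply: cvg_norm; apply: cvgM; [exact: cp1|exact: csu].
    + exact: lint_norm.
    + by move=> x /ltW Ax; have [-> _ _ _] := pA x Ax; rewrite mul0r normr0.
  - move=> n x _; rewrite normrM ler_wpM2r// /k normrM ler_piMr//.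
    by rewrite ger0_norm ?step_ge0// step_le1.
have c3 : \int[mu]_x (r x * eta' n x) @[n --> \oo] --> - (\int[mu]_x (p1 x * u x * d x)).
  apply: cvg_trans (cvgN c2); apply: near_eq_cvg; apply: nearW => n.
  by rewrite fctE -rhsE -lhsE key.
have e12 : \int[mu]_x (p2 x * u x * r x + p1 x * q x * r x) = - (\int[mu]_x (p1 x * u x * d x)).
  by apply: cvg_unique c1 c3; exact: Rhausdorff.
by rewrite e12 opprK.
Qed.

Lemma thin_film_identity u psi : test_function setT psi ->
  (forall x, 0 <= u x) -> continuous u -> sobolevH 2 u ->
  weakly_differentiable (positivity_set u) (wderivn 2 u) ->
  sqrt_D3 u \in Lfun mu 2%:E ->
  \int[mu]_x (psi^`()%classic x * u x * D3pos u x) =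
  3 / 2 * \int[mu]_x (psi^`(2)%classic x * u^`()%classic x ^+ 2)
  - 2^-1 * \int[mu]_x (psi^`(4)%classic x * u x ^+ 2).
Proof.
move=> tp; have [A A0 pA] := test_function_supp tp; have [sp _] := tp.
apply: (thin_film_identity_aux (smooth_abscont 1 sp) (smooth_abscont 2 sp)
  (smooth_abscont 3 sp) _ A0).
  exact: abscont_continuous (smooth_abscont 4 sp).
by move=> x Ax; split; [exact: (pA 1%N)|exact: (pA 2%N)|exact: (pA 3%N)|exact: (pA 4%N)].
Qed.

End WithMollifier.
End Identity.

(** * Norms and uniform bounds *)

Section Bounds.
Local Open Scope classical_set_scope.
Local Open Scope ring_scope.
Context {R : realType}.
Local Notation mu := (@lebesgue_measure R).
Implicit Types (f g w F G u psi : R -> R) (a b c d e l m p x y z A B C : R).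

Lemma Lpnorm_powR p f : p != 0 -> (Lpnorm p%:E f < +oo)%E ->
  fine (Lpnorm p%:E f) `^ p = \int[mu]_x (`|f x| `^ p).
Proof.
move=> p0 fin; rewrite /Lpnorm in fin *.
have h : 'N[mu]_p%:E[EFin \o f]%E \is a fin_num by rewrite ge0_fin_numE ?Lnorm_ge0.
rewrite /Rintegral; transitivity (fine (('N[mu]_p%:E[EFin \o f])%E `^ p)%E).
  by rewrite -[in RHS](fineK h).
by rewrite poweR_Lnorm//.
Qed.

Lemma Lfun_fin (p : \bar R) f : f \in Lfun mu p -> (Lpnorm p f < +oo)%E.
Proof. by rewrite inE => /andP[_]; rewrite inE. Qed.

Lemma Lfun_mfun (p : \bar R) f : f \in Lfun mu p -> measurable_fun setT f.
Proof. by rewrite inE => /andP[]; rewrite inE. Qed.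

Lemma Lpnorm1_Rintegral f : f \in Lfun mu 1%:E ->
  fine (Lpnorm 1%:E f) = \int[mu]_x `|f x|.
Proof.
move=> f1; rewrite -[LHS]powRr1 ?fine_ge0 ?Lnorm_ge0// Lpnorm_powR ?oner_neq0 ?(Lfun_fin f1)//.
by apply: eq_Rintegral => x _; rewrite powRr1.
Qed.

Lemma Lpnorm2_Rintegral f : f \in Lfun mu 2%:E ->
  fine (Lpnorm 2%:E f) ^+ 2 = \int[mu]_x (f x ^+ 2).
Proof.
move=> f2; rewrite -powR_mulrn ?fine_ge0 ?Lnorm_ge0// Lpnorm_powR ?pnatr_eq0 ?(Lfun_fin f2)//.
by apply: eq_Rintegral => x _; rewrite powR_mulrn// real_normK// num_real.
Qed.

Lemma Rintegral_sub_le (D E : set (measurableTypeR R)) f : measurable D -> measurable E -> D `<=` E ->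
  mu.-integrable E (EFin \o f) -> (forall x, 0 <= f x) ->
  \int[mu]_(x in D) f x <= \int[mu]_(x in E) f x.
Proof.
move=> mD mE DE fi f0; have fD := integrableS mE mD DE fi.
apply: fine_le; [exact: integrable_fin_num|exact: integrable_fin_num|].
apply: ge0_subset_integral => //; first exact: measurable_int fi.
by move=> x _; rewrite lee_fin.
Qed.

Lemma Rintegral_cst_itv a b c : a <= b -> \int[mu]_(x in `[a, b]) c = c * (b - a).
Proof.
move=> ab; rewrite Rintegral_cst//; congr (_ * _).
transitivity (fine (mu `[a, b])) => //.
rewrite lebesgue_measure_itv/= lte_fin; case: ifPn => //=.
by rewrite -leNgt => ba; apply/esym/eqP; rewrite subr_eq0 eq_le ba.
Qed.

(** Integrate Young's inequality |p| <= l + p^2 / l. The free parameter l gives equicontinuity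
    without square roots. *)
Lemma abscont_modulus u (p : R -> R) b : abscont u p ->
  mu.-integrable setT (EFin \o (fun x => p x ^+ 2)) -> \int[mu]_x (p x ^+ 2) <= b ->
  forall l x y, 0 < l -> `|u y - u x| <= l * `|y - x| + b / l.
Proof.
move=> ap ip pb l.
have H x y : 0 < l -> x <= y -> `|u y - u x| <= l * (y - x) + b / l.
  move=> l0 xy; apply: le_trans (abscont_norm_le ap xy) _.
  have ip2 : mu.-integrable `[x, y] (EFin \o (fun x => p x ^+ 2)) by apply: integrableS ip.
  have ic : mu.-integrable `[x, y] (EFin \o (fun _ : R => l)).
    by apply: (continuous_lint (f := fun=> l)); exact: cst_continuous.
  have ip2l := lintZ l^-1 (integrable_lint ip) x y.
  have H1 : \int[mu]_(z in `[x, y]) `|p z| <= \int[mu]_(z in `[x, y]) (l + l^-1 * p z ^+ 2).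
    apply: le_Rintegral => //.
    - exact: (lint_norm ap.1).
    - exact: (integrableD _ ic ip2l).
    - move=> z _; rewrite -[X in _ + _ * X]real_normK ?num_real//.
      rewrite -(ler_pM2l l0) mulrDr mulrA mulfV ?gt_eqF// mul1r.
      have := sqr_ge0 (`|p z| - l); have := normr_ge0 (p z); nra.
  apply: le_trans H1 _; rewrite RintegralD//.
  rewrite RintegralZl// Rintegral_cst_itv//; apply: lerD => //.
  rewrite mulrC ler_wpM2r ?invr_ge0 ?(ltW l0)//; apply: le_trans pb.
  by apply: Rintegral_sub_le => // z; exact: sqr_ge0.
move=> x y l0; have [xy|/ltW yx] := Order.TotalTheory.leP x y.
  by rewrite (@ger0_norm _ (y - x)) ?subr_ge0//; exact: H.
by rewrite distrC (@ler0_norm _ (y - x)) ?subr_le0// opprB; exact: H.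
Qed.

(** With l = 1 in [abscont_modulus], |u| stays above |u x| - 1 - b on [x, x + 1]; integrate over
    this unit interval. *)
Lemma abscont_sup u (p : R -> R) b : abscont u p ->
  mu.-integrable setT (EFin \o (fun x => p x ^+ 2)) -> \int[mu]_x (p x ^+ 2) <= b ->
  mu.-integrable setT (EFin \o u) ->
  forall x, `|u x| <= \int[mu]_y `|u y| + 1 + b.
Proof.
move=> ap ip pb iu x.
have H y : `[x, x + 1]%classic y -> `|u x| - (1 + b) <= `|u y|.
  rewrite /= in_itv/= => /andP[xy yx].
  have := abscont_modulus ap ip pb x y ltr01; rewrite mul1r divr1 => h.
  have := ler_normB (u y) (u y - u x); rewrite opprB addrCA subrr addr0.
  have : `|y - x| <= 1 by rewrite ger0_norm; lra.
  lra.
have iu' := integrable_norm iu.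
have : \int[mu]_(y in `[x, x + 1]) (`|u x| - (1 + b)) <= \int[mu]_y `|u y|.
  apply: (@le_trans _ _ (\int[mu]_(y in `[x, x + 1]) `|u y|)).
    apply: le_Rintegral => //.
      by apply: (continuous_lint (f := fun=> _)); exact: cst_continuous.
    by apply: integrableS iu'.
  exact: Rintegral_sub_le.
rewrite Rintegral_cst_itv; lra.
Qed.

Section WithMollifier.
Variables (J : R -> R).
Hypothesis hJ : standard_mollifier J.

Lemma mollify_sup w d x t k : 0 < d -> lint w ->
  (forall z, `|z - x| <= d -> `|w z - w x| <= k) ->
  `|\int[mu]_z (Jd J d x z * w z)| <= t -> `|w x| <= t + k.
Proof.
move=> d0 lw wk wt.
have k0 : 0 <= k by apply: le_trans (wk x _) => //; rewrite subrr normr0 ltW.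
have lc c : lint (cst c : R -> R) by apply: continuous_lint; exact: cst_continuous.
have i1 := Jd_integrable hJ x d0 lw; have i2 := Jd_integrable hJ x d0 (lc (w x)).
have i3 := Jd_integrable hJ x d0 (lc k).
have i4 : mu.-integrable setT (EFin \o (fun z => Jd J d x z)).
  by have := Jd_integrable hJ x d0 (lc 1); under eq_fun do rewrite mulr1.
have E c : \int[mu]_z (Jd J d x z * c) = c by rewrite RintegralZr// Jd_int1// mul1r.
have h : `|\int[mu]_z (Jd J d x z * w z) - w x| <= k.
  rewrite -[X in _ - X]E -RintegralB//.
  have i5 := integrableB measurableT i1 i2.
  apply: le_trans (le_normr_Rintegral _ i5) _ => //; rewrite -[leRHS]E.
  apply: le_Rintegral => //; first exact: (integrable_norm i5).
  move=> z _; rewrite -mulrBr normrM (ger0_norm (Jd_ge0 hJ x z d0)).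
  have [zx|zx] := Order.TotalTheory.leP `|z - x| d.
    by rewrite ler_wpM2l// ?Jd_ge0//; exact: wk.
  by rewrite (Jd0 hJ d0 (ltW zx)) !mul0r.
have := ler_normB (\int[mu]_z (Jd J d x z * w z)) (\int[mu]_z (Jd J d x z * w z) - w x).
by rewrite opprB addrCA subrr addr0; lra.
Qed.

End WithMollifier.

Lemma powR_lipschitz m S s t : 0 <= m -> 0 <= s -> s <= S -> 0 <= t -> t <= S ->
  `|s `^ (m + 1) - t `^ (m + 1)| <= (m + 1) * S `^ m * `|s - t|.
Proof.
move=> m1; wlog : s t / t <= s => [H s0 sS t0 tS|].
  have [ts|/ltW st] := Order.TotalTheory.leP t s; first exact: H.
  by rewrite distrC (distrC s); exact: H.
move=> ts s0 sS t0 tS.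
have m10 : m + 1 != 0 by rewrite gt_eqF// ltr_wpDl.
have pS x : 0 <= x -> x <= S -> x `^ m <= S `^ m.
  move=> x0 xS; apply: ge0_ler_powR => //; rewrite nnegrE//; exact: le_trans xS.
rewrite (ger0_norm (x := s - t)) ?subr_ge0//.
move: ts; rewrite le_eqVlt => /predU1P[->|ts]; first by rewrite !subrr normr0 mulr0.
(* The power function is differentiated at positive points only, so t = 0 is settled before the mean
   value theorem. *)
move: t0; rewrite le_eqVlt => /predU1P[<-|t0].
  rewrite powR0// !subr0 ger0_norm ?powR_ge0// powRD; last by rewrite (negbTE m10).
  rewrite powRr1// ler_wpM2r//; apply: le_trans (pS s s0 sS) _.
  by rewrite ler_peMl ?powR_ge0// lerDr.
have [||c + ->] := @MVT R (fun x => x `^ (m + 1)) (fun x => (m + 1) * x `^ (m + 1 - 1)) t s ts.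
- by move=> x; rewrite in_itv/= => /andP[tx _]; apply: is_derive1_powR; exact: lt_trans tx.
- apply: derivable_within_continuous => x; rewrite in_itv/= => /andP[tx _].
  by have [] := @is_derive1_powR R (m + 1) x (lt_le_trans t0 tx).
rewrite in_itv/= addrK => /andP[tc cs].
rewrite normrM (ger0_norm (x := s - t)) ?subr_ge0 ?(ltW ts)//.
rewrite ler_wpM2r ?subr_ge0 ?(ltW ts)// normrM !ger0_norm ?powR_ge0 ?addr_ge0//.
rewrite ler_wpM2l ?addr_ge0// pS ?(ltW (lt_trans t0 tc))//.
exact: le_trans (ltW cs) sS.
Qed.

Lemma Lfun_infty_bound g : g \in Lfun mu +oo%E ->
  exists2 B : R, 0 <= B & {ae mu, forall t, `|g t| <= B}.
Proof.
move=> gi; have := Lfun_fin gi; rewrite /Lpnorm unlock.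
(* The norm with exponent +oo is defined as the essential supremum only when the whole space has
   positive measure. *)
have mu0 : (0 < mu [set: R])%E.
  have : (mu `[0%R, 1%R] <= mu [set: R])%E by apply: le_measure => //; rewrite inE.
  by rewrite lebesgue_measure_itv/= lte_fin ltr01 oppr0 adde0; apply: lt_le_trans; rewrite lte_fin.
rewrite mu0 => fin.
have h0 : (0 <= ess_sup mu (abse \o (EFin \o g)))%E.
  by apply: ess_sup_gee => //; apply/nearW => r /=.
have [B EB] : exists B : R, ess_sup mu (abse \o (EFin \o g)) = B%:E.
  by exists (fine (ess_sup mu (abse \o (EFin \o g)))); rewrite fineK// ge0_fin_numE.
exists B; first by rewrite EB lee_fin in h0.
have /ess_supP : (ess_sup mu (abse \o (EFin \o g)) <= B%:E)%E by rewrite EB.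
by apply: aeS => x /=; rewrite lee_fin.
Qed.

(** Collects what the three Bochner conditions give for u(., t) off a null set of times, with one
    bound B for all these times. *)
Record good_slice B f : Prop := {
  gs_ge0 : forall x, 0 <= f x ;
  gs_cont : continuous f ;
  gs_L1H1 : L1H1 f ;
  gs_norm : L1H1_norm f <= B ;
  gs_H2 : sobolevH 2 f ;
  gs_wd : weakly_differentiable (positivity_set f) (wderivn 2 f) ;
  gs_D3 : sqrt_D3 f \in Lfun mu 2%:E }.

Lemma L1H1_integrable f : L1H1 f ->
  [/\ mu.-integrable setT (EFin \o f), mu.-integrable setT (EFin \o (fun x => f x ^+ 2)),
      mu.-integrable setT (EFin \o (fun x => wderiv setT f x ^+ 2))
    & is_weak_derivative setT f (wderiv setT f)].
Proof.
move=> [f1 [fd f2]]; split.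
- exact/Lfun1_integrable.
- exact: Lfun2_integrable_sqr (f2 0%N isT).
- exact: Lfun2_integrable_sqr (f2 1%N isT).
- exact: wderivP (fd 0%N isT).
Qed.

Lemma L1H1_norm_bounds f B : L1H1 f -> L1H1_norm f <= B ->
  [/\ \int[mu]_x `|f x| <= B, \int[mu]_x (f x ^+ 2) <= B ^+ 2
    & \int[mu]_x (wderiv setT f x ^+ 2) <= B ^+ 2].
Proof.
move=> [f1 [fd f2]]; rewrite /L1H1_norm /sobolevH_norm big_ord_recr big_ord1/=.
rewrite (Lpnorm1_Rintegral f1) (Lpnorm2_Rintegral (f2 0%N isT)) (Lpnorm2_Rintegral (f2 1%N isT)).
have /= := f2 0%N isT; have /= := f2 1%N isT.
set I1 := (X in X + _ <= _); set I2 := \int[mu]_x (f x ^+ 2); set I3 := \int[mu]_x _ => _ _.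
have I10 : 0 <= I1 by exact: Rintegral_ge0.
have I20 : 0 <= I2 by apply: Rintegral_ge0 => x _; exact: sqr_ge0.
have I30 : 0 <= I3 by apply: Rintegral_ge0 => x _; exact: sqr_ge0.
have s0 := sqrtr_ge0 (I2 + I3).
have E : Num.sqrt (I2 + I3) ^+ 2 = I2 + I3 by rewrite sqr_sqrtr// addr_ge0.
move=> h; have h1 : Num.sqrt (I2 + I3) <= B by lra.
have h2 : I2 + I3 <= B ^+ 2 by rewrite -E; nra.
have h3 : I1 <= B by lra.
by split; [exact: h3|lra|lra].
Qed.

End Bounds.

(** * Integrals over time slices *)

Section NullModification.
Local Open Scope classical_set_scope.
Local Open Scope ring_scope.
Context dp (T : measurableType dp) {R : realType}.
Variable nu : {measure set T -> \bar R}.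
Import HBNNSimple.

(** The integral of a nonnegative function, measurable or not, is the supremum over the simple
    functions below it; each of these can be set to 0 on N without changing its integral. *)
Lemma integral_null_le (f g : T -> \bar R) (N : set T) : measurable N -> nu N = 0%E ->
  (forall x, (0 <= f x)%E) -> (forall x, (0 <= g x)%E) ->
  (forall x, ~ N x -> f x = g x) -> (\int[nu]_x f x <= \int[nu]_x g x)%E.
Proof.
move=> mN N0 f0 g0 fg; rewrite !ge0_integralTE//.
apply: ge_ereal_sup => _ [h /= hf <-].
apply: ereal_sup_ubound => /=; exists (proj_nnsfun h (measurableC mN)).
  move=> x; rewrite /= mindicE; have [Nx|nNx] := pselect (N x).
    by rewrite memNset ?mulr0// => h'; exact: h'.
  by rewrite mem_set// mulr1 -fg.
rewrite -!integralT_nnsfun; apply: ge0_ae_eq_integral => //.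
- exact/measurable_EFinP.
- exact/measurable_EFinP.
- by move=> x _; rewrite lee_fin.
- by move=> x _; rewrite lee_fin.
exists N; split => // x /= H; apply: contrapT => nNx; apply: H => _.
by rewrite mindicE mem_set// mulr1.
Qed.

(** Serves for the time integrals of the weak formulation, whose integrands involve a chosen weak
    derivative at each time and carry no measurability in time. *)
Lemma Rintegral_null_mod (D N : set T) (f g : T -> R) : measurable N -> nu N = 0%E ->
  (forall x, D x -> ~ N x -> f x = g x) ->
  \int[nu]_(x in D) f x = \int[nu]_(x in D) g x.
Proof.
move=> mN N0 fg; rewrite Rintegral_mkcond [RHS]Rintegral_mkcond.
have {}fg x : ~ N x -> (f \_ D) x = (g \_ D) x.
  by move=> nN; rewrite !patchE; case: ifPn => // /set_mem Dx; exact: fg.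
congr fine; rewrite integralE [RHS]integralE.
have H (f1 g1 : T -> R) : (forall x, ~ N x -> f1 x = g1 x) ->
    (\int[nu]_x (EFin \o f1)^\+ x = \int[nu]_x (EFin \o g1)^\+ x)%E /\
    (\int[nu]_x (EFin \o f1)^\- x = \int[nu]_x (EFin \o g1)^\- x)%E.
  move=> e; split; apply/eqP; rewrite eq_le; apply/andP; split;
    by apply: (integral_null_le mN N0) => // x nN; rewrite ?funeposE ?funenegE/= e.
by have [h1 h2] := H _ _ fg; congr (_ - _)%E; [exact: h1|exact: h2].
Qed.

End NullModification.

(** * Functionals of a single time slice *)

Section TimeIntegrals.
Local Open Scope classical_set_scope.
Local Open Scope ring_scope.
Context {R : realType}.
Local Notation mu := (@lebesgue_measure R).

(** Tonelli's theorem gives measurability for the positive and the negative part separately, whether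
    or not the slices are integrable. *)
Lemma measurable_Rintegral_slice (h : R * R -> R) : measurable_fun setT h ->
  measurable_fun setT (fun s : R => \int[mu]_x h (s, x)).
Proof.
move=> mh.
have mh' : measurable_fun setT (EFin \o h) by exact/measurable_EFinP.
have E : (fun s : R => (\int[mu]_x (h (s, x))%:E)%E) =
  (fun s : R => (\int[mu]_x ((EFin \o h)^\+ (s, x)) - \int[mu]_x ((EFin \o h)^\- (s, x)))%E).
  apply/funext => s; rewrite integralE; congr (_ - _)%E;
    by apply: eq_integral => x _; rewrite ?funeposE ?funenegE.
apply: (@measurableT_comp _ _ _ _ _ _ fine); first exact: fine_measurable.
rewrite E; apply: emeasurable_funB.
- exact: (@measurable_fun_fubini_tonelli_F _ _ (measurableTypeR R) (measurableTypeR R) R mu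
    ((EFin \o h)^\+%E) (measurable_funepos mh') (funepos_ge0 _)).
- exact: (@measurable_fun_fubini_tonelli_F _ _ (measurableTypeR R) (measurableTypeR R) R mu
    ((EFin \o h)^\-%E) (measurable_funeneg mh') (funeneg_ge0 _)).
Qed.

Implicit Types (f g psi a b c : R -> R) (m B S s t x y d k : R).

(** One functional for both uses: coefficients built from derivatives of psi give the tested
    equation, constant ones the virial identity. *)
Definition slice_integral m a b c f : R :=
  \int[mu]_x (a x * f^`()%classic x ^+ 2 + b x * f x ^+ 2 + c x * f x `^ (m + 1)).

Definition bounded_continuous a k := continuous a /\ forall x, `|a x| <= k.

Section Slices.
Variables (J : R -> R) (m : R).
Hypotheses (hJ : standard_mollifier J) (m0 : 0 <= m).

(** The sup bound of [abscont_sup] for mass at most B and squared gradient norm at most B^2. *)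
Definition sup_bound B := B + 1 + B ^+ 2.

Lemma good_slice_facts B f : good_slice B f ->
  [/\ forall x, derivable f x (1:R), abscont f (f^`()%classic), continuous (f^`()%classic) &
      {ae mu, forall x, wderiv setT f x = f^`()%classic x}] /\
  [/\ mu.-integrable setT (EFin \o f), mu.-integrable setT (EFin \o (fun x => f x ^+ 2)),
      mu.-integrable setT (EFin \o (fun x => f^`()%classic x ^+ 2)) &
      \int[mu]_x (wderiv setT f x ^+ 2) = \int[mu]_x (f^`()%classic x ^+ 2)] /\
  [/\ \int[mu]_x f x <= B, \int[mu]_x (f x ^+ 2) <= B ^+ 2,
      \int[mu]_x (f^`()%classic x ^+ 2) <= B ^+ 2 & forall x, f x <= sup_bound B].
Proof.
move=> gs; have f0 := gs_ge0 gs.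
have [df af aq wq] := H2_regularity hJ (gs_cont gs) (gs_H2 gs).
have cq := abscont_continuous aq.
have [i1 i2 i3 wd] := L1H1_integrable (gs_L1H1 gs).
have [b1 b2 b3] := L1H1_norm_bounds (gs_L1H1 gs) (gs_norm gs).
have mq2 : measurable_fun setT (fun x => f^`()%classic x ^+ 2).
  by apply: measurable_funX; exact: continuous_measurable_fun.
have mw2 : measurable_fun setT (fun x => wderiv setT f x ^+ 2).
  by apply/measurable_EFinP; exact: measurable_int i3.
have E3 : \int[mu]_x (wderiv setT f x ^+ 2) = \int[mu]_x (f^`()%classic x ^+ 2).
  by apply: Rintegral_ae_eq => //; apply: aeS wq => x ->.
have i3' : mu.-integrable setT (EFin \o (fun x => f^`()%classic x ^+ 2)).
  apply/integrableP; split; first exact/measurable_EFinP.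
  move/integrableP : i3 => [_]; congr (_ < +oo)%E; apply: ae_eq_integral => //.
  - by apply: measurableT_comp => //; exact/measurable_EFinP.
  - by apply: measurableT_comp => //; exact/measurable_EFinP.
  - by apply: aeS wq => x /= -> _.
have b1' : \int[mu]_x f x <= B.
  by apply: le_trans b1; apply: le_Rintegral => //; [exact: integrable_norm|move=> x _; exact: ler_norm].
rewrite E3 in b3; split; [split; [exact: df|exact: af|exact: cq|exact: wq]|].
split; [split; [exact: i1|exact: i2|exact: i3'|exact: E3]|].
split; [exact: b1'|exact: b2|exact: b3|move=> x].
apply: le_trans (ler_norm _) _; apply: le_trans (abscont_sup af i3' b3 i1 x) _.
by rewrite /sup_bound lerD2r lerD2r; exact: b1.
Qed.

Lemma good_slice_pow B f : good_slice B f ->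
  mu.-integrable setT (EFin \o (fun x => f x `^ (m + 1))) /\
  \int[mu]_x (f x `^ (m + 1)) <= sup_bound B `^ m * B.
Proof.
move=> gs; have f0 := gs_ge0 gs.
have [[df af cq wq] [[i1 i2 i3 E3] [b1 b2 b3 fS]]] := good_slice_facts gs.
have S0 : 0 <= sup_bound B by apply: le_trans (fS 0); exact: f0.
have pE x : f x `^ (m + 1) <= sup_bound B `^ m * f x.
  rewrite powRD; last by rewrite gt_eqF ?ltr_wpDl.
  rewrite powRr1// ler_wpM2r//; apply: ge0_ler_powR => //; rewrite nnegrE//.
have iS : mu.-integrable setT (EFin \o (fun x => sup_bound B `^ m * f x)).
  exact: (integrableZl measurableT _ i1).
have mp : measurable_fun setT (fun x => f x `^ (m + 1)).
  apply: (@measurableT_comp _ _ _ _ _ _ (@powR R ^~ (m + 1))) => //.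
  by apply: continuous_measurable_fun; exact: gs_cont gs.
have ip : mu.-integrable setT (EFin \o (fun x => f x `^ (m + 1))).
  apply: le_integrable iS => //; first exact/measurable_EFinP.
  move=> x _; rewrite !abse_EFin lee_fin !ger0_norm ?powR_ge0//.
  by rewrite mulr_ge0 ?powR_ge0.
split => //; apply: (@le_trans _ _ (\int[mu]_x (sup_bound B `^ m * f x))).
  exact: le_Rintegral.
by rewrite RintegralZl// ler_wpM2l// powR_ge0.
Qed.

Lemma bounded_mul_integrable a k f : bounded_continuous a k ->
  mu.-integrable setT (EFin \o f) -> mu.-integrable setT (EFin \o (fun x => a x * f x)).
Proof.
move=> [ca ab] fi; have mf : measurable_fun setT f by apply/measurable_EFinP; exact: measurable_int fi.
have ki := integrableZl measurableT k (integrable_norm fi).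
apply: le_integrable ki => //.
  by apply/measurable_EFinP; apply: measurable_funM => //; exact: continuous_measurable_fun.
move=> x _; rewrite !abse_EFin lee_fin !normrM normr_id ler_wpM2r//.
exact: le_trans (ler_norm _).
Qed.

Lemma slice_integrable B f a b c ka kb kc : good_slice B f ->
  bounded_continuous a ka -> bounded_continuous b kb -> bounded_continuous c kc ->
  [/\ mu.-integrable setT (EFin \o (fun x => a x * f^`()%classic x ^+ 2)),
      mu.-integrable setT (EFin \o (fun x => b x * f x ^+ 2)) &
      mu.-integrable setT (EFin \o (fun x => c x * f x `^ (m + 1)))] /\
  slice_integral m a b c f = \int[mu]_x (a x * f^`()%classic x ^+ 2) +
    \int[mu]_x (b x * f x ^+ 2) + \int[mu]_x (c x * f x `^ (m + 1)).
Proof.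
move=> gs ha hb hc.
have [_ [[i1 i2 i3 _] _]] := good_slice_facts gs.
have [i4 _] := good_slice_pow gs.
have j1 := bounded_mul_integrable ha i3; have j2 := bounded_mul_integrable hb i2.
have j3 := bounded_mul_integrable hc i4.
split => //; rewrite /slice_integral RintegralD//; first by rewrite RintegralD.
exact: (integrableD measurableT j1 j2).
Qed.

Definition slice_bound B ka kb kc := ka * B ^+ 2 + kb * B ^+ 2 + kc * (sup_bound B `^ m * B).

Lemma Rintegral_bounded_mul a k f K : bounded_continuous a k -> (forall x, 0 <= f x) ->
  mu.-integrable setT (EFin \o f) -> \int[mu]_x f x <= K ->
  `|\int[mu]_x (a x * f x)| <= k * K.
Proof.
move=> ha f0 fi fK; have ai := bounded_mul_integrable ha fi.
apply: le_trans (le_normr_Rintegral _ ai) _ => //.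
have k0 : 0 <= k by apply: le_trans (ha.2 0).
apply: (@le_trans _ _ (\int[mu]_x (k * f x))).
  apply: le_Rintegral => //; first exact: integrable_norm.
    exact: (integrableZl measurableT k fi).
  by move=> x _; rewrite normrM (ger0_norm (f0 x)) ler_wpM2r//; exact: ha.2.
by rewrite RintegralZl// ler_wpM2l.
Qed.

Lemma slice_integral_le B f a b c ka kb kc : good_slice B f ->
  bounded_continuous a ka -> bounded_continuous b kb -> bounded_continuous c kc ->
  `|slice_integral m a b c f| <= slice_bound B ka kb kc.
Proof.
move=> gs ha hb hc; have [_ ->] := slice_integrable gs ha hb hc.
have [_ [[i1 i2 i3 _] [b1 b2 b3 _]]] := good_slice_facts gs.
have [i4 b4] := good_slice_pow gs.
rewrite /slice_bound; apply: le_trans (ler_normD _ _) _; apply: lerD.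
  apply: le_trans (ler_normD _ _) _; apply: lerD.
    by apply: Rintegral_bounded_mul => // x; exact: sqr_ge0.
  by apply: Rintegral_bounded_mul => // x; exact: sqr_ge0.
by apply: Rintegral_bounded_mul => // x; exact: powR_ge0.
Qed.

Lemma test_bounded n psi k : test_function setT psi -> exists K,
  bounded_continuous (fun x => k * psi^`(n)%classic x) K.
Proof.
move=> tp; have [C C0 HC] := test_function_bounded n tp; exists (`|k| * C); split.
  move=> x; apply: cvgMr; apply: smooth_continuous; apply: smooth_derive1n.
  by case: tp.
by move=> x; rewrite normrM ler_wpM2l.
Qed.

Lemma bounded_continuous_cst k : bounded_continuous (cst k) `|k|.
Proof. by split => //; exact: cst_continuous. Qed.

(** Removes u_xxx from the weak formulation through [thin_film_identity]; only u and u_x remain,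
    which are jointly measurable in time and space. *)
Lemma slice_integral_test B f psi : good_slice B f -> test_function setT psi ->
  \int[mu]_x (psi^`()%classic x * f x * D3pos f x) -
    m / (m + 1) * \int[mu]_x (psi^`(2)%classic x * f x `^ (m + 1)) =
  slice_integral m (fun x => 3 / 2 * psi^`(2)%classic x) (fun x => - 2^-1 * psi^`(4)%classic x)
    (fun x => - (m / (m + 1)) * psi^`(2)%classic x) f.
Proof.
move=> gs tp.
have [K1 h1] := test_bounded 2 (3 / 2) tp; have [K2 h2] := test_bounded 4 (- 2^-1) tp.
have [K3 h3] := test_bounded 2 (- (m / (m + 1))) tp.
have [_ ->] := slice_integrable gs h1 h2 h3.
rewrite (thin_film_identity hJ tp (gs_ge0 gs) (gs_cont gs) (gs_H2 gs) (gs_wd gs) (gs_D3 gs)).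
have [K1' h1'] := test_bounded 2 1 tp; have [K2' h2'] := test_bounded 4 1 tp.
have [[j1 j2 j3] _] := slice_integrable gs h1' h2' h1'.
have E k n (g : R -> R) : mu.-integrable setT (EFin \o (fun x => 1 * psi^`(n)%classic x * g x)) ->
    \int[mu]_x (k * psi^`(n)%classic x * g x) = k * \int[mu]_x (psi^`(n)%classic x * g x).
  move=> ii; rewrite -RintegralZl//; last by move: ii; under eq_fun do rewrite mul1r.
  by apply: eq_Rintegral => x _; rewrite mulrA.
by rewrite (E _ _ _ j1) (E _ _ _ j2) (E _ _ _ j3) !mulNr.
Qed.

End Slices.

End TimeIntegrals.

(** * The weak formulation at almost every time *)

Section Evolution.
Local Open Scope classical_set_scope.
Local Open Scope ring_scope.
Context {R : realType}.
Local Notation mu := (@lebesgue_measure R).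
Implicit Types (f g psi a b c : R -> R) (B S s t x y d e k : R).

Lemma bounded_lint f k : measurable_fun setT f -> (forall x, `|f x| <= k) -> lint f.
Proof.
move=> mf fk x y.
have fin : (mu `[x, y] < +oo)%E.
  by rewrite lebesgue_measure_itv/=; case: ifPn => //; rewrite -EFinD ltry.
apply: measurable_bounded_integrable => //; first exact: measurable_funTS.
- exists k; split; first exact: num_real.
  by move=> K kK z _; apply: le_trans (fk z) (ltW kK).
Qed.

Definition good_times (T : R) (N : set R) : set R := `]0, T[%classic `\` N.

Variables (J : R -> R) (m : R) (u0 : R -> R) (T : R) (u : R -> R -> R).
Hypotheses (hJ : standard_mollifier J) (m1 : 1 <= m).
Hypothesis ws : weak_entropy_solution m u0 T u.

Let m0 : 0 <= m. Proof. exact: le_trans ler01 m1. Qed.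

Lemma good_times_exist : exists B N, [/\ 0 <= B, measurable N, mu N = 0%E &
  forall t, good_times T N t -> good_slice B (u t)].
Proof.
have [_ [g1 g1oo h1]] := wes_LooL1H1 ws.
have [_ [g2 _ h2]] := wes_L2H2 ws.
have [_ [g3 _ h3]] := wes_L2D3 ws.
have [B B0 HB] := Lfun_infty_bound g1oo.
have [N [mN N0 HN]] := aeI (aeI h1 h2) (aeI h3 HB).
exists B, N; split => // t [tT nNt].
have : ~ ~ ((t \in `]0, T[ -> L1H1 (u t) /\ g1 t = L1H1_norm (u t)) /\
   (t \in `]0, T[ -> sobolevH 2 (u t) /\ g2 t = sobolevH_norm 2 (u t))) by move=> H; apply: nNt; apply: HN => /= -[].
move=> /contrapT[H1 H2].
have : ~ ~ ((t \in `]0, T[ ->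
   [set f | weakly_differentiable (positivity_set f) (wderivn 2 f) /\
             sqrt_D3 f \in Lfun mu 2%:E] (u t) /\ g3 t = fine (Lpnorm 2%:E (sqrt_D3 (u t)))) /\ `|g1 t| <= B).
  by move=> H; apply: nNt; apply: HN => /= -[].
move=> /contrapT[H3 Hb].
have [L1 e1] := H1 tT; have [L2 _] := H2 tT; have [[L3 L4] _] := H3 tT.
have t0T : 0 < t < T by move: tT; rewrite /= in_itv.
have [p1 p2 _] := wes_slice ws t0T.
split => //; rewrite -e1; exact: le_trans (ler_norm _) Hb.
Qed.

Section GoodTimes.
Variables (B : R) (N : set R).
Hypotheses (mN : measurable N) (N0 : mu N = 0%E).
Hypothesis good : forall t, good_times T N t -> good_slice B (u t).

Let G := good_times T N.

Let mG : measurable G. Proof. by apply: measurableD. Qed.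

(** Set to 0 outside the good times, so that it is bounded and measurable on the whole line. *)
Definition time_slice a b c : R -> R := (slice_integral m a b c \o u) \_ G.

Let v := (fun z : R * R => u z.1 z.2) \_ (G `*` setT).

Let mv : measurable_fun setT v.
Proof.
apply/(measurable_restrictT _ _).1; first exact: measurableX.
have [mu1 _] := wes_LooL1H1 ws.
apply: measurable_funS mu1; first exact: measurableX.
by move=> z [[? _] _]; split.
Qed.

Let vE s x : v (s, x) = if s \in G then u s x else 0.
Proof. by rewrite /v patchE in_setX in_setT andbT. Qed.

(** Difference quotients in space of the jointly measurable v. Slices at good times are
    differentiable, so u_x is their pointwise limit and is jointly measurable as well. *)
Let dq (n : nat) (z : R * R) := n.+1%:R * (v (z.1, z.2 + n.+1%:R^-1) - v z).

Let mdq n : measurable_fun setT (dq n).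
Proof.
apply: measurable_funM => //; apply: measurable_funB => //.
apply: (measurableT_comp mv); apply: measurable_fun_pair => //=.
by apply: measurable_funD => //; exact: measurable_snd.
Qed.

Let q (z : R * R) := if z.1 \in G then (u z.1)^`()%classic z.2 else 0.

Let dq_cvg z : dq n z @[n --> \oo] --> q z.
Proof.
case: z => s x; rewrite /q /dq /=; case: ifPn => sG; last first.
  apply: cvg_near_cst; apply: nearW => n.
  by rewrite !vE (negbTE sG) subrr mulr0.
under eq_fun do rewrite !vE sG.
have [[df _ _ _] _] := good_slice_facts hJ (good (set_mem sG)).
have /cvg_ex[l hl] := df x.
have e : (u s)^`()%classic x = l.
  by rewrite derive1E; apply/cvg_lim => //; exact: Rhausdorff.
rewrite e.
have nz (n : nat) : (n.+1%:R^-1 : R) != 0 by rewrite invr_neq0// pnatr_eq0.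
have := (cvgr_dnbhsP _ 0 l).1 hl (fun n => n.+1%:R^-1) (conj nz cvg_harmonic).
apply: cvg_trans; apply: near_eq_cvg; apply: nearW => n.
rewrite invrK; congr (_ * (u s _ - u s x)); rewrite /= addrC; congr (_ + _).
exact: mulr1.
Qed.

Let mq : measurable_fun setT q.
Proof. by apply: (measurable_fun_cvg mdq) => z _; exact: dq_cvg. Qed.

Lemma time_slice_measurable a b c : continuous a -> continuous b -> continuous c ->
  measurable_fun setT (time_slice a b c).
Proof.
move=> ca cb cc.
pose h (z : R * R) := a z.2 * q z ^+ 2 + b z.2 * v z ^+ 2 + c z.2 * v z `^ (m + 1).
have mh : measurable_fun setT h.
  have m2 (a0 : R -> R) : continuous a0 -> measurable_fun setT (fun z : R * R => a0 z.2).
    move=> ca0; apply: (measurableT_comp (f := a0)); last exact: measurable_snd.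
    exact: continuous_measurable_fun.
  apply: measurable_funD; first apply: measurable_funD.
  - by apply: measurable_funM; [exact: m2|apply: measurable_funX].
  - by apply: measurable_funM; [exact: m2|apply: measurable_funX].
  - apply: measurable_funM; first exact: m2.
    exact: (@measurableT_comp _ _ _ _ _ _ (@powR R ^~ (m + 1))).
have := measurable_Rintegral_slice mh; congr (measurable_fun _ _).
apply/funext => s; rewrite /time_slice patchE; case: ifPn => sG.
  by apply: eq_Rintegral => x _; rewrite /h vE /q /= sG.
rewrite -[RHS](mul0r (fine (mu setT))) -(Rintegral_cst mu measurableT).
apply: eq_Rintegral => x _; rewrite /h vE /q /= (negbTE sG) powR0 ?expr0n/= ?mulr0 ?addr0//.
by rewrite gt_eqF// ltr_wpDl.
Qed.

(** The absolute value on the right keeps the bound valid at exceptional times, where the slice is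
    0. *)
Lemma time_slice_le a b c ka kb kc s :
  bounded_continuous a ka -> bounded_continuous b kb -> bounded_continuous c kc ->
  `|time_slice a b c s| <= `|slice_bound m B ka kb kc|.
Proof.
move=> ha hb hc; rewrite /time_slice patchE; case: ifPn => sG; last by rewrite normr0.
apply: le_trans (ler_norm _).
exact: (slice_integral_le hJ m0 (good (set_mem sG)) ha hb hc).
Qed.

Lemma time_slice_lint a b c ka kb kc :
  bounded_continuous a ka -> bounded_continuous b kb -> bounded_continuous c kc ->
  lint (time_slice a b c).
Proof.
move=> ha hb hc; apply: bounded_lint.
  by apply: time_slice_measurable; [exact: ha.1|exact: hb.1|exact: hc.1].
by move=> s; exact: (time_slice_le s ha hb hc).
Qed.

Definition test_slice psi := time_slice (fun x => 3 / 2 * psi^`(2)%classic x)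
  (fun x => - 2^-1 * psi^`(4)%classic x) (fun x => - (m / (m + 1)) * psi^`(2)%classic x).

Lemma test_slice_lint psi : test_function setT psi -> lint (test_slice psi).
Proof.
move=> tp.
have [K1 h1] := test_bounded 2 (3 / 2) tp; have [K2 h2] := test_bounded 4 (- 2^-1) tp.
have [K3 h3] := test_bounded 2 (- (m / (m + 1))) tp.
exact: (time_slice_lint h1 h2 h3).
Qed.

Lemma weak_evolution psi t : 0 < t < T -> test_function setT psi ->
  \int[mu]_x (psi x * u t x) - \int[mu]_x (psi x * u0 x) =
  \int[mu]_(s in `[0, t]) test_slice psi s.
Proof.
move=> t0T tp; rewrite (wes_weak ws t0T tp).
have [t0 tT] := andP t0T.
(* Time 0 lies in [0, t] but is not a good time, so it joins the exceptional set. *)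
have mN0 : measurable (N `|` [set (0:R)]) by exact: measurableU.
have N00 : mu (N `|` [set (0:R)]) = 0%E.
  by apply: null_set_setU => //; exact: lebesgue_measure_set1.
have inG s : `[0, t]%classic s -> ~ (N `|` [set (0:R)]) s -> s \in G.
  rewrite /= in_itv/= => /andP[s0 st] /not_orP[nN /= s00]; rewrite inE; split => //=.
  rewrite in_itv/= lt_neqAle s0 (le_lt_trans st tT) !andbT eq_sym; exact/eqP.
pose c1 := fun x : R => 1 * psi^`(2)%classic x.
have [K hc1] := test_bounded 2 1 tp.
have h0 := @bounded_continuous_cst R 0.
pose X2 := time_slice (cst 0) (cst 0) c1.
have lX2 : lint X2 by exact: (time_slice_lint h0 h0 hc1).
have lW := test_slice_lint tp.
have e2 : \int[mu]_(s in `[0, t]) (\int[mu]_x (psi^`(2)%classic x * u s x `^ (m + 1))) =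
    \int[mu]_(s in `[0, t]) X2 s.
  apply: (@Rintegral_null_mod _ (measurableTypeR R) R mu _ _ _ _ mN0 N00) => s st nN.
  rewrite /X2 /time_slice patchE inG//; apply: eq_Rintegral => x _.
  by rewrite /c1 !mul0r !add0r mul1r.
(* The term with u_xxx alone is [test_slice] plus the power term [X2]; both are integrable in time,
   so the integrals may be split and [X2] cancels. *)
have e1 : \int[mu]_(s in `[0, t]) (\int[mu]_x (psi^`()%classic x * u s x * D3pos (u s) x)) =
    \int[mu]_(s in `[0, t]) (test_slice psi s + m / (m + 1) * X2 s).
  apply: (@Rintegral_null_mod _ (measurableTypeR R) R mu _ _ _ _ mN0 N00) => s st nN; have sG := inG s st nN.
  rewrite /test_slice /time_slice !patchE sG /=.
  rewrite -(slice_integral_test hJ m0 (good (set_mem sG)) tp) -[LHS](subrK (m / (m + 1) *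
    \int[mu]_x (psi^`(2)%classic x * u s x `^ (m + 1)))); congr (_ + _ * _).
  by rewrite /X2 /time_slice patchE sG; apply: eq_Rintegral => x _; rewrite /c1 !mul0r !add0r mul1r.
rewrite e1 e2; move: X2 (test_slice psi) lX2 lW {e1 e2} => X2 W lX2 lW.
rewrite RintegralD; [|by []|exact: lW|exact: (lintZ _ lX2)].
by rewrite RintegralZl; [rewrite addrK|by []|exact: lX2].
Qed.

(** The Lipschitz constant sees psi only through bounds on two derivatives, so it is common to all
    translates of a mollifier. *)
Lemma weak_evolution_lipschitz psi k2 k4 : test_function setT psi ->
  (forall x, `|psi^`(2)%classic x| <= k2) -> (forall x, `|psi^`(4)%classic x| <= k4) ->
  forall x y, x <= y -> `|\int[mu]_(s in `[x, y]) test_slice psi s| <=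
  `|slice_bound m B (3 / 2 * k2) (2^-1 * k4) (m / (m + 1) * k2)| * (y - x).
Proof.
move=> tp h2 h4 x y xy; have lW := test_slice_lint tp.
apply: le_trans (le_normr_Rintegral _ (lW x y)) _ => //.
rewrite -Rintegral_cst_itv//; apply: le_Rintegral => //.
- exact: (lint_norm lW).
- by apply: (continuous_lint (f := fun=> _)); exact: cst_continuous.
have mm : 0 <= m / (m + 1) by rewrite divr_ge0// addr_ge0.
have cc k n : continuous (fun x => k * psi^`(n)%classic x).
  move=> z; apply: cvgMr; apply: smooth_continuous; apply: smooth_derive1n.
  by case: tp.
move=> s _; apply: time_slice_le; (split; first exact: cc); move=> z; rewrite normrM.
- by rewrite (ger0_norm (x := 3 / 2)) ?ler_wpM2l// divr_ge0.
- by rewrite normrN (ger0_norm (x := 2^-1)) ?ler_wpM2l// invr_ge0.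
- by rewrite normrN (ger0_norm mm) ler_wpM2l.
Qed.

End GoodTimes.
End Evolution.

(** * Continuity in time of the power mass *)

Section TimeContinuity.
Local Open Scope classical_set_scope.
Local Open Scope ring_scope.
Context {R : realType}.
Local Notation mu := (@lebesgue_measure R).
Implicit Types (f g psi a b c : R -> R) (B S s t x y z d e k l : R).

(** Asks less than [good_slice], so that it also covers the continuous representative of the initial
    datum, which is only in H^1. *)
Record h1_slice B f : Prop := {
  h1_ge0 : forall x, 0 <= f x ;
  h1_int : mu.-integrable setT (EFin \o f) ;
  h1_mass : \int[mu]_x f x <= B ;
  h1_abscont : exists2 p, abscont f p &
    mu.-integrable setT (EFin \o (fun x => p x ^+ 2)) /\ \int[mu]_x (p x ^+ 2) <= B ^+ 2 }.

Lemma h1_slice_le B B' f : 0 <= B -> B <= B' -> h1_slice B f -> h1_slice B' f.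
Proof.
move=> B0 BB' [f0 fi fB [p fp [ip pB]]]; split => //; first exact: le_trans BB'.
exists p => //; split => //; apply: le_trans pB _.
by rewrite ler_pXn2r ?nnegrE// (le_trans B0).
Qed.

Lemma h1_slice_continuous B f : h1_slice B f -> continuous f.
Proof. by move=> [_ _ _ [p fp _]]; exact: abscont_continuous fp. Qed.

Lemma h1_slice_modulus B f l x y : h1_slice B f -> 0 < l ->
  `|f y - f x| <= l * `|y - x| + B ^+ 2 / l.
Proof. by move=> [_ _ _ [p fp [ip pB]]] l0; exact: (abscont_modulus fp ip pB). Qed.

Lemma h1_slice_sup B f x : h1_slice B f -> f x <= sup_bound B.
Proof.
move=> [f0 fi fB [p fp [ip pB]]].
apply: le_trans (ler_norm _) _; apply: le_trans (abscont_sup fp ip pB fi x) _.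
rewrite /sup_bound lerD2r lerD2r; apply: le_trans fB.
by rewrite le_eqVlt; apply/predU1P; left; apply: eq_Rintegral => y _; rewrite ger0_norm.
Qed.

Section WithMollifier.
Variables (J : R -> R).
Hypothesis hJ : standard_mollifier J.

Lemma good_h1_slice B f : good_slice B f -> h1_slice B f.
Proof.
move=> gs; have [[_ af _ _] [[i1 _ i3 _] [b1 _ b3 _]]] := good_slice_facts hJ gs.
split; [exact: gs_ge0 gs|exact: i1|exact: b1|].
by exists (f^`()%classic); [exact: af|split; [exact: i3|exact: b3]].
Qed.

(** For the initial datum, which need not be continuous. Nonnegativity passes to the continuous
    representative because the two agree on a dense set. *)
Lemma L1H1_representative f : L1H1 f -> (forall x, 0 <= f x) ->
  exists B g, [/\ 0 <= B, h1_slice B g & {ae mu, forall x, f x = g x}].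
Proof.
move=> Lf f0; have [i1 i2 i3 wd] := L1H1_integrable Lf.
have [b1 b2 b3] := L1H1_norm_bounds Lf (lexx _).
have [g ag fg] := weak_abscont hJ wd.
have cg := abscont_continuous ag.
exists (L1H1_norm f), g.
have B0 : 0 <= L1H1_norm f by apply: le_trans b1; apply: Rintegral_ge0.
split => //; have mf : measurable_fun setT f by apply/measurable_EFinP; exact: measurable_int i1.
have mg : measurable_fun setT g by exact: continuous_measurable_fun.
have g0 x : 0 <= g x.
  rewrite leNgt; apply/negP => gx.
  have /cvgrPdist_lt/(_ (- g x)) := cg x; rewrite oppr_gt0 => /(_ gx) [r /= r0 hr].
  have [|y fgy /andP[xy yx]] := @ae_dense R _ fg x (x + r); first lra.
  have := hr y; rewrite /= ltr0_norm; last lra.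
  have gy0 : 0 <= g y by rewrite -fgy.
  move=> H; have : `|g x - g y| < - g x by apply: H; lra.
  by rewrite ltr0_norm; lra.
have eg : \int[mu]_x f x = \int[mu]_x g x.
  by apply: Rintegral_ae_eq => //; apply: aeS fg => x + _.
have ig : mu.-integrable setT (EFin \o g).
  apply/integrableP; split; first exact/measurable_EFinP.
  move/integrableP : i1 => [_]; congr (_ < +oo)%E; apply: ae_eq_integral => //.
  - by apply: measurableT_comp => //; exact/measurable_EFinP.
  - by apply: measurableT_comp => //; exact/measurable_EFinP.
  - by apply: aeS fg => x /= -> _.
split => //.
  rewrite -eg; apply: le_trans b1; apply: le_Rintegral => //; first exact: integrable_norm.
  by move=> x _; exact: ler_norm.
by exists (wderiv setT f).
Qed.

Lemma Jd_test d x : 0 < d -> test_function setT (Jd J d x).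
Proof.
move=> d0; split; first exact: (Jd_smooth hJ).
exists (`[- (`|x| + d), `|x| + d]%classic); split => //; first exact: segment_compact.
move=> z /=; rewrite in_itv/= -ler_norml => /negP; rewrite -ltNge.
exact: (Jd_out hJ).
Qed.

Lemma Jd_derive_bound n d : exists C, forall x z, `|(Jd J d x)^`(n)%classic z| <= C.
Proof.
have [tJ _ _ _] := hJ; have [C C0 HC] := test_function_bounded n tJ.
exists (`|d^-1 * d^-1 ^+ n| * C) => x z.
rewrite /Jd derive1n_affine; last by case: tJ.
by rewrite normrM ler_wpM2l.
Qed.

(* Functions bounded in H^1 are equicontinuous, so local averages at a small
   scale control the sup norm. *)
Lemma h1_sup_small B e : 0 < e -> exists2 d : R, 0 < d &
  forall f g, h1_slice B f -> h1_slice B g ->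
  forall t, (forall x, `|\int[mu]_z (Jd J d x z * (f z - g z))| <= t) ->
  forall x, `|f x - g x| <= t + e.
Proof.
move=> e0; have B20 := sqr_ge0 B.
have B21 : 0 < B ^+ 2 + 1 by lra.
(* With this l, B^2 / l <= e / 4, and at distance at most d = e / (4 l) the other term of the
   modulus is at most e / 4 too. Each of f and g then oscillates by at most e / 2. *)
pose l := 4 * (B ^+ 2 + 1) / e; have l0 : 0 < l by rewrite /l divr_gt0// mulr_gt0.
have d0 : 0 < e / (4 * l) by rewrite divr_gt0// mulr_gt0.
exists (e / (4 * l)) => // f g hf hg t ht x.
have lw : lint (fun z => f z - g z).
  by apply: lintB; apply: integrable_lint; [exact: h1_int hf|exact: h1_int hg].
apply: (mollify_sup hJ d0 lw _ (ht x)) => z zx.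
have -> : f z - g z - (f x - g x) = (f z - f x) - (g z - g x) by ring.
apply: le_trans (ler_normB _ _) _.
have h1 := h1_slice_modulus x z hf l0; have h2 := h1_slice_modulus x z hg l0.
have h3 : l * `|z - x| <= e / 4.
  rewrite mulrC -ler_pdivlMr//; apply: le_trans zx _.
  by rewrite invfM mulrA.
have h4 : B ^+ 2 / l <= e / 4.
  rewrite ler_pdivrMr// /l.
  have -> : e / 4 * (4 * (B ^+ 2 + 1) / e) = B ^+ 2 + 1 by field; rewrite gt_eqF.
  lra.
lra.
Qed.

End WithMollifier.

Lemma h1_pow_integrable B f (m : R) : 0 <= m -> h1_slice B f ->
  mu.-integrable setT (EFin \o (fun x => f x `^ (m + 1))).
Proof.
move=> m0 hf; have f0 := h1_ge0 hf.
have iS : mu.-integrable setT (EFin \o (fun x => sup_bound B `^ m * f x)).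
  exact: (integrableZl measurableT _ (h1_int hf)).
have S0 : 0 <= sup_bound B by apply: le_trans (h1_slice_sup 0 hf); exact: f0.
apply: le_integrable iS => //.
  apply/measurable_EFinP; apply: (@measurableT_comp _ _ _ _ _ _ (@powR R ^~ (m + 1))) => //.
  by apply: continuous_measurable_fun; exact: h1_slice_continuous hf.
move=> x _; rewrite !abse_EFin lee_fin !ger0_norm ?powR_ge0//; last first.
  by rewrite mulr_ge0 ?powR_ge0.
rewrite powRD; last by rewrite gt_eqF ?ltr_wpDl.
rewrite powRr1// ler_wpM2r//; apply: ge0_ler_powR => //; rewrite ?nnegrE//.
exact: h1_slice_sup hf.
Qed.

(* Of the m + 1 powers, one is kept linear so that the mass bounds its integral;
   hence only the sup norm of f - g enters. *)
Lemma power_mass_diff B f g (m e : R) : 1 <= m -> h1_slice B f -> h1_slice B g ->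
  (forall x, `|f x - g x| <= e) ->
  `|\int[mu]_x (f x `^ (m + 1)) - \int[mu]_x (g x `^ (m + 1))| <=
  (m + 1) * sup_bound B `^ (m - 1) * (2 * B) * e.
Proof.
move=> m1 hf hg fge; have m0 : 0 <= m by exact: le_trans ler01 m1.
have f0 := h1_ge0 hf; have g0 := h1_ge0 hg.
have S0 : 0 <= sup_bound B by apply: le_trans (h1_slice_sup 0 hf); exact: f0.
have pf := h1_pow_integrable m0 hf; have pg := h1_pow_integrable m0 hg.
rewrite -RintegralB//; have ip := integrableB measurableT pf pg.
apply: le_trans (le_normr_Rintegral _ ip) _ => //.
pose k := (m + 1) * sup_bound B `^ (m - 1) * e.
have e0 : 0 <= e by apply: le_trans (fge 0).
have k0 : 0 <= k by rewrite /k !mulr_ge0 ?powR_ge0// addr_ge0.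
have ifg := integrableD measurableT (h1_int hf) (h1_int hg).
apply: (@le_trans _ _ (\int[mu]_x (k * (f x + g x)))).
  apply: le_Rintegral => //; first exact: integrable_norm.
    exact: (integrableZl measurableT k ifg).
  move=> x _; set s := f x; set t := g x.
  have [s0 t0] : 0 <= s /\ 0 <= t by split; [exact: f0|exact: g0].
  pose M := Num.max s t.
  have sM : s <= M by rewrite le_max lexx.
  have tM : t <= M by rewrite le_max lexx orbT.
  have M0 : 0 <= M by exact: le_trans sM.
  have MS : M <= sup_bound B.
    by rewrite ge_max; apply/andP; split; [exact: h1_slice_sup hf|exact: h1_slice_sup hg].
  have Mst : M <= s + t by rewrite ge_max lerDl t0 lerDr s0.
  apply: le_trans (powR_lipschitz m0 s0 sM t0 tM) _.
  have E : M `^ m <= sup_bound B `^ (m - 1) * (s + t).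
    apply: (@le_trans _ _ (M `^ (m - 1) * M)); last first.
      apply: ler_pM => //; first exact: powR_ge0.
      by apply: ge0_ler_powR => //; rewrite ?nnegrE// subr_ge0.
    rewrite -{3}(powRr1 M0) -powRD ?subrK//.
    by apply/implyP => /eqP h; lra.
  apply: (@le_trans _ _ ((m + 1) * (sup_bound B `^ (m - 1) * (s + t)) * e)); last first.
    by rewrite /k le_eqVlt; apply/predU1P; left; ring.
  apply: ler_pM => //; first by rewrite mulr_ge0 ?powR_ge0// addr_ge0.
    by rewrite ler_wpM2l// addr_ge0.
  exact: fge.
rewrite RintegralZl// RintegralD//; [|exact: h1_int hf|exact: h1_int hg].
have hfB := h1_mass hf; have hgB := h1_mass hg.
rewrite (_ : _ * (2 * B) * e = k * (2 * B)); last by rewrite /k; ring.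
by rewrite ler_wpM2l//; lra.
Qed.

Lemma same_side (y d a b : R) : 0 < d -> d <= `|a - y| -> `|b - a| <= d / 2 ->
  (y < a -> y < b) /\ (a < y -> b < y).
Proof.
move=> d0 ha /ler_normlP[h1 h2]; split => h; move: ha.
  by rewrite gtr0_norm ?subr_gt0//; lra.
by rewrite ltr0_norm ?subr_lt0//; lra.
Qed.

Lemma side_trans (y a b c : R) : (y < a -> y < b) /\ (a < y -> b < y) ->
  (y < b -> y < c) /\ (b < y -> c < y) -> (y < a -> y < c) /\ (a < y -> c < y).
Proof. by move=> [a1 a2] [b1 b2]; split => h; [exact: b1 (a1 h)|exact: b2 (a2 h)]. Qed.

Section Evolution.
Variables (J : R -> R) (m : R) (u0 : R -> R) (T : R) (u : R -> R -> R).
Hypotheses (hJ : standard_mollifier J) (m1 : 1 <= m).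
Hypothesis ws : weak_entropy_solution m u0 T u.
Hypotheses (u0_ge0 : forall x, 0 <= u0 x) (u0_L1H1 : L1H1 u0).
Variables (B : R) (N : set R).
Hypotheses (B0 : 0 <= B) (mN : measurable N) (N0 : mu N = 0%E).
Hypothesis good : forall t, good_times T N t -> good_slice B (u t).

Let G := good_times T N.

Lemma good_times_dense (c d : R) : 0 <= c -> c < d -> d <= T -> exists z, [/\ G z, c < z & z < d].
Proof.
move=> c0 cd dT.
have aeN : {ae mu, forall x, ~ N x} by exists N; split => // x /= /contrapT.
have [x nNx /andP[cx xd]] := ae_dense aeN cd.
by exists x; split => //; split => //=; rewrite in_itv/=; apply/andP; split; lra.
Qed.

Definition power_mass f : R := \int[mu]_x (f x `^ (m + 1)).

(** The scale d of the mollifier is fixed by [h1_sup_small] before the time step: at this scale the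
    local averages, whatever their centre, move slowly in time, which gives closeness in sup norm
    and then of the power masses. The initial datum is compared separately, as time 0 is not a good
    time. *)
Lemma power_mass_continuous e : 0 < e -> exists2 d : R, 0 < d &
  (forall s t, G s -> G t -> s < t -> t - s < d -> `|power_mass (u t) - power_mass (u s)| <= e) /\
  (forall t, G t -> t < d -> `|power_mass (u t) - power_mass u0| <= e).
Proof.
move=> e0.
have [B1 [v0 [B10 hv0 uv0]]] := L1H1_representative hJ u0_L1H1 u0_ge0.
pose C := Num.max B B1.
have BC : B <= C by rewrite le_max lexx.
have B1C : B1 <= C by rewrite le_max lexx orbT.
have C0 : 0 <= C by exact: le_trans BC.
have hG t : G t -> h1_slice C (u t).
  by move=> Gt; apply: h1_slice_le BC _ => //; exact: (good_h1_slice hJ (good Gt)).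
have {}hv0 : h1_slice C v0 by exact: h1_slice_le B1C hv0.
(* A sup distance e / L changes the power mass by at most e. Half of it is spent on the local
   averages, half on the oscillation at scale d. *)
pose L := (m + 1) * sup_bound C `^ (m - 1) * (2 * C) + 1.
have L0 : 0 < L.
  by rewrite /L ltr_wpDl// !mulr_ge0 ?powR_ge0// addr_ge0// (le_trans ler01 m1).
have eL0 : 0 < e / L / 2 by rewrite !divr_gt0.
have [d d0 hd] := h1_sup_small hJ C eL0.
have [k2 hk2] := Jd_derive_bound hJ 2 d; have [k4 hk4] := Jd_derive_bound hJ 4 d.
pose K := `|slice_bound m B (3 / 2 * k2) (2^-1 * k4) (m / (m + 1) * k2)| + 1.
have K0 : 0 < K by rewrite /K ltr_wpDl.
have key f g : h1_slice C f -> h1_slice C g ->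
    (forall x, `|\int[mu]_z (Jd J d x z * (f z - g z))| <= e / L / 2) ->
    `|power_mass f - power_mass g| <= e.
  move=> hf hg H; have close x := hd f g hf hg _ H x.
  apply: le_trans (power_mass_diff m1 hf hg close) _.
  rewrite (_ : e / L / 2 + e / L / 2 = e / L); last by field; rewrite gt_eqF.
  rewrite mulrCA ler_piMr ?(ltW e0)// ler_pdivrMr// mul1r /L; lra.
exists (e / L / 2 / K); first by rewrite divr_gt0.
have lip x y z : x <= y -> y - x < e / L / 2 / K ->
    `|\int[mu]_(s in `[x, y]) test_slice m T u N (Jd J d z) s| <= e / L / 2.
  move=> xy yx.
  apply: le_trans (weak_evolution_lipschitz hJ m1 ws mN good (Jd_test hJ z d0) (hk2 z) (hk4 z) xy) _.
  apply: (@le_trans _ _ (K * (y - x))); first by rewrite ler_wpM2r ?subr_ge0// /K lerDl.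
  by rewrite mulrC -ler_pdivlMr// ltW.
have splitI f g z : h1_slice C f -> h1_slice C g ->
    \int[mu]_x (Jd J d z x * (f x - g x)) =
    \int[mu]_x (Jd J d z x * f x) - \int[mu]_x (Jd J d z x * g x).
  move=> hf hg; rewrite -RintegralB//; last 2 first.
  - by apply: (Jd_integrable hJ) => //; apply: integrable_lint; exact: h1_int hf.
  - by apply: (Jd_integrable hJ) => //; apply: integrable_lint; exact: h1_int hg.
  by apply: eq_Rintegral => x _; rewrite mulrBr.
have inT t : G t -> 0 < t < T by move=> [/= + _]; rewrite in_itv.
split=> [s t Gs Gt st ts|t Gt td].
  apply: key; [exact: hG|exact: hG|move=> z].
  have e1 := weak_evolution hJ m1 ws mN N0 good (inT s Gs) (Jd_test hJ z d0).
  have e2 := weak_evolution hJ m1 ws mN N0 good (inT t Gt) (Jd_test hJ z d0).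
  have lW := test_slice_lint hJ m1 ws mN good (Jd_test hJ z d0).
  have s0 : 0 <= s by have /andP[/ltW] := inT s Gs.
  rewrite (splitI _ _ z (hG t Gt) (hG s Gs)).
  move: e2; rewrite (Rint_split lW s0 (ltW st)) -e1 => /eqP.
  rewrite subr_eq => /eqP ->.
  rewrite (_ : _ - _ = \int[mu]_(x in `[s, t]) test_slice m T u N (Jd J d z) x); last by ring.
  exact: lip (ltW st) ts.
have -> : power_mass u0 = power_mass v0.
  apply: Rintegral_ae_eq => //.
  - apply: (@measurableT_comp _ _ _ _ _ _ (@powR R ^~ (m + 1))) => //.
    by case: u0_L1H1 => /Lfun_mfun.
  - apply: (@measurableT_comp _ _ _ _ _ _ (@powR R ^~ (m + 1))) => //.
    by apply: continuous_measurable_fun; exact: h1_slice_continuous hv0.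
  - by apply: aeS uv0 => x -> _.
apply: key; [exact: hG|exact: hv0|move=> z].
have e2 := weak_evolution hJ m1 ws mN N0 good (inT t Gt) (Jd_test hJ z d0).
rewrite (splitI _ _ z (hG t Gt) hv0).
have e3 : \int[mu]_x (Jd J d z x * u0 x) = \int[mu]_x (Jd J d z x * v0 x).
  have mJ : measurable_fun setT (Jd J d z).
    by apply: continuous_measurable_fun; apply: smooth_continuous; exact: (Jd_smooth hJ).
  apply: Rintegral_ae_eq => //.
  - by apply: measurable_funM => //; case: u0_L1H1 => /Lfun_mfun.
  - by apply: measurable_funM => //; apply: continuous_measurable_fun; exact: h1_slice_continuous hv0.
  - by apply: aeS uv0 => x -> _.
have t0 : 0 < t by have /andP[] := inT t Gt.
by rewrite -e3 e2; apply: lip; [exact: ltW|rewrite subr0].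
Qed.

(** Good times less than tau apart have power masses within d / 2 of each other, which is too little
    to jump across y while staying at distance d from it. Density of the good times allows chaining,
    starting near time 0. *)
Lemma power_mass_gap (y d : R) : 0 < d ->
  (forall t, G t -> d <= `|power_mass (u t) - y|) -> d <= `|power_mass u0 - y| ->
  (y < power_mass u0 -> forall t, G t -> y + d <= power_mass (u t)) /\
  (power_mass u0 < y -> forall t, G t -> power_mass (u t) <= y - d).
Proof.
move=> d0 gapG gap0.
have [tau tau0 [c1 c2]] := power_mass_continuous (divr_gt0 d0 (ltr0n R 2)).
pose same (a b : R) := (y < a -> y < b) /\ (a < y -> b < y).
have inT t : G t -> 0 < t < T by move=> [/= + _]; rewrite in_itv.
have chain s t : G s -> G t -> s < t -> same (power_mass (u s)) (power_mass (u t)).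
  move: s t; apply: (@chaining R G (fun s t => same (power_mass (u s)) (power_mass (u t))) tau tau0).
  - move=> x z c' e Gx Gz xc ce ez.
    have /andP[x0 _] := inT x Gx; have /andP[_ zT] := inT z Gz.
    by apply: good_times_dense; [exact: le_trans (ltW x0) xc|exact: ce|exact: le_trans ez (ltW zT)].
  - move=> x z Gx Gz xz zx; apply: (same_side d0); [exact: gapG|exact: c1].
  - by move=> x z w _ _ _ _ _; exact: side_trans.
have start t : G t -> same (power_mass u0) (power_mass (u t)).
  move=> Gt; have /andP[t0 tT] := inT t Gt.
  have mt0 : 0 < Num.min tau t by rewrite lt_min tau0.
  have mtT : Num.min tau t <= T by rewrite ge_min (ltW tT) orbT.
  have [s [Gs s0 st]] := good_times_dense (lexx 0) mt0 mtT.
  move: st; rewrite lt_min => /andP[stau st].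
  have same0 : same (power_mass u0) (power_mass (u s)).
    by apply: (same_side d0); [exact: gap0|exact: c2].
  exact: side_trans same0 (chain s t Gs Gt st).
split=> h t Gt; have [a1 a2] := start t Gt; have := gapG t Gt.
  have := a1 h; move: (power_mass (u t)) => w yw.
  by rewrite gtr0_norm ?subr_gt0// lerBrDl.
have := a2 h; move: (power_mass (u t)) => w yw.
by rewrite ltr0_norm ?subr_lt0// opprB lerBrDr -lerBrDl.
Qed.

End Evolution.

End TimeContinuity.

(** * The second moment *)

Section Moments.
Local Open Scope classical_set_scope.
Local Open Scope ring_scope.
Context {R : realType}.
Local Notation mu := (@lebesgue_measure R).
Implicit Types (f g psi a b c : R -> R) (B S s t x y z d e k l : R).

Lemma second_moment_integrable (f : R -> R) : (forall x, 0 <= f x) -> measurable_fun setT f ->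
  (second_moment f < +oo)%E -> mu.-integrable setT (EFin \o (fun x => x ^+ 2 * f x)).
Proof.
move=> f0 mf fin; apply/integrableP; split.
  by apply/measurable_EFinP; apply: measurable_funM => //; apply: measurable_funX.
move: fin; congr (_ < +oo)%E; apply: eq_integral => x _.
by rewrite abse_EFin ger0_norm// mulr_ge0 ?sqr_ge0.
Qed.

(** Fatou's lemma makes the limit integrable, and the limit then dominates the sequence. This yields
    the finiteness of the second moment at positive times, which is not assumed. *)
Lemma dominated_limit_integrable (f_ : nat -> R -> R) f l :
  (forall n, mu.-integrable setT (EFin \o f_ n)) ->
  (forall n x, 0 <= f_ n x <= f x) -> (forall x, f_ n x @[n --> \oo] --> f x) ->
  \int[mu]_x f_ n x @[n --> \oo] --> l ->
  mu.-integrable setT (EFin \o f) /\ \int[mu]_x f x = l.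
Proof.
move=> fi fb fc fl.
have mf_ n : measurable_fun setT (f_ n) by apply/measurable_EFinP; exact: measurable_int (fi n).
have mf : measurable_fun setT f by apply: (measurable_fun_cvg mf_) => x _; exact: fc.
have f0 x : 0 <= f x by have /andP[h1 h2] := fb 0%N x; exact: le_trans h2.
have le : (\int[mu]_x (f x)%:E <= l%:E)%E.
  have -> : (\int[mu]_x (f x)%:E = \int[mu]_x limn_einf (fun n => (f_ n x)%:E))%E.
    apply: eq_integral => x _; apply/esym; apply: (cvg_limn_einf_sup _).1.
    by apply: cvg_EFin; [exact: nearW|exact: fc].
  apply: le_trans (fatou _ measurableT _ _) _.
  - by move=> n; apply/measurable_EFinP; exact: mf_.
  - by move=> n x _; rewrite lee_fin; have /andP[] := fb n x.
  rewrite le_eqVlt; apply/predU1P; left; apply: (cvg_limn_einf_sup _).1.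
  have -> : (fun n => \int[mu]_x (f_ n x)%:E)%E = EFin \o (fun n => \int[mu]_x f_ n x).
    by apply/funext => n /=; rewrite /Rintegral fineK//; exact: (integrable_fin_num _ (fi n)).
  by apply: cvg_EFin; [exact: nearW|exact: fl].
have ifn : mu.-integrable setT (EFin \o f).
  apply/integrableP; split; first exact/measurable_EFinP.
  apply: (@le_lt_trans _ _ l%:E); last by rewrite ltry.
  by under eq_integral do rewrite /= ger0_norm//.
split => //.
have [||_ c] := @Rdominated _ _ _ mu setT f_ f f measurableT mf_ mf _ ifn.
- by apply: nearW => x _; exact: fc.
- by move=> n x _; have /andP[h1 h2] := fb n x; rewrite ger0_norm.
by apply: (cvg_unique _ c fl); exact: Rhausdorff.
Qed.

Section WithMollifier.
Variables (J : R -> R).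
Hypothesis hJ : standard_mollifier J.

Let chi x : R := (1 * step J (1 * x + 2)) * (1 * step J (-1 * x + 2)).

Let chi_smooth : smooth chi.
Proof. by apply: smoothM; apply: smooth_affine; exact: (step_smooth hJ). Qed.

Let chi01 x : 0 <= chi x <= 1.
Proof.
rewrite /chi !mul1r; have := step_ge0 hJ (x + 2); have := step_le1 hJ (x + 2).
have := step_ge0 hJ (-1 * x + 2); have := step_le1 hJ (-1 * x + 2).
by move=> *; rewrite mulr_ge0// mulr_ile1.
Qed.

Let chi1 x : `|x| <= 1 -> chi x = 1.
Proof.
by move=> /ler_normlP[h1 h2]; rewrite /chi !(step1 hJ) ?mulr1//; lra.
Qed.

Let chi0 x : 3 <= `|x| -> chi x = 0.
Proof.
rewrite /chi; have [x0|x0] := Order.TotalTheory.leP 0 x => x3.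
  by rewrite ger0_norm// in x3; rewrite (step0 hJ (x := -1 * x + 2)) ?mulr0//; lra.
by rewrite ltr0_norm// in x3; rewrite (step0 hJ (x := 1 * x + 2)) ?mulr0 ?mul0r//; lra.
Qed.

Let phi x := x * x * chi x.

Let phi_smooth : smooth phi.
Proof. by apply: smoothM chi_smooth; apply: smoothM; exact: smooth_id. Qed.

Let phi_test : test_function setT phi.
Proof.
split; first exact: phi_smooth.
exists `[-3, 3]%classic; split => //; first exact: segment_compact.
move=> x /=; rewrite in_itv/= => /negP; rewrite -ler_norml -ltNge => x3.
by rewrite /phi chi0 ?mulr0// ltW.
Qed.

Let phi2 : phi^`(2)%classic 0 = 2.
Proof.
have near1 : \forall y \near (0:R), `|y| < 1.
  by near=> y; near: y; apply: (cvgr0_norm_lt (fun x : R => x)) => //; exact: cvg_id.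
have e1 y : `|y| < 1 -> phi^`()%classic y = y + y.
  move=> y1; rewrite derive1E (@near_eq_derive _ _ _ phi (fun x : R => x * x)) ?oner_neq0//; last first.
    have : \forall z \near y, `|z| < 1.
      have := @norm_continuous _ R^o y => /cvgr_lt; exact.
    by apply: filterS => z z1; rewrite /phi chi1 ?mulr1// ltW.
  by rewrite deriveM// !derive_id /GRing.scale/= !mulr1.
rewrite derive1nS derive1n1 derive1E (@near_eq_derive _ _ _ _ (fun x : R => x + x)) ?oner_neq0//; last first.
  by apply: filterS near1 => z z1; exact: e1.
by rewrite deriveD// derive_id.
Unshelve. all: by end_near. Qed.

(** With phi = x^2 near 0 and compact support, N^2 phi(x / N) has second derivative phi''(x / N),
    bounded and tending to phi''(0) = 2, and fourth derivative of order N^-2. *)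
Lemma moment_cutoff : exists (psi : nat -> R -> R) (k : R),
  [/\ forall n, test_function setT (psi n), forall n x, 0 <= psi n x <= x ^+ 2
    & forall x, psi n x @[n --> \oo] --> x ^+ 2] /\
  [/\ forall n x, `|(psi n)^`(2)%classic x| <= k, forall n x, `|(psi n)^`(4)%classic x| <= k,
      forall x, (psi n)^`(2)%classic x @[n --> \oo] --> (2:R)
    & forall x, (psi n)^`(4)%classic x @[n --> \oo] --> (0:R)].
Proof.
have [C2 C20 H2] := test_function_bounded 2 phi_test.
have [C4 C40 H4] := test_function_bounded 4 phi_test.
pose N (n : nat) : R := n.+1%:R.
have N0 n : N n != 0 by rewrite pnatr_eq0.
have scale4 (w y : R) : w != 0 -> w ^+ 2 * w^-1 ^+ 4 * y = w^-1 ^+ 2 * y.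
  by move=> w0; field.
have scale2 (w y : R) : w != 0 -> w ^+ 2 * w^-1 ^+ 2 * y = y.
  by move=> w0; field.
have scaleq (w y z : R) : w != 0 -> w ^+ 2 * (w^-1 * y * (w^-1 * y) * z) = y ^+ 2 * z.
  by move=> w0; field.
pose psi n x := N n ^+ 2 * phi ((N n)^-1 * x + 0).
have d2 n x : (psi n)^`(2)%classic x = phi^`(2)%classic ((N n)^-1 * x).
  rewrite /psi derive1n_affine; last exact: phi_smooth.
  by rewrite addr0 (scale2 _ _ (N0 n)).
have d4 n x : (psi n)^`(4)%classic x = (N n)^-1 ^+ 2 * phi^`(4)%classic ((N n)^-1 * x).
  rewrite /psi derive1n_affine; last exact: phi_smooth.
  by rewrite addr0 (scale4 _ _ (N0 n)).
have cN : (N n)^-1 @[n --> \oo] --> (0:R) by exact: cvg_harmonic.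
have cNx x : (N n)^-1 * x @[n --> \oo] --> (0:R).
  by rewrite -(mul0r x); apply: cvgM => //; exact: cvg_cst.
have inv1 n : (N n)^-1 ^+ 2 <= 1.
  by rewrite expr_le1 ?invr_ge0// invf_le1// ler1n.
exists psi, (Num.max C2 C4); split; split.
- move=> n; split; first exact: smooth_affine.
  exists `[- (3 * N n), 3 * N n]%classic; split => //; first exact: segment_compact.
  move=> x /=; rewrite in_itv/= => /negP; rewrite -ler_norml -ltNge => xN.
  rewrite /psi addr0 /phi chi0 ?mulr0//.
  by rewrite normrM normfV (ger0_norm (x := N n))// mulrC ler_pdivlMr// ltW.
- move=> n x; have E : psi n x = x ^+ 2 * chi ((N n)^-1 * x).
    by rewrite /psi /phi addr0 (scaleq _ _ _ (N0 n)).
  have /andP[c0 c1] := chi01 ((N n)^-1 * x).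
  by rewrite E mulr_ge0 ?sqr_ge0//= ler_piMr// sqr_ge0.
- move=> x; apply: cvg_near_cst; near=> n.
  rewrite /psi /phi addr0 (scaleq _ _ _ (N0 n)) chi1 ?mulr1//.
  by near: n; move/cvgr0_norm_le: (cNx x); apply.
- by move=> n x; rewrite d2 le_max H2.
- move=> n x; rewrite d4 le_max normrM ger0_norm ?exprn_ge0 ?invr_ge0//.
  by apply/orP; right; apply: le_trans (H4 ((N n)^-1 * x)); rewrite ler_piMl.
- move=> x; under eq_fun do rewrite d2.
  rewrite -phi2; apply: continuous_cvg; last exact: cNx.
  by apply: smooth_continuous; exact: smooth_derive1n.
- move=> x; under eq_fun do rewrite d4.
  rewrite (_ : 0 = 0 ^+ 2 * phi^`(4)%classic 0); last by rewrite expr0n mul0r.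
  apply: cvgM; first by rewrite expr2; apply: (cvgM (f := fun n => (N n)^-1)).
  apply: continuous_cvg; last exact: cNx.
  by apply: smooth_continuous; exact: smooth_derive1n.
Unshelve. all: by end_near. Qed.

Lemma slice_integral_cvg m B f (a_ b_ c_ : nat -> R -> R) a b c ka kb kc : 0 <= m ->
  good_slice B f ->
  (forall n, bounded_continuous (a_ n) ka) -> (forall n, bounded_continuous (b_ n) kb) ->
  (forall n, bounded_continuous (c_ n) kc) ->
  (forall x, a_ n x @[n --> \oo] --> a x) -> (forall x, b_ n x @[n --> \oo] --> b x) ->
  (forall x, c_ n x @[n --> \oo] --> c x) ->
  slice_integral m (a_ n) (b_ n) (c_ n) f @[n --> \oo] --> slice_integral m a b c f.
Proof.
move=> m0 gs ha hb hc ca cb cc.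
have h k := @bounded_continuous_cst R k.
have [[j1 j2 j3] _] := slice_integrable hJ m0 gs (h ka) (h kb) (h kc).
have j12 := integrableD measurableT j1 j2.
have j := integrableD measurableT j12 j3.
have mn n : measurable_fun setT (fun x => a_ n x * f^`()%classic x ^+ 2 + b_ n x * f x ^+ 2 +
    c_ n x * f x `^ (m + 1)).
  have [[i1 i2 i3] _] := slice_integrable hJ m0 gs (ha n) (hb n) (hc n).
  have i12 := integrableD measurableT i1 i2.
  by apply/measurable_EFinP; exact: (measurable_int _ (integrableD measurableT i12 i3)).
have cv x : a_ n x * f^`()%classic x ^+ 2 + b_ n x * f x ^+ 2 + c_ n x * f x `^ (m + 1)
    @[n --> \oo] --> a x * f^`()%classic x ^+ 2 + b x * f x ^+ 2 + c x * f x `^ (m + 1).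
  by apply: cvgD; [apply: cvgD|]; apply: cvgM; rewrite ?ca ?cb ?cc//; apply: cvg_cst.
have [|||_ //] := @Rdominated _ _ _ mu setT
  (fun n x => a_ n x * f^`()%classic x ^+ 2 + b_ n x * f x ^+ 2 + c_ n x * f x `^ (m + 1))
  (fun x => a x * f^`()%classic x ^+ 2 + b x * f x ^+ 2 + c x * f x `^ (m + 1)) _ measurableT mn _ _ j.
- by apply: (measurable_fun_cvg mn) => x _; exact: cv.
- by apply: nearW => x _; exact: cv.
move=> n x _; apply: le_trans (ler_normD _ _) _; apply: lerD; last first.
  by rewrite normrM (ger0_norm (powR_ge0 _ _)) ler_wpM2r ?powR_ge0//; exact: (hc n).2.
apply: le_trans (ler_normD _ _) _; apply: lerD.
  by rewrite normrM (ger0_norm (sqr_ge0 (f^`()%classic x))) ler_wpM2r ?sqr_ge0//; exact: (ha n).2.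
by rewrite normrM (ger0_norm (sqr_ge0 (f x))) ler_wpM2r ?sqr_ge0//; exact: (hb n).2.
Qed.

End WithMollifier.

Section Evolution.
Variables (J : R -> R) (m : R) (u0 : R -> R) (T : R) (u : R -> R -> R).
Hypotheses (hJ : standard_mollifier J) (m1 : 1 <= m).
Hypothesis ws : weak_entropy_solution m u0 T u.
Hypotheses (u0_ge0 : forall x, 0 <= u0 x) (u0_L1H1 : L1H1 u0).
Hypothesis u0_moment : (second_moment u0 < +oo)%E.
Variables (B : R) (N : set R).
Hypotheses (B0 : 0 <= B) (mN : measurable N) (N0 : mu N = 0%E).
Hypothesis good : forall t, good_times T N t -> good_slice B (u t).

Let m0 : 0 <= m. Proof. exact: le_trans ler01 m1. Qed.

(** The coefficients are the limits of those of [test_slice] when psi'' tends to 2 and the fourth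
    derivative of psi to 0. *)
Definition virial_slice := time_slice m T u N (cst 3) (cst 0) (cst (- (2 * m / (m + 1)))).

Lemma virial_slice_lint : lint virial_slice.
Proof.
have h k := @bounded_continuous_cst R k.
exact: (time_slice_lint hJ m1 ws mN good (h 3) (h 0) (h _)).
Qed.

(** The tested equation is passed to the limit along [moment_cutoff]: dominated by x^2 u0 at the
    initial time and by a constant in the time integral. The left-hand side goes through
    [dominated_limit_integrable]. *)
Lemma second_moment_evolution t : 0 < t < T ->
  mu.-integrable setT (EFin \o (fun x => x ^+ 2 * u t x)) /\
  \int[mu]_x (x ^+ 2 * u t x) =
  \int[mu]_x (x ^+ 2 * u0 x) + \int[mu]_(s in `[0, t]) virial_slice s.
Proof.
move=> t0T; have /andP[t0 tT] := t0T.
have [psi [k [[tp p01 pc] [b2 b4 c2 c4]]]] := moment_cutoff hJ.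
have mu0 : measurable_fun setT u0 by case: u0_L1H1 => /Lfun_mfun.
have mx2 : measurable_fun setT (fun x : R => x ^+ 2) by apply: measurable_funX.
have i0 := second_moment_integrable u0_ge0 mu0 u0_moment.
have mp n : measurable_fun setT (psi n).
  by apply: continuous_measurable_fun; apply: smooth_continuous; case: (tp n).
have [|||_ C0] := @Rdominated _ _ _ mu setT (fun n x => psi n x * u0 x) _ _ measurableT _
    (measurable_funM mx2 mu0) _ i0.
- by move=> n; apply: measurable_funM; [exact: mp|exact: mu0].
- by apply: nearW => x _; apply: cvgM; [exact: pc|exact: cvg_cst].
- move=> n x _; have /andP[h1 h2] := p01 n x.
  by rewrite ger0_norm ?mulr_ge0// ler_wpM2r.
have cc n j l : continuous (fun x => l * (psi n)^`(j)%classic x).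
  by move=> z; apply: cvgMr; apply: smooth_continuous; apply: smooth_derive1n; case: (tp n).
pose a_ n x := 3 / 2 * (psi n)^`(2)%classic x.
pose b_ n x := - 2^-1 * (psi n)^`(4)%classic x.
pose c_ n x := - (m / (m + 1)) * (psi n)^`(2)%classic x.
have ha n : bounded_continuous (a_ n) (`|3 / 2| * k).
  by split; [exact: cc|move=> x; rewrite normrM ler_wpM2l].
have hb n : bounded_continuous (b_ n) (`|- 2^-1| * k).
  by split; [exact: cc|move=> x; rewrite normrM ler_wpM2l].
have hc n : bounded_continuous (c_ n) (`|- (m / (m + 1))| * k).
  by split; [exact: cc|move=> x; rewrite normrM ler_wpM2l].
have h l := @bounded_continuous_cst R l.
have [||||||_ C1] := @Rdominated _ _ _ mu `[0, t]%classic (fun n => test_slice m T u N (psi n))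
   virial_slice (cst `|slice_bound m B (`|3 / 2| * k) (`|- 2^-1| * k) (`|- (m / (m + 1))| * k)|) _ _ _ _ _.
- by [].
- move=> n; apply: measurable_funTS.
  by apply: (time_slice_measurable hJ m1 ws mN good); exact: cc.
- apply: measurable_funTS; apply: (time_slice_measurable hJ m1 ws mN good); exact: cst_continuous.
- apply: nearW => s _.
  rewrite /test_slice /virial_slice /time_slice; under eq_fun do rewrite patchE.
  rewrite patchE; case: ifPn => [sG|_]; last exact: cvg_cst.
  apply: (slice_integral_cvg hJ m0 (good (set_mem sG)) ha hb hc) => x.
  + rewrite /a_ (_ : cst 3 x = 3 / 2 * 2); last by rewrite /=; field.
    by apply: cvgM; [exact: cvg_cst|exact: c2].
  + rewrite /b_ (_ : cst 0 x = - 2^-1 * 0); last by rewrite /= mulr0.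
    by apply: cvgM; [exact: cvg_cst|exact: c4].
  + rewrite /c_ (_ : cst _ x = - (m / (m + 1)) * 2); last by rewrite /=; ring.
    by apply: cvgM; [exact: cvg_cst|exact: c2].
- by apply: (continuous_lint (f := fun=> _)); exact: cst_continuous.
- by move=> n s _; exact: (time_slice_le hJ m1 good s (ha n) (hb n) (hc n)).
have [ut0 cu Lu] := wes_slice ws t0T.
have [iu _ _ _] := L1H1_integrable Lu.
apply: (@dominated_limit_integrable (fun n x => psi n x * u t x)).
- move=> n; have [C _ HC] := test_function_bounded 0 (tp n).
  apply: (bounded_mul_integrable (k := C)) iu; split; last exact: HC.
  by apply: smooth_continuous; case: (tp n).
- move=> n x; have /andP[h1 h2] := p01 n x.
  by rewrite mulr_ge0//= ler_wpM2r.
- by move=> x; apply: cvgM; [exact: pc|exact: cvg_cst].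
have E n : \int[mu]_x (psi n x * u t x) =
    \int[mu]_x (psi n x * u0 x) + \int[mu]_(s in `[0, t]) test_slice m T u N (psi n) s.
  by rewrite -(weak_evolution hJ m1 ws mN N0 good t0T (tp n)) addrC subrK.
under eq_fun do rewrite E.
exact: cvgD.
Qed.

End Evolution.

End Moments.

(** * Consequences of the Sz.-Nagy inequality *)

Section SzNagyInequality.
Local Open Scope classical_set_scope.
Local Open Scope ring_scope.
Context {R : realType}.
Local Notation mu := (@lebesgue_measure R).
Implicit Types (f g : R -> R) (C d e k l m x y Y M : R).

Lemma Lfun1_norm f : (forall x, 0 <= f x) -> f \in Lfun mu 1%:E ->
  Lpnorm 1%:E f = (\int[mu]_x f x)%:E.
Proof.
move=> f0 f1; have fin : Lpnorm 1%:E f \is a fin_num.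
  by rewrite ge0_fin_numE ?Lnorm_ge0//; exact: Lfun_fin.
rewrite -(fineK fin) Lpnorm1_Rintegral//; congr (_%:E).
by apply: eq_Rintegral => x _; rewrite ger0_norm.
Qed.

Lemma L1H1_sz_nagy_class f : (forall x, 0 <= f x) -> L1H1 f -> sz_nagy_class f.
Proof. by move=> f0 [f1 [fd f2]]; split; [|exact: f1|exact: (fd 0%N isT)|exact: (f2 1%N isT)]. Qed.

Lemma sz_nagy_rhsE m f : sz_nagy_class f -> sz_nagy_rhs m f =
  ((\int[mu]_x f x) `^ ((m + 3) / m) * \int[mu]_x (wderiv setT f x ^+ 2))%:E.
Proof.
move=> [f0 f1 _ f2]; rewrite /sz_nagy_rhs Lfun1_norm//.
have fin : Lpnorm 2%:E (wderiv setT f) \is a fin_num.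
  by rewrite ge0_fin_numE ?Lnorm_ge0//; exact: Lfun_fin.
by rewrite -(fineK fin) -EFin_expe Lpnorm2_Rintegral.
Qed.

Lemma Lpnorm_power_mass m f : 0 < m -> (forall x, 0 <= f x) ->
  (Lpnorm (m + 1)%:E f < +oo)%E ->
  Lpnorm (m + 1)%:E f = (fine (Lpnorm (m + 1)%:E f))%:E /\
  fine (Lpnorm (m + 1)%:E f) `^ (m + 1) = power_mass m f.
Proof.
move=> m0 f0 fin; split; first by rewrite fineK// ge0_fin_numE ?Lnorm_ge0.
have m1 : m + 1 != 0 by rewrite gt_eqF// addr_gt0.
rewrite (Lpnorm_powR m1 fin).
by apply: eq_Rintegral => x _; rewrite ger0_norm.
Qed.

Lemma sz_nagy_lhsE m f : 0 < m -> (forall x, 0 <= f x) ->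
  (Lpnorm (m + 1)%:E f < +oo)%E -> sz_nagy_lhs m f = (power_mass m f `^ (3 / m))%:E.
Proof.
move=> m0 f0 fin; have [e1 e2] := Lpnorm_power_mass m0 f0 fin.
rewrite /sz_nagy_lhs e1 poweR_EFin -e2 -powRrM; congr (_ `^ _)%:E.
by field; rewrite gt_eqF.
Qed.

Lemma Lpnorm_lty_sz_nagy m f : 0 < m -> (sz_nagy_lhs m f < +oo)%E ->
  (Lpnorm (m + 1)%:E f < +oo)%E.
Proof.
by move=> m0; apply: lty_poweRy; rewrite mulf_neq0// ?invr_neq0 ?mulf_neq0 ?gt_eqF ?addr_gt0.
Qed.

(* The infimum of an empty or unbounded set is 0, so a nonzero constant
   is a true infimum. *)
Lemma sz_nagy_le m f : 0 < m -> sz_nagy_const m != 0 -> sz_nagy_class f ->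
  (Lpnorm (m + 1)%:E f < +oo)%E /\
  power_mass m f `^ (3 / m) <= sz_nagy_const m *
    ((\int[mu]_x f x) `^ ((m + 3) / m) * \int[mu]_x (wderiv setT f x ^+ 2)).
Proof.
move=> m0 C0 fc; have [f0 _ _ _] := fc.
pose S := [set C : R | forall f, sz_nagy_class f ->
                 (sz_nagy_lhs m f <= C%:E * sz_nagy_rhs m f)%E].
have hS : has_inf S by apply: contrapT => h; move/eqP: C0; apply; exact: inf_out.
have [C1 SC1] := hS.1.
have fin : (Lpnorm (m + 1)%:E f < +oo)%E.
  apply: Lpnorm_lty_sz_nagy => //; apply: le_lt_trans (SC1 f fc) _.
  by rewrite sz_nagy_rhsE// -EFinM ltry.
split => //; have ineq C : S C -> power_mass m f `^ (3 / m) <= C *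
    ((\int[mu]_x f x) `^ ((m + 3) / m) * \int[mu]_x (wderiv setT f x ^+ 2)).
  by move=> /(_ f fc); rewrite sz_nagy_lhsE// sz_nagy_rhsE// -EFinM lee_fin.
have : 0 <= (\int[mu]_x f x) `^ ((m + 3) / m) * \int[mu]_x (wderiv setT f x ^+ 2).
  by rewrite mulr_ge0 ?powR_ge0// Rintegral_ge0// => x _; exact: sqr_ge0.
move: (_ * _) ineq => r ineq; rewrite le_eqVlt => /predU1P[r0|r0].
  (* If r = 0, the inequality reads the same for every constant, so it follows from [C1]. *)
  by have := ineq C1 SC1; rewrite -r0 !mulr0.
rewrite -ler_pdivrMr//; apply: lb_le_inf; first exact: hS.1.
by move=> C SC; rewrite ler_pdivrMr//; exact: ineq.
Qed.

(** A constant <= 0 in the equality case would make the norm of U vanish, whereas an optimizer is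
    nonzero. Positivity also excludes the default value of [inf]. *)
Lemma sz_nagy_const_gt0 m (U : R -> R) : 0 < m -> sz_nagy_optimizer m U -> 0 < sz_nagy_const m.
Proof.
move=> m0 [Uc nz]; have [U0 U1 _ _] := Uc; rewrite sz_nagy_rhsE// -EFinM => e.
have fin : (Lpnorm (m + 1)%:E U < +oo)%E.
  by apply: Lpnorm_lty_sz_nagy => //; rewrite e ltry.
have r0 : 0 <= (\int[mu]_x U x) `^ ((m + 3) / m) * \int[mu]_x (wderiv setT U x ^+ 2).
  by rewrite mulr_ge0 ?powR_ge0// Rintegral_ge0// => x _; exact: sqr_ge0.
rewrite ltNge; apply/negP => C0; apply: nz.
have lhs0 : sz_nagy_lhs m U = 0%E.
  by apply/eqP; rewrite eq_le poweR_ge0 e lee_fin mulr_le0_ge0.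
have L0 : Lpnorm (m + 1)%:E U = 0%E.
  by move/eqP: lhs0; rewrite poweR_eq0 ?Lnorm_ge0// => /andP[/eqP].
have mU : measurable_fun setT (EFin \o U).
  by apply/measurable_EFinP; exact: Lfun_mfun U1.
have m10 : (0 < (m + 1)%:E)%E by rewrite lte_fin addr_gt0.
have := @Lnorm_eq0_eq0 _ (measurableTypeR R) R mu _ _ mU m10 L0.
by apply: aeS => x /= /(_ Logic.I)[].
Qed.

(** The left-hand function of Y is continuous at Y1 > 0, so it exceeds E on a ball around Y1, whose
    radius is d. *)
Lemma poly_gap m k E Y1 : 0 < Y1 ->
  E < 2^-1 * (k * Y1 `^ (3 / m)) - (m + 1)^-1 * Y1 ->
  exists2 d : R, 0 < d & forall Y, 2^-1 * (k * Y `^ (3 / m)) - (m + 1)^-1 * Y <= E ->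
    d <= `|Y - Y1|.
Proof.
move=> Y10 EG; pose G Y := 2^-1 * (k * Y `^ (3 / m)) - (m + 1)^-1 * Y.
have cG : G x @[x --> Y1] --> G Y1.
  have cp : {for Y1, continuous (fun Y : R => Y `^ (3 / m))}.
    apply: differentiable_continuous; apply/derivable1_diffP.
    by have [] := @is_derive1_powR R (3 / m) Y1 Y10.
  apply: cvgB; last by apply: cvgMr; exact: cvg_id.
  by apply: cvgMr; apply: cvgMr.
have nG : nbhs Y1 [set Y | E < G Y] by exact: (cvgr_gt (G Y1) cG).
have /nbhs_ballP[d /= d0 hd] := nG.
exists d => // Y GE; rewrite leNgt; apply/negP => Yd.
have : E < G Y by apply: hd; rewrite /ball/= distrC.
by rewrite ltNge GE.
Qed.

(** With q = 1 - 3 / m > 0, the balance at Y1 rewrites the expression as Y^(3/m) times 2m/(m+1)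
    (Y1^q - Y^q). The first factor is bounded below because Y >= l, the second because Y <= Y1 -
    d. *)
Lemma virial_gap m k Y1 d l : 3 < m -> 0 < k -> 0 < Y1 -> 0 < d -> 0 < l ->
  k * Y1 `^ (3 / m) = 2 * m / (3 * (m + 1)) * Y1 ->
  exists2 e : R, 0 < e & forall Y, l <= Y -> Y <= Y1 - d ->
    e <= 3 * (k * Y `^ (3 / m)) - 2 * m / (m + 1) * Y.
Proof.
move=> hm k0 Y10 d0 l0 eY1; have m0 : 0 < m by lra.
pose q := 1 - 3 / m; have q0 : 0 < q by rewrite subr_gt0 ltr_pdivrMr// mul1r.
have splitY Y : 0 < Y -> Y = Y `^ (3 / m) * Y `^ q.
  move=> Y0; rewrite -powRD; last by rewrite (gt_eqF Y0) implybT.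
  by rewrite (_ : 3 / m + q = 1) ?powRr1 ?(ltW Y0)// /q addrC subrK.
have kE : 3 * k = 2 * m / (m + 1) * Y1 `^ q.
  have pY : 0 < Y1 `^ (3 / m) by exact: powR_gt0.
  apply: (mulIf (lt0r_neq0 pY)); move: eY1 (splitY Y1 Y10) pY.
  move: (Y1 `^ q) (Y1 `^ (3 / m)) => s p eY1 hs _.
  rewrite -[LHS]mulrA eY1 {1}hs; field; rewrite gt_eqF ?addr_gt0//.
(* An upper bound of the admissible Y that is positive even when Y1 - d is not. *)
pose Z := Num.max l (Y1 - d).
have Z0 : 0 < Z by rewrite lt_max l0.
have [Y1l|lY1] := Order.TotalTheory.leP Y1 l.
  (* No Y lies between l and Y1 - d in this case. *)
  by exists 1 => // Y lY Yd; lra.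
have ZY1 : Z < Y1 by rewrite gt_max lY1 ltrBlDr ltrDl.
pose e := l `^ (3 / m) * (2 * m / (m + 1) * (Y1 `^ q - Z `^ q)).
have c0 : 0 < 2 * m / (m + 1) by rewrite divr_gt0 ?addr_gt0 ?mulr_gt0.
have h : 0 < Y1 `^ q - Z `^ q.
  by rewrite subr_gt0 gt0_ltr_powR// nnegrE ltW.
exists e; first by rewrite /e mulr_gt0 ?powR_gt0// mulr_gt0.
move=> Y lY Yd; have Y0 : 0 < Y by exact: lt_le_trans lY.
have -> : 3 * (k * Y `^ (3 / m)) - 2 * m / (m + 1) * Y =
    Y `^ (3 / m) * (2 * m / (m + 1) * (Y1 `^ q - Y `^ q)).
  rewrite mulrA kE [in X in _ - X](splitY Y Y0); ring.
apply: ler_pM; [exact: powR_ge0|by rewrite ltW// mulr_gt0| |].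
  by apply: ge0_ler_powR; rewrite ?nnegrE ?divr_ge0// ltW.
rewrite ler_wpM2l ?(ltW c0)// lerD2l lerN2.
by apply: ge0_ler_powR; rewrite ?nnegrE ?(ltW q0) ?(ltW Y0) ?(ltW Z0)// le_max Yd orbT.
Qed.

(* f <= h on [-A, A], f <= h^-m f^(m+1) where f > h, and f <= x^2 f / A^2
   outside [-A, A]. *)
Lemma power_mass_lower m M l : 0 < m -> 0 < M -> 0 <= l -> exists2 c : R, 0 < c &
  forall f, (forall x, 0 <= f x) -> mu.-integrable setT (EFin \o f) ->
    mu.-integrable setT (EFin \o (fun x => x ^+ 2 * f x)) ->
    mu.-integrable setT (EFin \o (fun x => f x `^ (m + 1))) ->
    \int[mu]_x f x = M -> \int[mu]_x (x ^+ 2 * f x) <= l -> c <= power_mass m f.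
Proof.
(* A and h are chosen so that the tail l / A^2 and the low part 2 A h carry at most M / 4 each; the
   remaining mass M / 2 lies where f > h. *)
move=> m0 M0 l0; pose A := 1 + 4 * l / M.
have A1 : 1 <= A by rewrite lerDl divr_ge0 ?mulr_ge0// ltW.
have A0 : 0 < A by exact: lt_le_trans A1.
pose h := M / (8 * A); have h0 : 0 < h by rewrite divr_gt0 ?mulr_gt0.
have hm0 : 0 < h `^ m by exact: powR_gt0.
exists (M / 2 * h `^ m); first by rewrite !mulr_gt0 ?invr_gt0.
move=> f f0 fi f2i fmi fM fl.
pose I : R -> R := \1_(`[- A, A]%classic).
have AA : - A <= A by lra.
have iI : mu.-integrable setT (EFin \o I).
  exact: integrable_indic_itv.
have II : \int[mu]_x I x = 2 * A.
  transitivity (\int[mu]_(x in `[- A, A]) (1:R)); last by rewrite Rintegral_cst_itv//; ring.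
  rewrite [RHS]Rintegral_mkcond; apply: eq_Rintegral => x _.
  by rewrite patchE /I indicE; case: ifPn.
have j1 := integrableZl measurableT h iI.
have j2 := integrableZl measurableT (h `^ m)^-1 fmi.
have j3 := integrableZl measurableT (A ^- 2) f2i.
have j12 := integrableD measurableT j1 j2.
have : \int[mu]_x f x <= \int[mu]_x (h * I x + (h `^ m)^-1 * f x `^ (m + 1) + A ^- 2 * (x ^+ 2 * f x)).
  apply: le_Rintegral => //; first exact: (integrableD measurableT j12 j3).
  move=> x _; have p1 : 0 <= h * I x by rewrite mulr_ge0 ?(ltW h0)// /I indicE.
  have p2 : 0 <= (h `^ m)^-1 * f x `^ (m + 1) by rewrite mulr_ge0 ?invr_ge0 ?powR_ge0.
  have p3 : 0 <= A ^- 2 * (x ^+ 2 * f x).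
    by rewrite mulr_ge0 ?invr_ge0 ?exprn_ge0 ?(ltW A0)// mulr_ge0 ?sqr_ge0.
  have [fh|hf] := Order.TotalTheory.leP (f x) h; last first.
    suff : f x <= (h `^ m)^-1 * f x `^ (m + 1) by lra.
    rewrite mulrC ler_pdivlMr// powRD ?powRr1//; last first.
      by apply/implyP => _; rewrite gt_eqF// (lt_trans h0).
    rewrite mulrC ler_wpM2r//; apply: ge0_ler_powR; rewrite ?nnegrE ?(ltW m0) ?(ltW h0)//.
    exact: ltW.
  have [xA|xA] := Order.TotalTheory.leP `|x| A.
    suff : f x <= h * I x by lra.
    by rewrite /I indicE mem_set ?mulr1//= in_itv/= -ler_norml.
  suff : f x <= A ^- 2 * (x ^+ 2 * f x) by lra.
  rewrite mulrA ler_peMl// mulrC ler_pdivlMr ?exprn_gt0// mul1r.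
  by rewrite -[x ^+ 2]real_normK ?num_real// ler_pXn2r ?nnegrE ?(ltW A0)// ltW.
have j := integrableD measurableT j12 j3.
rewrite (RintegralD _ j12 j3)// (RintegralD _ j1 j2)//.
rewrite RintegralZl// RintegralZl// RintegralZl// II fM -/(power_mass m f).
have b1 : h * (2 * A) = M / 4 by rewrite /h; field; rewrite gt_eqF.
have b3 : A ^- 2 * \int[mu]_x (x ^+ 2 * f x) <= M / 4.
  rewrite mulrC ler_pdivrMr ?exprn_gt0//; apply: le_trans fl _.
  have lA : l <= M / 4 * A.
    rewrite (_ : M / 4 * A = M / 4 + l); last by rewrite /A; field; rewrite gt_eqF.
    by rewrite lerDr divr_ge0// ltW.
  apply: le_trans lA _; rewrite ler_wpM2l ?divr_ge0 ?(ltW M0)// expr2 ler_peMl ?(ltW A0)//.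
rewrite b1 => H; rewrite -ler_pdivlMr// mulrC; lra.
Qed.

End SzNagyInequality.

(** * Solutions below the critical energy *)

Section Dichotomy.
Local Open Scope classical_set_scope.
Local Open Scope ring_scope.
Context {R : realType}.
Local Notation mu := (@lebesgue_measure R).
Implicit Types (f g : R -> R) (B C T c d e k l s t x y Y : R).

Lemma cvg_pinfty_limf_esup (F : set_system R) (h : R -> \bar R) :
  ProperFilter F -> h x @[x --> F] --> +oo%E -> limf_esup h F = +oo%E.
Proof.
move=> FF /cvgeyPge hF; apply/eqP; rewrite -leye_eq; apply: le_ereal_inf_tmp.
move=> _ [A FA <-]; rewrite leye_eq; apply/eqP/eqyP => K _.
have [x [Ax Kx]] := filter_ex (filterI FA (hF K)).
by apply: le_trans Kx _; apply: ereal_sup_ubound; exists x.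
Qed.

(** The negative part vanishes off N, and [integral_null_le] bounds its integral by 0 without
    measurability. Used for the entropy dissipation. *)
Lemma integral_null_ge0 (D N : set R) (h : R -> \bar R) : measurable N -> mu N = 0%E ->
  (forall x, D x -> ~ N x -> (0 <= h x)%E) -> (0 <= \int[mu]_(x in D) h x)%E.
Proof.
move=> mN N0 h0; rewrite integral_mkcond integralE.
rewrite (_ : (\int[mu]_x ((h \_ D)^\-%E x))%E = 0%E) ?sube0; first exact: integral_ge0.
apply/eqP; rewrite eq_le; apply/andP; split; last exact: integral_ge0.
rewrite -(integral0 mu setT).
apply: (@integral_null_le _ (measurableTypeR R) R mu _ _ _ mN N0) => // x nN.
rewrite funenegE patchE; case: ifPn => [/set_mem Dx|_]; last by rewrite oppe0 maxxx.
by apply/max_idPr; rewrite leeNl oppe0; exact: h0.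
Qed.

Lemma good_times_average T (N : set R) (F : R -> R) c x y : measurable N -> mu N = 0%E ->
  lint F -> (forall s, good_times T N s -> c <= F s) ->
  0 <= x -> x <= y -> y < T -> c * (y - x) <= \int[mu]_(s in `[x, y]) F s.
Proof.
move=> mN N0 lF cF x0 xy yT.
have lc : lint (cst c : R -> R) by apply: continuous_lint; exact: cst_continuous.
rewrite -Rintegral_cst_itv// -subr_ge0 -RintegralB//.
have mN0 : measurable (N `|` [set (0:R)]) by exact: measurableU.
have N00 : mu (N `|` [set (0:R)]) = 0%E.
  by apply: null_set_setU => //; exact: lebesgue_measure_set1.
(* The integrand agrees at good times with its positive part, which is nonnegative at every time. *)
rewrite (_ : Rintegral _ _ _ = \int[mu]_(s in `[x, y]) Num.max 0 (F s - c)).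
  by apply: Rintegral_ge0 => s _; rewrite le_max lexx.
apply: (@Rintegral_null_mod _ (measurableTypeR R) R mu _ _ _ _ mN0 N00) => s.
rewrite /= in_itv/= => /andP[xs sy] /not_orP[nN /= s0].
rewrite max_r// subr_ge0; apply: cF; split => //=; rewrite in_itv/=.
by rewrite (le_lt_trans sy yT) andbT lt_neqAle (le_trans x0 xs) andbT eq_sym; exact/eqP.
Qed.

(** The exponents m / (m - 3) and 1 - 3 / m are inverse to each other, so Y^(1 - 3/m) = l. The
    conclusion is the equation G'(Y) = 0 cleared of denominators. *)
Lemma power_balance m k l Y : 3 < m -> 0 < l -> l = 3 * (m + 1) / (2 * m) * k ->
  Y = l `^ (m / (m - 3)) -> k * Y `^ (3 / m) = 2 * m / (3 * (m + 1)) * Y.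
Proof.
move=> hm l0 lE YE.
have m0 : 0 < m by lra.
have m10 : 0 < m + 1 by rewrite addr_gt0.
have m3 : 0 < m - 3 by rewrite subr_gt0.
have Y0 : 0 < Y by rewrite YE powR_gt0.
have lY : Y `^ (1 - 3 / m) = l.
  rewrite YE -powRrM (_ : _ * _ = 1) ?powRr1 ?(ltW l0)//.
  by field; rewrite !gt_eqF.
have YY : Y = Y `^ (3 / m) * l.
  rewrite -[in RHS]lY -powRD; last by rewrite (gt_eqF Y0) implybT.
  by rewrite (addrC (3 / m)) subrK powRr1// ltW.
rewrite [in RHS]YY lE; move: (_ `^ _) => p.
by field; rewrite !gt_eqF.
Qed.

(** * The critical level and solutions of energy below it *)

Section Optimizer.
Variables (m M : R) (U : R -> R).
Hypotheses (hm : 3 < m) (M0 : 0 < M).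
Hypotheses (Uopt : sz_nagy_optimizer m U) (UY : Yset m M (Pstar m M) U).

Let m0 : 0 < m. Proof. by move: hm; lra. Qed.
Let m10 : 0 < m + 1. Proof. by rewrite addr_gt0. Qed.

(** [critical_slope] is the constant K of the overview, and [critical_mass] is Ystar. *)
Definition critical_slope := (sz_nagy_const m * M `^ ((m + 3) / m))^-1.
Definition critical_mass := Pstar m M `^ (m + 1).

Let C0 : 0 < sz_nagy_const m. Proof. exact: sz_nagy_const_gt0 m0 Uopt. Qed.

Lemma critical_slope_gt0 : 0 < critical_slope.
Proof. by rewrite invr_gt0 mulr_gt0// powR_gt0. Qed.

Let r := 3 * (m + 1) / (2 * m) * critical_slope.

Let r0 : 0 < r. Proof. by rewrite mulr_gt0 ?critical_slope_gt0// divr_gt0 ?mulr_gt0. Qed.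

Lemma critical_massE : critical_mass = r `^ (m / (m - 3)).
Proof.
have m3 : 0 < m - 3 by rewrite subr_gt0.
have Mp : 0 < M `^ ((m + 3) / m) by exact: powR_gt0.
rewrite /critical_mass /Pstar -powRrM; congr (_ `^ _).
  rewrite /r /critical_slope; move: (_ `^ _) Mp (sz_nagy_const m) C0 => p p0 C Cp.
  by field; rewrite !gt_eqF.
by field; rewrite !gt_eqF.
Qed.

Lemma critical_mass_gt0 : 0 < critical_mass.
Proof. by rewrite critical_massE powR_gt0. Qed.

Lemma critical_mass_balance :
  critical_slope * critical_mass `^ (3 / m) = 2 * m / (3 * (m + 1)) * critical_mass.
Proof.
exact: (power_balance hm r0 (erefl r) critical_massE).
Qed.

(** Equality in the Sz.-Nagy inequality determines the integral of U_x^2 as K Ystar^(3/m), and the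
    balance at Ystar turns this into a multiple of Ystar. *)
Lemma optimizer_energy : energy m U = (m - 3) / (3 * (m + 1)) * critical_mass.
Proof.
have [U0 U1 U2 UM UP] := UY; have [Uc _ e] := Uopt.
have fin : (Lpnorm (m + 1)%:E U < +oo)%E by rewrite UP ltry.
have [_ mU] := Lpnorm_power_mass m0 U0 fin.
have {}mU : power_mass m U = critical_mass by rewrite -mU UP.
have UM' : \int[mu]_x U x = M by apply/EFin_inj; rewrite -UM Lfun1_norm.
move: e; rewrite sz_nagy_lhsE// sz_nagy_rhsE// -EFinM => -[]; rewrite UM' mU.
rewrite /energy -/(power_mass m U) mU.
move: (\int[mu]_x _) => D e.
have -> : D = critical_slope * critical_mass `^ (3 / m).
  rewrite e /critical_slope; have Mp : 0 < M `^ ((m + 3) / m) by exact: powR_gt0.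
  move: {e} (_ `^ _) Mp (sz_nagy_const m) C0 => p p0 C Cp.
  by field; rewrite !gt_eqF.
by rewrite critical_mass_balance; field; rewrite gt_eqF.
Qed.

Lemma critical_ineq f : (forall x, 0 <= f x) -> L1H1 f -> \int[mu]_x f x = M ->
  (Lpnorm (m + 1)%:E f < +oo)%E /\
  critical_slope * power_mass m f `^ (3 / m) <= \int[mu]_x (wderiv setT f x ^+ 2).
Proof.
move=> f0 Lf fM; have C00 : sz_nagy_const m != 0 by rewrite gt_eqF.
have [fin] := sz_nagy_le m0 C00 (L1H1_sz_nagy_class f0 Lf).
rewrite fM mulrA => h; split => //.
have Mp : 0 < M `^ ((m + 3) / m) by exact: powR_gt0.
by rewrite /critical_slope [leLHS]mulrC ler_pdivrMr ?mulr_gt0// [leRHS]mulrC.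
Qed.

Lemma energy_gap E : E < energy m U -> exists2 d : R, 0 < d &
  forall f, (forall x, 0 <= f x) -> L1H1 f -> \int[mu]_x f x = M -> energy m f <= E ->
    d <= `|power_mass m f - critical_mass|.
Proof.
rewrite optimizer_energy => EU.
have [|d d0 hd] := @poly_gap R m critical_slope E critical_mass critical_mass_gt0.
  rewrite critical_mass_balance; apply: lt_le_trans EU _; rewrite le_eqVlt; apply/predU1P; left.
  by field; rewrite gt_eqF.
exists d => // f f0 Lf fM fE; apply: hd; apply: le_trans fE.
have [_ h] := critical_ineq f0 Lf fM.
by rewrite /energy lerD2r ler_pM2l.
Qed.

Lemma Lpnorm_critical_mass f : (forall x, 0 <= f x) -> L1H1 f -> \int[mu]_x f x = M ->
  ((Lpnorm (m + 1)%:E U < Lpnorm (m + 1)%:E f)%E -> critical_mass < power_mass m f) /\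
  ((Lpnorm (m + 1)%:E f < Lpnorm (m + 1)%:E U)%E -> power_mass m f < critical_mass).
Proof.
move=> f0 Lf fM; have [_ _ _ _ ->] := UY.
have [fin _] := critical_ineq f0 Lf fM.
have [-> <-] := Lpnorm_power_mass m0 f0 fin.
have L0 : 0 <= fine (Lpnorm (m + 1)%:E f) by rewrite fine_ge0// Lnorm_ge0.
have P0 : 0 <= Pstar m M by exact: powR_ge0.
by split; rewrite lte_fin => h; apply: gt0_ltr_powR; rewrite ?nnegrE.
Qed.

Section Evolution.
Variables (J : R -> R) (u0 : R -> R) (T : R) (u : R -> R -> R).
Hypothesis hJ : standard_mollifier J.
Hypothesis ws : weak_entropy_solution m u0 T u.
Hypotheses (u0_ge0 : forall x, 0 <= u0 x) (u0_L1H1 : L1H1 u0).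
Hypotheses (u0_moment : (second_moment u0 < +oo)%E) (u0M : \int[mu]_x u0 x = M).
(** The gap is a parameter here, so that one d serves all time horizons T. *)
Variable d : R.
Hypothesis d0 : 0 < d.
Hypothesis gap : forall f, (forall x, 0 <= f x) -> L1H1 f -> \int[mu]_x f x = M ->
  energy m f <= energy m u0 -> d <= `|power_mass m f - critical_mass|.

Let m1 : 1 <= m. Proof. by move: hm; lra. Qed.

Lemma solution_energy t : 0 < t < T -> energy m (u t) <= energy m u0.
Proof.
move=> t0T; rewrite -lee_fin; apply: le_trans (wes_energy ws t0T).
(* The slice at time 0 is not known to be nonnegative, so {0} is discarded as a null set. *)
rewrite leeDl//; apply: (@integral_null_ge0 _ [set 0]) => //.
  exact: lebesgue_measure_set1.
move=> s; rewrite /= in_itv/= => /andP[s0 st] /eqP sn0.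
have s0T : 0 < s < T.
  by rewrite lt_neqAle eq_sym sn0 s0 (le_lt_trans st)//; case/andP: t0T.
have [us0 _ _] := wes_slice ws s0T.
by apply: integral_ge0 => x _; rewrite lee_fin mulr_ge0 ?exprn_ge0.
Qed.

Lemma solution_mass t : 0 < t < T -> \int[mu]_x u t x = M.
Proof. by move=> t0T; rewrite (wes_mass ws t0T); exact: u0M. Qed.

Lemma solution_side : exists B N, [/\ 0 <= B, measurable N, mu N = 0%E,
    forall t, good_times T N t -> good_slice B (u t) &
    (critical_mass < power_mass m u0 ->
       forall t, good_times T N t -> critical_mass + d <= power_mass m (u t)) /\
    (power_mass m u0 < critical_mass ->
       forall t, good_times T N t -> power_mass m (u t) <= critical_mass - d)].
Proof.
have [B [N [B0 mN N0 good]]] := good_times_exist ws; exists B, N.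
split; [exact: B0|exact: mN|exact: N0|exact: good|].
apply: (power_mass_gap hJ m1 ws u0_ge0 u0_L1H1 B0 mN N0 good d0).
  move=> t [+ _]; rewrite /= in_itv/= => t0T; have [ut0 _ Lu] := wes_slice ws t0T.
  exact: (gap ut0 Lu (solution_mass t0T) (solution_energy t0T)).
exact: (gap u0_ge0 u0_L1H1 u0M (lexx _)).
Qed.

Section GoodTimes.
Variables (B : R) (N : set R).
Hypotheses (B0 : 0 <= B) (mN : measurable N) (N0 : mu N = 0%E).
Hypothesis good : forall t, good_times T N t -> good_slice B (u t).

Lemma virial_sliceE t : good_times T N t ->
  virial_slice m T u N t = 3 * \int[mu]_x (wderiv setT (u t) x ^+ 2)
    - 2 * m / (m + 1) * power_mass m (u t).
Proof.
move=> Gt; rewrite /virial_slice /time_slice patchE mem_set//=.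
have gs := good Gt; have h k := @bounded_continuous_cst R k.
have [_ [[_ i2 i3 E3] _]] := good_slice_facts hJ gs.
have [i4 _] := good_slice_pow hJ (ltW m0) gs.
have [_ ->] := slice_integrable hJ (ltW m0) gs (h 3) (h 0) (h (- (2 * m / (m + 1)))).
rewrite E3 /power_mass RintegralZl// RintegralZl// RintegralZl//.
by rewrite mul0r addr0 mulNr.
Qed.

Lemma virial_slice_energy t : good_times T N t ->
  virial_slice m T u N t <= 6 * energy m u0 - 2 * (m - 3) / (m + 1) * power_mass m (u t).
Proof.
move=> Gt; rewrite virial_sliceE//.
have t0T : 0 < t < T by case: Gt => + _; rewrite /= in_itv.
have := solution_energy t0T; rewrite /energy -/(power_mass m (u t)).
move: (power_mass m (u t)) (\int[mu]_x _) => Y D h.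
rewrite (_ : 3 * D - _ = 6 * (2^-1 * D - (m + 1)^-1 * Y) - 2 * (m - 3) / (m + 1) * Y); last first.
  by move: (m10) => m10'; field; rewrite gt_eqF.
by rewrite lerD2r ler_pM2l.
Qed.

Lemma virial_slice_critical t : good_times T N t ->
  3 * (critical_slope * power_mass m (u t) `^ (3 / m))
    - 2 * m / (m + 1) * power_mass m (u t) <= virial_slice m T u N t.
Proof.
move=> Gt; rewrite virial_sliceE//.
have t0T : 0 < t < T by case: Gt => + _; rewrite /= in_itv.
have [ut0 _ Lu] := wes_slice ws t0T.
have [_ h] := critical_ineq ut0 Lu (solution_mass t0T).
by rewrite lerD2r (ler_pM2l (ltr0n R 3)); exact: h.
Qed.

End GoodTimes.

(** The bound is the time at which a second moment decreasing at rate at least c would reach 0. It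
    does not depend on T, so it bounds the maximal time. *)
Lemma supercritical_lifetime : energy m u0 < energy m U -> critical_mass < power_mass m u0 ->
  T <= \int[mu]_x (x ^+ 2 * u0 x) / (6 * (energy m U - energy m u0)).
Proof.
move=> subcritical Y0.
have [B [N [B0 mN N0 good [side _]]]] := solution_side.
pose c := 6 * (energy m U - energy m u0).
have c0 : 0 < c by rewrite mulr_gt0// subr_gt0.
have I0 : 0 <= \int[mu]_x (x ^+ 2 * u0 x).
  by apply: Rintegral_ge0 => x _; rewrite mulr_ge0 ?sqr_ge0.
rewrite leNgt; apply/negP; rewrite -/c => IT.
have [I [{}IT I00 eI]] : exists I : R, [/\ I < T, 0 <= I & \int[mu]_x (x ^+ 2 * u0 x) = I * c].
  exists (\int[mu]_x (x ^+ 2 * u0 x) / c).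
  by rewrite divfK ?gt_eqF//; split; [exact: IT|exact: divr_ge0 I0 (ltW c0)|].
(* At this time, after I and before T, the second moment would be at most c (I - t) < 0. *)
pose t := (I + T) / 2.
have It : I < t by rewrite /t midf_lt.
have t0T : 0 < t < T by rewrite (le_lt_trans I00 It) /t midf_lt.
have [t0 tT] := andP t0T.
have [iu e] := second_moment_evolution hJ m1 ws u0_ge0 u0_L1H1 u0_moment mN N0 good t0T.
have lV := virial_slice_lint hJ m1 ws mN good.
have lV' := lintZ (-1) lV.
have V s : good_times T N s -> c <= -1 * virial_slice m T u N s.
  move=> Gs; have := virial_slice_energy good Gs; have := side Y0 s Gs.
  move: (virial_slice m T u N s) (power_mass m (u s)) => v Y hY hv.
  rewrite mulN1r lerNr; apply: le_trans hv _.
  have : 2 * (m - 3) / (m + 1) * critical_mass <= 2 * (m - 3) / (m + 1) * Y.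
    apply: ler_wpM2l; first by rewrite divr_ge0 ?(ltW m10)// mulr_ge0// subr_ge0 ltW.
    by apply: le_trans hY; rewrite lerDl ltW.
  rewrite /c optimizer_energy.
  rewrite (_ : 2 * (m - 3) / (m + 1) * critical_mass = 6 * ((m - 3) / (3 * (m + 1)) * critical_mass)); last first.
    by field; rewrite gt_eqF.
  by move=> h; rewrite [6 * (_ - energy m u0)]mulrBr opprB lerD2l lerN2.
have := good_times_average mN N0 lV' V (lexx 0) (ltW t0) tT.
rewrite RintegralZl//.
have : 0 <= \int[mu]_x (x ^+ 2 * u t x).
  have [ut0 _ _] := wes_slice ws t0T.
  by apply: Rintegral_ge0 => x _; rewrite mulr_ge0 ?sqr_ge0.
rewrite e subr0.
rewrite eI; move: (Rintegral _ _ _) => V0 h1 h2.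
have : c * t <= c * I by apply: le_trans h2 _; rewrite mulN1r [c * I]mulrC -subr_ge0 opprK.
by rewrite ler_pM2l// leNgt It.
Qed.

(** A bound at some time in every interval suffices to contradict divergence of the gradient norm at
    a finite maximal time. *)
Lemma subcritical_gradient : power_mass m u0 < critical_mass ->
  forall a b : R, 0 <= a -> a < b -> b <= T -> exists t, [/\ a < t, t < b &
    (Lpnorm 2%:E (wderiv setT (u t)) <=
     (2 * (energy m u0 + (m + 1)^-1 * critical_mass) + 1)%:E)%E].
Proof.
move=> Y0 a b a0 ab bT.
have [B [N [B0 mN N0 good [_ side]]]] := solution_side.
have [t [Gt at_ tb]] := good_times_dense mN N0 a0 ab bT.
exists t; split => //.
have t0T : 0 < t < T by case: Gt => + _; rewrite /= in_itv.
have [_ _ [_ [_ /(_ 1%N isT) /= w2]]] := wes_slice ws t0T.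
have fin : Lpnorm 2%:E (wderiv setT (u t)) \is a fin_num.
  by rewrite ge0_fin_numE ?Lnorm_ge0//; exact: Lfun_fin.
(* The inequality z <= (z^2 + 1) / 2 bounds the norm by its square without a root; hence the + 1 in
   the bound. *)
have aux (z Y E D : R) : Y <= critical_mass - d -> 2^-1 * D - (m + 1)^-1 * Y <= E ->
    z ^+ 2 = D -> z <= 2 * (E + (m + 1)^-1 * critical_mass) + 1.
  move=> hY hE hz.
  have h1 : (m + 1)^-1 * Y <= (m + 1)^-1 * critical_mass.
    rewrite ler_wpM2l ?invr_ge0 ?(ltW m10)//; apply: le_trans hY _.
    by rewrite gerBl ltW.
  have h2 : 0 <= D by rewrite -hz sqr_ge0.
  by have := sqr_ge0 (z - 1); rewrite sqrrB1 hz; lra.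
rewrite -(fineK fin) lee_fin.
exact: (aux _ _ _ _ (side Y0 t Gt) (solution_energy t0T) (Lpnorm2_Rintegral w2)).
Qed.

Definition second_momentR t : R := \int[mu]_x (x ^+ 2 * u t x).

Lemma second_momentE t : 0 < t < T -> second_moment (u t) = (second_momentR t)%:E.
Proof.
move=> t0T; have [B [N [B0 mN N0 good]]] := good_times_exist ws.
have [iu _] := second_moment_evolution hJ m1 ws u0_ge0 u0_L1H1 u0_moment mN N0 good t0T.
by rewrite /second_moment /second_momentR /Rintegral fineK//; exact: (integrable_fin_num _ iu).
Qed.

(** The rate c is left free: c = 0 gives monotonicity of the second moment, c = e its linear growth.
    The integrability premise in the hypothesis on c is what [power_mass_lower] asks for. *)
Lemma subcritical_moment_growth c s t :
  (forall x, 0 < x < T -> mu.-integrable setT (EFin \o (fun y => u x y `^ (m + 1))) ->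
    power_mass m (u x) <= critical_mass - d ->
    c <= 3 * (critical_slope * power_mass m (u x) `^ (3 / m))
      - 2 * m / (m + 1) * power_mass m (u x)) ->
  power_mass m u0 < critical_mass -> 0 < s -> s <= t -> t < T ->
  c * (t - s) <= second_momentR t - second_momentR s.
Proof.
move=> hc Y0 s0 st tT.
have [B [N [B0 mN N0 good [_ side]]]] := solution_side.
have s0T : 0 < s < T by rewrite s0 (le_lt_trans st).
have t0T : 0 < t < T by rewrite tT (lt_le_trans s0).
have [_ e1] := second_moment_evolution hJ m1 ws u0_ge0 u0_L1H1 u0_moment mN N0 good s0T.
have [_ e2] := second_moment_evolution hJ m1 ws u0_ge0 u0_L1H1 u0_moment mN N0 good t0T.
have lV := virial_slice_lint hJ m1 ws mN good.
have V x : good_times T N x -> c <= virial_slice m T u N x.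
  move=> Gx; apply: (le_trans _ (virial_slice_critical good Gx)); apply: hc.
  - by case: Gx => + _; rewrite /= in_itv.
  - by have [] := good_slice_pow hJ (ltW m0) (good x Gx).
  - exact: side.
have := good_times_average mN N0 lV V (ltW s0) st tT.
rewrite /second_momentR e1 e2 (Rint_split lV (ltW s0) st).
move: (\int[mu]_x _) (\int[mu]_(_ in `[s, t]) _) (\int[mu]_(_ in `[0, s]) _) => w0 w1 w2 h.
by rewrite opprD addrACA subrr add0r addrAC subrr add0r.
Qed.

End Evolution.
End Optimizer.
End Dichotomy.

(** * Maximal solutions *)

Section MaximalSolutions.
Local Open Scope classical_set_scope.
Local Open Scope ring_scope.
Context {R : realType}.
Local Notation mu := (@lebesgue_measure R).

(** For Y > 0 this is [virial_gap] with l = Y; at Y = 0 the negative term disappears. *)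
Lemma virial_ge0 (m k Y1 d Y : R) : 3 < m -> 0 < k -> 0 < Y1 -> 0 < d ->
  k * Y1 `^ (3 / m) = 2 * m / (3 * (m + 1)) * Y1 -> 0 <= Y -> Y <= Y1 - d ->
  0 <= 3 * (k * Y `^ (3 / m)) - 2 * m / (m + 1) * Y.
Proof.
move=> hm k0 Y10 d0 bal; rewrite le_eqVlt => /predU1P[<- _|Y0 Yd].
  by rewrite mulr0 subr0 !mulr_ge0 ?powR_ge0// ltW.
have [e e0 he] := virial_gap hm k0 Y10 d0 Y0 bal.
exact: le_trans (ltW e0) (he Y (lexx Y) Yd).
Qed.

Lemma linear_growth_unbounded (g : R -> R) : (forall t, 0 < t -> 0 <= g t) ->
  (forall K : R, 0 <= K -> (forall t, 0 < t -> g t <= K) ->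
    exists2 e : R, 0 < e & forall t, 1 <= t -> e * (t - 1) <= g t - g 1) ->
  forall A : R, exists2 t : R, 0 < t & A <= g t.
Proof.
move=> g0 H A; apply: contrapT => nA.
have bA t : 0 < t -> g t <= `|A|.
  move=> t0; rewrite leNgt; apply/negP => h; apply: nA; exists t; first exact: t0.
  exact: le_trans (ler_norm _) (ltW h).
have [e e0 he] := H _ (normr_ge0 A) bA.
have p0 : 0 <= (`|A| + 1) / e by rewrite divr_ge0 ?addr_ge0// ltW.
have := he (1 + (`|A| + 1) / e); rewrite lerDl => /(_ p0).
have := g0 1 ltr01; have : 0 < 1 + (`|A| + 1) / e by rewrite ltr_pwDl.
move=> /bA; rewrite [1 + _ - 1]addrC addKr [e * _]mulrC divfK ?gt_eqF//; lra.
Qed.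

Lemma nondecreasing_unbounded_cvgey (h : R -> \bar R) (g : R -> R) :
  (forall t, 0 < t -> h t = (g t)%:E) -> (forall s t, 0 < s -> s <= t -> g s <= g t) ->
  (forall A : R, exists2 t : R, 0 < t & A <= g t) -> h t @[t --> +oo] --> +oo%E.
Proof.
move=> hg mono unb; apply/cvgeyPge => A; have [t0 t00 At0] := unb A.
near=> t; have tt : t0 < t by near: t; exact: nbhs_pinfty_gt (num_real t0).
rewrite (hg t (lt_trans t00 tt)) lee_fin; apply: le_trans At0 _.
exact: mono t00 (ltW tt).
Unshelve. all: by end_near. Qed.

Section Maximal.
Implicit Types (c d s t T x : R).
Variables (m M : R) (U u0 : R -> R) (Tw : \bar R) (u : R -> R -> R).
Hypotheses (hm : 3 < m) (M0 : 0 < M).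
Hypotheses (Uopt : sz_nagy_optimizer m U) (UY : Yset m M (Pstar m M) U).
Hypotheses (u0_ge0 : forall x, 0 <= u0 x) (u0_L1H1 : L1H1 u0).
Hypotheses (u0_moment : (second_moment u0 < +oo)%E) (u0M : \int[mu]_x u0 x = M).
Hypothesis subcritical : energy m u0 < energy m U.
Hypothesis hu : maximal_weak_entropy_solution m u0 Tw u.

Lemma blowup : critical_mass m M < power_mass m u0 -> exists T : R, Tw = T%:E /\
  limf_esup (fun t => Lpnorm 2%:E (wderiv setT (u t))) T^'- = +oo%E.
Proof.
move=> Y0.
(* The construction of the maximal solution is used here for its mollifier. *)
have [J [_ [_ [hJ _ _ _]]]] := max_lim hu.
have [d d0 gap] := energy_gap hm M0 Uopt UY subcritical.
have bound T (T0 : 0 < T) (TTw : (T%:E < Tw)%E) :=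
  supercritical_lifetime hm M0 Uopt UY hJ (max_sol hu T0 TTw) u0_ge0 u0_L1H1 u0_moment
    u0M d0 gap subcritical Y0.
have := max_Tw hu; case ETw : Tw => [T| |] // _.
  by exists T; split => //; exact: (cvg_pinfty_limf_esup _ (max_blowup hu ETw)).
(* If the maximal time were +oo, the lifetime bound K would have to hold for the horizon |K| + 1. *)
move: bound; move: (_ / _) => K bound.
have K0 : 0 < `|K| + 1 by rewrite ltr_wpDl.
have /bound : ((`|K| + 1)%:E < Tw)%E by rewrite ETw ltry.
by move=> /(_ K0); have := ler_norm K; rewrite leNgt => h1 h2; have := le_lt_trans h2; lra.
Qed.

(** At a finite maximal time the gradient norm tends to +oo, while [subcritical_gradient] finds
    times arbitrarily close to it with a fixed bound. *)
Lemma global_existence : power_mass m u0 < critical_mass m M -> Tw = +oo%E.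
Proof.
move=> Y0.
have [J [_ [_ [hJ _ _ _]]]] := max_lim hu.
have [d d0 gap] := energy_gap hm M0 Uopt UY subcritical.
have := max_Tw hu; case ETw : Tw => [T| |] //; rewrite lte_fin => T0.
have /cvgeyPgt/(_ (2 * (energy m u0 + (m + 1)^-1 * critical_mass m M) + 1)) := max_blowup hu ETw.
rewrite /at_left near_withinE => /nbhs_ballP[e /= e0 he].
(* The window ]a, b[ lies in the left neighbourhood of T where the norm exceeds the bound, and b < T
   because the solution is given on horizons below T. *)
pose a := Num.max 0 (T - e); pose b := (a + T) / 2.
have aT : a < T by rewrite gt_max T0 ltrBlDr ltrDl.
have ab : a < b by rewrite midf_lt.
have bT : b < T by rewrite midf_lt.
have a0 : 0 <= a by rewrite le_max lexx.
have bTw : (b%:E < Tw)%E by rewrite ETw lte_fin.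
have [t [at_ tb]] := subcritical_gradient hm hJ (max_sol hu (le_lt_trans a0 ab) bTw)
  u0_ge0 u0_L1H1 u0M d0 gap Y0 a0 ab (lexx b).
have tT : t < T by exact: lt_trans bT.
have tE : T - e < t by apply: le_lt_trans at_; rewrite le_max lexx orbT.
have te : ball T e t by rewrite /ball/= gtr0_norm ?subr_gt0// ltrBlDr addrC -ltrBlDr.
by rewrite leNgt (he t te tT).
Qed.

Section Global.
Hypothesis Y0 : power_mass m u0 < critical_mass m M.
Variable J : R -> R.
Hypothesis hJ : standard_mollifier J.
Hypothesis global : forall T, 0 < T -> weak_entropy_solution m u0 T u.

Let tt1 t : 0 < t -> 0 < t < t + 1.
Proof. by move=> t0; rewrite t0 ltrDl ltr01. Qed.

(** The horizon t + 1 makes t an interior time. *)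
Let ws t : 0 < t -> weak_entropy_solution m u0 (t + 1) u.
Proof. by move=> t0; apply: global; rewrite addr_gt0. Qed.

Let m2E t : 0 < t -> second_moment (u t) = (second_momentR u t)%:E.
Proof.
by move=> t0; exact: (second_momentE hm hJ (ws t0) u0_ge0 u0_L1H1 u0_moment (tt1 t0)).
Qed.

Lemma global_slice t : 0 < t -> [/\ forall x, 0 <= u t x, mu.-integrable setT (EFin \o u t),
  \int[mu]_x u t x = M & mu.-integrable setT (EFin \o (fun x => x ^+ 2 * u t x))].
Proof.
move=> t0; have [ut0 _ Lu] := wes_slice (ws t0) (tt1 t0).
have [L1 _] := Lu; have [iu _ _ _] := L1H1_integrable Lu.
split; [exact: ut0|exact: iu|exact: (solution_mass (ws t0) u0M (tt1 t0))|].
apply: (second_moment_integrable ut0 (Lfun_mfun L1)).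
by rewrite (m2E t0); exact: ltry.
Qed.

Lemma second_momentR_ge0 t : 0 < t -> 0 <= second_momentR u t.
Proof.
move=> /global_slice[ut0 _ _ _]; apply: Rintegral_ge0 => x _.
exact: mulr_ge0 (sqr_ge0 x) (ut0 x).
Qed.

Section Gap.
Variable d : R.
Hypothesis d0 : 0 < d.
Hypothesis gap : forall f, (forall x, 0 <= f x) -> L1H1 f -> \int[mu]_x f x = M ->
  energy m f <= energy m u0 -> d <= `|power_mass m f - critical_mass m M|.

Let growth c s t : (forall x, 0 < x ->
    mu.-integrable setT (EFin \o (fun y => u x y `^ (m + 1))) ->
    power_mass m (u x) <= critical_mass m M - d ->
    c <= 3 * (critical_slope m M * power_mass m (u x) `^ (3 / m))
      - 2 * m / (m + 1) * power_mass m (u x)) ->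
    0 < s -> s <= t -> c * (t - s) <= second_momentR u t - second_momentR u s.
Proof.
move=> hc s0 st; have t0 : 0 < t by exact: lt_le_trans st.
have /andP[_ tt] := tt1 t0.
apply: (subcritical_moment_growth hm M0 Uopt hJ (ws t0) u0_ge0 u0_L1H1 u0_moment u0M
  d0 gap _ Y0 s0 st tt).
by move=> x /andP[x0 _]; exact: hc.
Qed.

Let kpos := critical_slope_gt0 hm M0 Uopt.
Let cpos := critical_mass_gt0 hm M0 Uopt.
Let cbal := critical_mass_balance hm M0 Uopt.

Lemma second_momentR_nondecreasing s t : 0 < s -> s <= t ->
  second_momentR u s <= second_momentR u t.
Proof.
move=> s0 st; rewrite -subr_ge0 -(mul0r (t - s)).
apply: (growth _ s0 st) => x x0 _ hY.
apply: (virial_ge0 hm kpos cpos d0 cbal _ hY).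
by apply: Rintegral_ge0 => y _; exact: powR_ge0.
Qed.

Lemma second_momentR_linear_growth (K : R) : 0 <= K ->
  (forall t, 0 < t -> second_momentR u t <= K) ->
  exists2 e : R, 0 < e & forall t, 1 <= t ->
    e * (t - 1) <= second_momentR u t - second_momentR u 1.
Proof.
move=> K0 bK; have m0 : 0 < m by exact: lt_trans hm.
have [l l0 hl] := power_mass_lower m0 M0 K0.
have [e e0 he] := virial_gap hm kpos cpos d0 l0 cbal.
exists e; first exact: e0.
move=> t t1; apply: (growth _ ltr01 t1) => x x0 ip hY; apply: (he _ _ hY).
have [ux0 iu ux ix] := global_slice x0.
exact: (hl _ ux0 iu ix ip ux (bK x x0)).
Qed.

(** Linear growth under a supposed bound shows only that the second moment is unbounded;
    monotonicity turns this into a limit. *)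
Lemma second_moment_diverges : second_moment (u t) @[t --> +oo] --> +oo%E.
Proof.
apply: (nondecreasing_unbounded_cvgey m2E second_momentR_nondecreasing).
exact: (linear_growth_unbounded second_momentR_ge0 second_momentR_linear_growth).
Qed.

End Gap.
End Global.

Lemma moment_divergence : power_mass m u0 < critical_mass m M -> Tw = +oo%E ->
  second_moment (u t) @[t --> +oo] --> +oo%E.
Proof.
move=> Y0 ETw.
have [J [_ [_ [hJ _ _ _]]]] := max_lim hu.
have [d d0 gap] := energy_gap hm M0 Uopt UY subcritical.
apply: (second_moment_diverges Y0 hJ _ d0 gap) => T T0.
by apply: (max_sol hu T0); rewrite ETw ltry.
Qed.

End Maximal.

End MaximalSolutions.

Theorem theorem1p5 (R : realType) (m M : R) (u0 Ustar : R -> R)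
    (hm : 3 < m)
    (hu0_ge0 : forall x, 0 <= u0 x)
    (hu0_L1 : u0 \in Lfun (@lebesgue_measure R) 1%:E)
    (hu0_H1 : sobolevH 1 u0)
    (hu0_moment : (second_moment u0 < +oo)%E)
    (hM : M = \int[@lebesgue_measure R]_x u0 x)
    (hM_gt0 : 0 < M)
    (hUstar_opt : sz_nagy_optimizer m Ustar)
    (hUstar_Y : Yset m M (Pstar m M) Ustar) :
  energy m Ustar = (m - 3) / (3 * (m + 1)) * Pstar m M `^ (m + 1) /\
  (energy m u0 < energy m Ustar ->
   forall (Tw : \bar R) (u : R -> R -> R),
     maximal_weak_entropy_solution m u0 Tw u ->
     ((Lpnorm (m + 1)%:E Ustar < Lpnorm (m + 1)%:E u0)%E ->
        exists T : R, Tw = T%:E /\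
          limf_esup (fun t => Lpnorm 2%:E (wderiv setT (u t))) T^'- = +oo%E)
     /\
     ((Lpnorm (m + 1)%:E u0 < Lpnorm (m + 1)%:E Ustar)%E ->
        Tw = +oo%E /\
        second_moment (u t) @[t --> +oo] --> +oo%E)).
Proof.
split; first exact: (optimizer_energy hm hM_gt0 hUstar_opt hUstar_Y).
move=> subcritical Tw u hu.
have u0L : L1H1 u0 by split.
have [h1 h2] := Lpnorm_critical_mass hm hM_gt0 hUstar_opt hUstar_Y hu0_ge0 u0L (esym hM).
split=> [/h1 Y0|/h2 Y0].
  exact: (blowup hm hM_gt0 hUstar_opt hUstar_Y hu0_ge0 u0L hu0_moment (esym hM) subcritical hu Y0).
have ETw := global_existence hm hM_gt0 hUstar_opt hUstar_Y hu0_ge0 u0L (esym hM) subcritical hu Y0.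
split; first exact: ETw.
exact: (moment_divergence hm hM_gt0 hUstar_opt hUstar_Y hu0_ge0 u0L hu0_moment (esym hM) subcritical hu Y0 ETw).
Qed.
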